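(* Let $\sigma>1/2$ be real. There exist a positive constant $c_\sigma$ depending only on $\sigma$ and a positive absolute constant $C$ such that for every real $T$, every finite factor-closed set $K$ of positive integers with $K^+=\max K\le T$ and $\max_{k,\ell\in K}\frac{\max(k,\ell)}{(k,\ell)}\ge c_\sigma$, and every $0\le\varepsilon<\sigma$, $$(1+C)\Big(\sum_{n\in K}\frac1{n^{2\varepsilon}}\Big)\max_{1\le t\le T}|\zeta(\sigma+it)|^2\ge\frac{\zeta(2\sigma)}2\sum_{n\in K}\frac{\sigma_{-\sigma+\varepsilon}(n)^2}{n^{2\varepsilon}}-\frac1{T^{2\sigma-1}}\Big(\sum_{\ell\in K}\frac1{\ell^\varepsilon}\Big)\Big(\sum_{k\in K}k^{1-\sigma-\varepsilon}\log(kT)\Big).$$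
   Context: $\zeta$ is the Riemann zeta function. A set $K$ of positive integers is factor-closed if $d\mid k$, $k\in K$ imply $d\in K$. For real $u$, $\sigma_u(n)=\sum_{d|n}d^u$ (a divisor function, distinguished from the real number $\sigma$ by its subscript). $(k,\ell)$ is the gcd. *)

(* Defs.v *)
From Stdlib Require Import Reals List Arith.
From Coquelicot Require Import Coquelicot.
Import ListNotations.
Open Scope R_scope.

Definition Cexp (z : C) : C := (exp (Re z) * cos (Im z), exp (Re z) * sin (Im z)).

(* n^s for a positive integer n, with the real logarithm of n. *)
Definition nat_Cpow (n : nat) (s : C) : C := Cexp (Cmult s (RtoC (ln (INR n)))).

(* Complex analyticity: [f] is the sum of a complex power series centred at
   [s0] on some disc of positive radius. *)
Definition C_analytic_at (f : C -> C) (s0 : C) : Prop :=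
  exists (a : nat -> C) (r : R), 0 < r /\
    forall s : C, Cmod (Cminus s s0) < r ->
      @is_pseries C_AbsRing C_NormedModule a (Cminus s s0) (f s).

(* The analytic continuation to C \ {1} of the Dirichlet series
   sum_(n >= 1) n^(-s), Re s > 1.  By the identity theorem this determines
   [zeta] everywhere except at the pole s = 1, where the value is arbitrary. *)
Definition is_riemann_zeta (zeta : C -> C) : Prop :=
  (forall s : C, s <> RtoC 1 -> C_analytic_at zeta s) /\
  (forall s : C, 1 < Re s ->
     @is_series C_AbsRing C_NormedModule
       (fun n : nat => nat_Cpow (S n) (Copp s)) (zeta s)).

Definition sum_over (K : list nat) (f : nat -> R) : R :=
  fold_right Rplus 0 (map f K).

(* For n = 0 this list is empty; it is only used for n >= 1. *)
Definition divisors (n : nat) : list nat :=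
  filter (fun d => Nat.eqb (n mod d) 0) (seq 1 n).

Definition sigma_div (u : R) (n : nat) : R :=
  sum_over (divisors n) (fun d => Rpower (INR d) u).

(* A finite set of positive integers, listed without repetition. *)
Definition finite_set_pos (K : list nat) : Prop :=
  NoDup K /\ forall k : nat, In k K -> (0 < k)%nat.

Definition factor_closed (K : list nat) : Prop :=
  forall d k : nat, Nat.divide d k -> In k K -> In d K.

(* [RList.MaxRlist] is the maximum of a nonempty list of reals, and 0 for the
   empty list. *)
Definition max_ratio (K : list nat) : R :=
  RList.MaxRlist
    (map (fun p : nat * nat =>
            INR (Nat.max (fst p) (snd p)) / INR (Nat.gcd (fst p) (snd p)))
         (list_prod K K)).

Definition is_maximum (E : R -> Prop) (M : R) : Prop :=
  E M /\ is_upper_bound E M.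

(* Main.v *)
(* Write c_n = n^(-eps) and b_n = n^(-eps) sigma_(eps-sigma)(n) = sum_(d | n) d^(-sigma) c_(n/d).
   One must bound max |zeta| from below by |b| / |c| (l2 norms on K), and gain a factor
   zeta(2 sigma)^(1/2) when sigma is close to 1/2; if the right-hand side is negative there is
   nothing to prove, so the error term may be used as a bound on the l1 norm of c.

   Averaged against a positive definite (Fejer) weight, zeta(sigma + it) |R(t)|^2 is a sum of
   nonnegative terms, where zeta is replaced by sum_(m <= X) m^(-s) up to a small error. Keeping
   the diagonal terms with R = |b| c + |c| b gives max |zeta| >> |b| / |c| (resonance method);
   the mean value of |R|^2 is bounded by Schur's test.

   For sigma >= 1 the ratio |b| / |c| is bounded by a multiple of sum_(m <= y) m^(-sigma),
   y = (ln T)/2, and this size is reached by the resonator prod_(2 <= m <= y) (1 + m^(it)).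
   For 1/2 < sigma < 1 the resonance is applied directly. When sigma is close to 1/2 the bound
   on the l1 norm reduces K to n <= T^delta; then one picks a block of primes in (Q, 2Q] with Q
   between ln T / lnln T and its power 3/2, passes to a fibre of K free of these primes (cheap,
   since n <= T^delta has few prime factors in the block) and multiplies the resonator by
   prod_p (1 + p^(it)), which gains more than any constant. *)

Require Import Defs.
From mathcomp Require all_boot.
From Stdlib Require Import Reals List Lra Lia Psatz Permutation Classical ClassicalEpsilon Arith.
From Coquelicot Require Import Coquelicot.
Import ListNotations.
Open Scope R_scope.

(** * Real-analytic functions on a half-line *)

(** [C0] must not depend on sigma, whereas [zeta (2 sigma)] blows up at 1/2. Losses depending on
    sigma are pushed into [c_sigma], which acts as a threshold for [T]: a quotient
    [max(k, l) / gcd(k, l)] is at most [max K <= T]. Zeta enters through an upper bound for its real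
    part on [1 <= t <= T]. The average also sees [|t| < 1], close to the pole when sigma = 1; there
    the partial sum is estimated trivially. The weight makes this region cost [O(ln T / T)], up to
    the factor that the trivial bound brings, but [|R(t)|^2] may reach the square of the l1 norm of
    the resonator, and this is why the l1 norm has to be controlled. For sigma < 1 the length [X]
    must make [T X^(-sigma)] negligible and also, against the l1 bound of size [T^(2 sigma - 1)],
    the term [X^(1 - sigma) / T]. The first asks for [X > T^(1 / sigma)], the second for [X < T^2];
    there is room between them exactly when sigma > 1/2, and [X] is taken at the midpoint exponent
    [1 + 1 / (2 sigma)]. *)

Lemma ex_series_dominated (a b : nat -> R) :
  (forall n, Rabs (a n) <= b n) -> ex_series b -> ex_series a.
Proof.
  intros H Hb. apply ex_series_Rabs.
  apply (@ex_series_le R_AbsRing R_CompleteNormedModule (fun n => Rabs (a n)) b); [|exact Hb].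
  intro n. change (Rabs (Rabs (a n)) <= b n). rewrite Rabs_Rabsolu. apply H.
Qed.

Lemma Series_abs_le (a b : nat -> R) :
  (forall n, Rabs (a n) <= b n) -> ex_series b -> Rabs (Series a) <= Series b.
Proof.
  intros H Hb.
  eapply Rle_trans; [apply Series_Rabs|].
  - apply (ex_series_dominated _ b); [|exact Hb]. intro n. rewrite Rabs_Rabsolu. apply H.
  - apply Series_le; [|exact Hb]. intro n. split; [apply Rabs_pos|apply H].
Qed.

Lemma series_tail_small (b : nat -> R) (e : R) :
  ex_series b -> 0 < e -> exists K, (0 < K)%nat /\ Rabs (Series (fun k => b (K + k)%nat)) < e.
Proof.
  intros [l Hb] He.
  pose proof (is_series_unique _ _ Hb) as Hl.
  assert (L : is_lim_seq (sum_n b) l) by exact Hb.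
  apply is_lim_seq_spec in L. destruct (L (mkposreal e He)) as [N HN]. simpl in HN.
  exists (S N). split; [lia|].
  specialize (HN N (le_n N)).
  rewrite (Series_incr_n b (S N)) in Hl; [|lia|exists l; exact Hb].
  simpl pred in Hl. rewrite <- sum_n_Reals in Hl.
  replace (Series (fun k => b (S N + k)%nat)) with (- (sum_n b N - l)) by lra.
  rewrite Rabs_Ropp. exact HN.
Qed.

Lemma tannery (d : nat -> nat -> R) (B : nat -> R) :
  (forall k, is_lim_seq (fun J => d J k) 0) ->
  (forall J k, Rabs (d J k) <= B k) -> ex_series B ->
  is_lim_seq (fun J => Series (d J)) 0.
Proof.
  intros Hlim Hdom HB.
  apply is_lim_seq_spec. intros [e He]. simpl.
  destruct (series_tail_small B (e / 2) HB ltac:(lra)) as [K [HK Htail]].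
  assert (Hfin : is_lim_seq (fun J => sum_f_R0 (d J) (pred K)) 0).
  { clear - Hlim. induction (pred K) as [|m IH].
    - simpl. apply Hlim.
    - simpl. replace (Finite 0) with (Rbar_plus 0 0) by (simpl; f_equal; lra).
      apply is_lim_seq_plus'; [exact IH | apply Hlim]. }
  apply is_lim_seq_spec in Hfin. destruct (Hfin (mkposreal (e/2) ltac:(lra))) as [N HN].
  simpl in HN. exists N. intros J HJ. specialize (HN J HJ).
  rewrite (Series_incr_n (d J) K HK).
  2:{ apply (ex_series_dominated _ B); [apply Hdom | exact HB]. }
  assert (Ht : Rabs (Series (fun k => d J (K + k)%nat)) <= Series (fun k => B (K + k)%nat)).
  { apply Series_abs_le; [intro; apply Hdom|]. apply (ex_series_incr_n B K). exact HB. }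
  pose proof (Rle_abs (Series (fun k => B (K + k)%nat))).
  rewrite Rminus_0_r in *.
  eapply Rle_lt_trans; [apply Rabs_triang|]. lra.
Qed.

Lemma sum_n_Series (b : nat -> nat -> R) (J : nat) :
  (forall j, ex_series (fun k => b k j)) ->
  ex_series (fun k => sum_n (b k) J) /\
  sum_n (fun j => Series (fun k => b k j)) J = Series (fun k => sum_n (b k) J).
Proof.
  intro H. induction J as [|J [IH1 IH2]].
  - split.
    + apply (ex_series_ext (fun k => b k O)); [|apply H]. intro k. now rewrite sum_O.
    + rewrite sum_O. apply Series_ext. intro k. now rewrite sum_O.
  - split.
    + apply (ex_series_ext (fun k => sum_n (b k) J + b k (S J))).
      * intro k. now rewrite sum_Sn.
      * apply (ex_series_plus (V := R_NormedModule)); [exact IH1 | apply H].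
    + rewrite sum_Sn, IH2. change plus with Rplus.
      rewrite <- Series_plus; [|exact IH1|apply H].
      apply Series_ext. intro k. now rewrite sum_Sn.
Qed.

(** The partial sums of row [k] stay within [2 * B k] of [h k], so [tannery] applies to the
    differences. The absolute row sums are bounded uniformly in [J], as the interchange requires. *)
Lemma double_series (b : nat -> nat -> R) (h B : nat -> R) :
  (forall k, is_series (b k) (h k)) ->
  (forall k J, sum_n (fun j => Rabs (b k j)) J <= B k) ->
  ex_series B ->
  is_series (fun j => Series (fun k => b k j)) (Series h).
Proof.
  intros Hs Hdom HB.
  assert (Hsum : forall k J, Rabs (sum_n (b k) J) <= B k).
  { intros k J. eapply Rle_trans; [|apply (Hdom k J)].
    apply (norm_sum_n_m (V := R_NormedModule)). }
  assert (Hpt : forall k j, Rabs (b k j) <= B k).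
  { intros k j. eapply Rle_trans; [|apply (Hdom k j)].
    destruct j; [rewrite sum_O; lra|]. rewrite sum_Sn. change plus with Rplus.
    enough (0 <= sum_n (fun j => Rabs (b k j)) j) by lra.
    rewrite sum_n_Reals. apply cond_pos_sum. intro; apply Rabs_pos. }
  assert (Hh : forall k, Rabs (h k) <= B k).
  { intro k. assert (L : is_lim_seq (fun J => Rabs (sum_n (b k) J)) (Rabs (h k))).
    { apply (is_lim_seq_abs _ (h k)). exact (Hs k). }
    apply (is_lim_seq_le _ (fun _ => B k) _ _ (Hsum k) L (is_lim_seq_const _)). }
  assert (Exj : forall j, ex_series (fun k => b k j)).
  { intro j. apply (ex_series_dominated _ B); [intro; apply Hpt | exact HB]. }
  assert (Exh : ex_series h) by (apply (ex_series_dominated _ B); assumption).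
  change (is_lim_seq (sum_n (fun j => Series (fun k => b k j))) (Series h)).
  apply (is_lim_seq_ext (fun J => Series (fun k => sum_n (b k) J - h k) + Series h)).
  { intro J. destruct (sum_n_Series b J Exj) as [E1 E2]. rewrite E2, Series_minus; [ring|exact E1|exact Exh]. }
  replace (Finite (Series h)) with (Finite (0 + Series h)) by (f_equal; ring).
  apply is_lim_seq_plus'; [|apply is_lim_seq_const].
  apply (tannery (fun J k => sum_n (b k) J - h k) (fun k => 2 * B k)).
  - intro k. replace (Finite 0) with (Finite (h k - h k)) by (f_equal; ring).
    apply is_lim_seq_minus'; [exact (Hs k) | apply is_lim_seq_const].
  - intros J k. unfold Rminus. eapply Rle_trans; [apply Rabs_triang|]. rewrite Rabs_Ropp.
    specialize (Hsum k J). specialize (Hh k). lra.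
  - apply (ex_series_scal_l (K := R_AbsRing) 2 B). exact HB.
Qed.

Definition real_analytic_at (f : R -> R) (u0 : R) : Prop :=
  exists (a : nat -> R) (r : R), 0 < r /\
    forall z, Rabs z < r -> is_series (fun k => a k * z ^ k) (f (u0 + z)).

Lemma real_analytic_ext (f g : R -> R) u0 :
  (forall u, f u = g u) -> real_analytic_at f u0 -> real_analytic_at g u0.
Proof.
  intros E (a & r & Hr & H). exists a, r. split; [exact Hr|]. intros z Hz. rewrite <- E. auto.
Qed.

Lemma real_analytic_plus (f g : R -> R) u0 :
  real_analytic_at f u0 -> real_analytic_at g u0 -> real_analytic_at (fun u => f u + g u) u0.
Proof.
  intros (a & r & Hr & Ha) (b & q & Hq & Hb).
  exists (fun k => a k + b k), (Rmin r q). split; [now apply Rmin_pos|].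
  intros z Hz.
  apply (is_series_ext (fun k => plus (a k * z ^ k) (b k * z ^ k))).
  - intro k. unfold plus; simpl. ring.
  - apply (is_series_plus (V := R_NormedModule)).
    + apply Ha. eapply Rlt_le_trans; [exact Hz|apply Rmin_l].
    + apply Hb. eapply Rlt_le_trans; [exact Hz|apply Rmin_r].
Qed.

Lemma real_analytic_scal (c : R) (f : R -> R) u0 :
  real_analytic_at f u0 -> real_analytic_at (fun u => c * f u) u0.
Proof.
  intros (a & r & Hr & Ha). exists (fun k => c * a k), r. split; [exact Hr|].
  intros z Hz. apply (is_series_ext (fun k => scal c (a k * z ^ k))).
  - intro k. unfold scal; simpl; unfold mult; simpl. ring.
  - apply (is_series_scal (V := R_NormedModule) c). auto.
Qed.

Lemma is_series_shift (a : nat -> R) (z l : R) :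
  is_series (fun k => a k * z ^ k) l ->
  is_series (fun k => match k with O => 0 | S j => a j end * z ^ k) (z * l).
Proof.
  intro H. apply (is_series_decr_1 (V := R_NormedModule)).
  match goal with |- is_series _ ?x => replace x with (scal z l : R) end.
  2:{ unfold plus, opp, scal; simpl; unfold mult; simpl. ring. }
  apply (is_series_ext (fun k => scal z (a k * z ^ k))).
  - intro k. unfold scal; simpl; unfold mult; simpl. ring.
  - apply (is_series_scal (V := R_NormedModule) z). exact H.
Qed.

Lemma real_analytic_mul_id (f : R -> R) u0 :
  real_analytic_at f u0 -> real_analytic_at (fun u => u * f u) u0.
Proof.
  intro Hf.
  apply (real_analytic_ext (fun u => u0 * f u + (u - u0) * f u)); [intro; ring|].
  apply real_analytic_plus; [now apply real_analytic_scal|].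
  destruct Hf as (a & r & Hr & Ha).
  exists (fun k => match k with O => 0 | S j => a j end), r. split; [exact Hr|].
  intros z Hz. replace (u0 + z - u0) with z by ring. apply is_series_shift. auto.
Qed.

Lemma real_analytic_const (c u0 : R) : real_analytic_at (fun _ => c) u0.
Proof.
  exists (fun k => match k with O => c | _ => 0 end), 1. split; [lra|]. intros z _.
  apply (is_series_decr_1 (V := R_NormedModule)).
  match goal with |- is_series _ ?x => replace x with 0 end.
  2:{ unfold plus, opp; simpl. ring. }
  apply (is_series_ext (fun _ => 0)); [intro; simpl; ring|].
  change (is_lim_seq (sum_n (fun _ : nat => 0)) 0).
  apply (is_lim_seq_ext (fun _ => 0)); [|apply is_lim_seq_const].
  intro n. rewrite sum_n_const. ring.
Qed.

Lemma CV_radius_decr_n (a : nat -> R) (n : nat) : CV_radius (PS_decr_n a n) = CV_radius a.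
Proof.
  induction n as [|n IH].
  - apply CV_radius_ext. reflexivity.
  - rewrite <- IH, <- (CV_radius_decr_1 (PS_decr_n a n)). apply CV_radius_ext.
    intro k. unfold PS_decr_n, PS_decr_1. f_equal. lia.
Qed.

Lemma CV_radius_pos (a : nat -> R) (r : R) :
  0 < r -> (forall z, Rabs z < r -> ex_series (fun k => a k * z ^ k)) ->
  Rbar_lt 0 (CV_radius a).
Proof.
  intros Hr Hex.
  assert (Rbar_le (Rabs (r / 2)) (CV_radius a)).
  { assert (E : ex_series (fun k => a k * (r/2) ^ k)) by (apply Hex; rewrite Rabs_pos_eq; lra).
    destruct (CV_radius_bounded a) as [ub _].
    rewrite Rabs_pos_eq by lra. apply ub.
    apply ex_series_lim_0 in E. apply is_lim_seq_spec in E.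
    destruct (E (mkposreal 1 Rlt_0_1)) as [N HN]. simpl in HN.
    clear - HN.
    assert (G : forall n0, exists M, forall n, (n < n0)%nat -> Rabs (a n * (r/2) ^ n) <= M).
    { intro n0. induction n0 as [|m [M HM]]; [exists 0; intros; lia|].
      exists (Rmax M (Rabs (a m * (r/2)^m))). intros n Hn.
      destruct (Nat.eq_dec n m) as [->|]; [apply Rmax_r|].
      eapply Rle_trans; [apply HM; lia|apply Rmax_l]. }
    destruct (G N) as [M HM]. exists (Rmax M 1). intro n.
    destruct (Nat.lt_ge_cases n N) as [L|L].
    - eapply Rle_trans; [apply HM, L|apply Rmax_l].
    - specialize (HN n L). rewrite Rminus_0_r in HN. eapply Rle_trans; [left; exact HN|apply Rmax_r]. }
  rewrite Rabs_pos_eq in H by lra.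
  eapply Rbar_lt_le_trans; [|exact H]. simpl. lra.
Qed.

(** Dividing by a power of [z], with the earlier coefficients already zero, leaves a power series
    continuous at 0 that vanishes for small positive [z]; its value at 0 is [a k]. Vanishing on one
    side of 0 is what the supremum argument of [identity_theorem_halfline] supplies. *)
Lemma coef_vanish (a : nat -> R) (r : R) :
  0 < r -> (forall z, Rabs z < r -> ex_series (fun k => a k * z ^ k)) ->
  (forall z, 0 < z < r -> Series (fun k => a k * z ^ k) = 0) ->
  forall k, a k = 0.
Proof.
  intros Hr Hex H0.
  pose proof (CV_radius_pos a r Hr Hex) as Hrad.
  intro k. induction k as [k IH] using lt_wf_ind.
  set (b := PS_decr_n a k).
  assert (Hb : forall z, 0 < z < r -> PSeries b z = 0).
  { intros z Hz. destruct k as [|k].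
    - unfold b. rewrite (PSeries_ext _ a); [apply H0, Hz|]. intro n. reflexivity.
    - assert (E : PSeries a z = 0) by apply H0, Hz.
      rewrite (PSeries_decr_n a k) in E.
      2:{ apply ex_pseries_R. apply Hex. rewrite Rabs_pos_eq; lra. }
      replace (sum_f_R0 (fun k => a k * z ^ k) k) with 0 in E.
      2:{ symmetry. rewrite (sum_eq _ (fun _ => 0)); [rewrite sum_cte; ring|].
          intros i Hi. rewrite IH by lia. ring. }
      rewrite Rplus_0_l in E. apply Rmult_integral in E. destruct E as [E|E]; [|exact E].
      exfalso. apply (pow_nonzero z (S k)); [lra|exact E]. }
  assert (Hc : continuity_pt (PSeries b) 0).
  { apply PSeries_continuity. unfold b. rewrite CV_radius_decr_n, Rabs_R0. exact Hrad. }
  assert (Hb0 : PSeries b 0 = a k).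
  { rewrite PSeries_0. unfold b, PS_decr_n. f_equal. lia. }
  rewrite <- Hb0. apply NNPP. intro Hne.
  destruct (Hc (Rabs (PSeries b 0)) ltac:(now apply Rabs_pos_lt)) as (d & Hd & HD).
  simpl in HD. unfold R_dist, D_x, no_cond in HD.
  set (z := Rmin (d/2) (r/2)).
  assert (0 < z) by (unfold z; apply Rmin_pos; lra).
  assert (z <= d/2) by apply Rmin_l. assert (z <= r/2) by apply Rmin_r.
  specialize (HD z). rewrite (Hb z) in HD by lra.
  rewrite !Rminus_0_l, Rabs_Ropp in HD.
  apply (Rlt_irrefl (Rabs (PSeries b 0))). apply HD.
  split; [split; [trivial|lra]|]. rewrite Rminus_0_r, Rabs_pos_eq; lra.
Qed.

(** Let [w] be the supremum of the points from [v] on where [f] does not vanish. To the right of [w]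
    the function is zero, so its expansion at [w] is zero and [f] vanishes on a left neighbourhood
    of [w] too, contrary to the choice of [w]. *)
Lemma identity_theorem_halfline (f : R -> R) :
  (forall u, 0 < u -> real_analytic_at f u) -> (forall u, 1 < u -> f u = 0) ->
  forall u, 0 < u -> f u = 0.
Proof.
  intros Ha H1 v Hv. apply NNPP. intro Hne.
  set (E := fun u => v <= u /\ f u <> 0).
  destruct (completeness E) as [w [Hub Hlub]].
  - exists 1. intros u [_ Hu]. apply Rnot_lt_le. intro. apply Hu, H1. lra.
  - exists v. split; [lra|exact Hne].
  - assert (Hvw : v <= w) by (apply Hub; split; [lra|exact Hne]).
    assert (Hz : forall u, w < u -> f u = 0).
    { intros u Hu. apply NNPP. intro N. assert (u <= w); [|lra]. apply Hub. split; [lra|exact N]. }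
    destruct (Ha w ltac:(lra)) as (a & r & Hr & Hs).
    assert (A0 : forall k, a k = 0).
    { apply (coef_vanish a r Hr).
      - intros z Hzr. eexists. apply Hs, Hzr.
      - intros z Hzr. rewrite (is_series_unique _ _ (Hs z ltac:(rewrite Rabs_pos_eq; lra))).
        apply Hz. lra. }
    assert (Hloc : forall u, w - r < u -> f u = 0).
    { intros u Hu. destruct (Rlt_dec w u) as [L|L]; [now apply Hz|].
      assert (Hs' := Hs (u - w) ltac:(rewrite Rabs_left1; lra)).
      replace (w + (u - w)) with u in Hs' by ring.
      rewrite <- (is_series_unique _ _ Hs').
      rewrite (Series_ext _ (fun _ => 0 * 0)); [rewrite Series_scal_l; ring|].
      intro k. rewrite A0. ring. }
    assert (w <= Rmax v (w - r / 2)); [|].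
    { apply Hlub. intros u [Hu1 Hu2]. apply Rnot_lt_le. intro N. apply Hu2, Hloc.
      pose proof (Rmax_r v (w - r/2)). lra. }
    unfold Rmax in H. destruct (Rle_dec v (w - r/2)); [lra|].
    assert (v = w) by lra. apply Hne, Hloc. lra.
Qed.

(** * Analytic continuation of zeta along horizontal lines *)

Lemma Rpower_pos (x y : R) : 0 < Rpower x y.
Proof. apply exp_pos. Qed.

Lemma Rpower_decr (x y a : R) : 0 < x <= y -> 0 <= a -> Rpower y (- a) <= Rpower x (- a).
Proof.
  intros H Ha. rewrite !Rpower_Ropp. apply Rinv_le_contravar; [apply Rpower_pos|].
  apply Rle_Rpower_l; lra.
Qed.

Lemma exp_le_exp (x y : R) : x <= y -> exp x <= exp y.
Proof. intros [H|H]; [left; now apply exp_increasing|right; now rewrite H]. Qed.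

Lemma ln_le_ln (x y : R) : 0 < x -> x <= y -> ln x <= ln y.
Proof. intros Hx [H|H]; [left; now apply ln_increasing|right; now rewrite H]. Qed.

Lemma ln_nonneg (x : R) : 1 <= x -> 0 <= ln x.
Proof. intro H. rewrite <- ln_1. apply ln_le_ln; lra. Qed.

Lemma sum_n_le_series (a : nat -> R) (l : R) :
  (forall n, 0 <= a n) -> is_series a l -> forall n, sum_n a n <= l.
Proof.
  intros H0 Hs n.
  apply (is_lim_seq_incr_compare (sum_n a) l Hs).
  intro k. rewrite sum_Sn. unfold plus; simpl. specialize (H0 (S k)). lra.
Qed.

Lemma is_series_exp (x : R) : is_series (fun j => x ^ j / INR (fact j)) (exp x).
Proof.
  pose proof (is_exp_Reals x) as H. apply is_pseries_R in H.
  eapply is_series_ext; [|exact H]. intro n. simpl. unfold Rdiv. apply Rmult_comm.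
Qed.

Lemma is_series_exp_neg (L z : R) :
  is_series (fun j => (-1) ^ j / INR (fact j) * L ^ j * z ^ j) (exp (- (z * L))).
Proof.
  eapply is_series_ext; [|apply is_series_exp]. intro j. simpl.
  replace (- (z * L)) with ((-1) * L * z) by ring. rewrite !Rpow_mult_distr. field.
  apply INR_fact_neq_0.
Qed.

Lemma is_series_exp_neg_lin (b L z : R) :
  is_series (fun j => (-1) ^ j / INR (fact j) * (INR j * L ^ pred j + b * L ^ j) * z ^ j)
    ((b - z) * exp (- (z * L))).
Proof.
  pose proof (is_series_exp_neg L z) as H.
  pose proof (is_series_shift _ _ _ H) as H2.
  pose proof (is_series_scal (V := R_NormedModule) b _ _ H) as H3.
  pose proof (is_series_scal (V := R_NormedModule) (-1) _ _ H2) as H4.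
  pose proof (is_series_plus (V := R_NormedModule) _ _ _ _ H3 H4) as H5.
  match type of H5 with is_series _ ?l => replace ((b - z) * exp (- (z * L))) with l end.
  2:{ unfold plus, scal; simpl; unfold mult; simpl. ring. }
  eapply is_series_ext; [|exact H5]. intro j.
  unfold plus, scal; simpl; unfold mult; simpl.
  destruct j as [|j]; [simpl; field|].
  rewrite fact_simpl, mult_INR. simpl pred. 
  change ((-1) ^ S j) with ((-1) * (-1) ^ j). change (L ^ S j) with (L * L ^ j).
  field. split; [apply INR_fact_neq_0|]. apply not_0_INR. lia.
Qed.

(* For [s = u + i t], [osc t 0 u x] and [osc t (PI / 2) u x] are the real and
   imaginary parts of [x^(1-s)], and [osc'] is the derivative in [x]; summing
   [osc_step] over [k] gives the parts of [sum_(m >= 2) (m^(1-s) - (m-1)^(1-s) + (s-1) m^(-s))]. *)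
Definition osc (t phi u x : R) : R := x * Rpower x (- u) * cos (t * ln x + phi).
Definition osc' (t phi u x : R) : R :=
  Rpower x (- u) * ((1 - u) * cos (t * ln x + phi) - t * sin (t * ln x + phi)).
Definition osc_step (t phi u : R) (k : nat) : R :=
  osc t phi u (INR (S k) + 1) - osc t phi u (INR (S k)) - osc' t phi u (INR (S k) + 1).

(* Up to the factor [(-1)^j / j!], [psi j] is the [j]-th Taylor coefficient of [osc] in [u]. *)
Definition psi (t phi u : R) (j : nat) (x : R) : R := ln x ^ j * osc t phi u x.
Definition psi' (t phi u : R) (j : nat) (x : R) : R :=
  Rpower x (- u) * ((INR j * ln x ^ pred j + (1 - u) * ln x ^ j) * cos (t * ln x + phi)
                    - t * ln x ^ j * sin (t * ln x + phi)).
Definition psi'' (t phi u : R) (j : nat) (x : R) : R :=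
  Rpower x (- u) / x *
   (- u * ((INR j * ln x ^ pred j + (1 - u) * ln x ^ j) * cos (t * ln x + phi)
                    - t * ln x ^ j * sin (t * ln x + phi))
    + (INR j * (INR (pred j) * ln x ^ pred (pred j)) + (1 - u) * (INR j * ln x ^ pred j)) * cos (t * ln x + phi)
    - t * (INR j * ln x ^ pred j + (1 - u) * ln x ^ j) * sin (t * ln x + phi)
    - t * (INR j * ln x ^ pred j) * sin (t * ln x + phi)
    - t * t * ln x ^ j * cos (t * ln x + phi)).

Lemma psi_derive t phi u j x : 0 < x -> derivable_pt_lim (psi t phi u j) x (psi' t phi u j x).
Proof.
  intro Hx. apply is_derive_Reals. unfold psi, psi', osc, Rpower.
  auto_derive; [repeat split; assumption|]. field. lra.
Qed.

Lemma psi'_derive t phi u j x : 0 < x -> derivable_pt_lim (psi' t phi u j) x (psi'' t phi u j x).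
Proof.
  intro Hx. apply is_derive_Reals. unfold psi', psi'', Rpower.
  auto_derive; [repeat split; assumption|]. field. lra.
Qed.

(** Equal to [(d/dL + B)^2] applied to [L^j], so that summation against [rho^j / j!] yields
    [(rho + B)^2 exp(rho L)]. For [j <= 1] the factors [INR j] and [INR (pred j)] cancel the terms
    with truncated exponents. *)
Definition psi_major (B L : R) (j : nat) : R :=
  INR j * INR (pred j) * L ^ pred (pred j) + 2 * B * (INR j * L ^ pred j) + B * B * L ^ j.

Lemma psi_major_mono B L L' j : 0 <= B -> 0 <= L <= L' -> psi_major B L j <= psi_major B L' j.
Proof.
  intros HB HL. unfold psi_major.
  pose proof (pos_INR j). pose proof (pos_INR (pred j)).
  pose proof (pow_incr L L' j HL). pose proof (pow_incr L L' (pred j) HL).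
  pose proof (pow_incr L L' (pred (pred j)) HL).
  repeat apply Rplus_le_compat.
  - apply Rmult_le_compat_l; [nra|assumption].
  - apply Rmult_le_compat_l; [nra|]. apply Rmult_le_compat_l; assumption.
  - apply Rmult_le_compat_l; [nra|assumption].
Qed.

Lemma Rabs_mul_unit (x c : R) : -1 <= c <= 1 -> Rabs (x * c) <= Rabs x.
Proof.
  intro H. rewrite Rabs_mult. rewrite <- (Rmult_1_r (Rabs x)) at 2.
  apply Rmult_le_compat_l; [apply Rabs_pos|]. apply Rabs_le. exact H.
Qed.

Lemma psi''_bound t phi u j x : 0 < u -> 0 <= t -> 1 <= x ->
  Rabs (psi'' t phi u j x) <= Rpower x (- u) / x * psi_major (1 + u + t) (ln x) j.
Proof.
  intros Hu Ht Hx. unfold psi''.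
  assert (HP : 0 < Rpower x (- u) / x) by (apply Rdiv_lt_0_compat; [apply Rpower_pos|lra]).
  rewrite Rabs_mult, (Rabs_pos_eq (_ / _)) by lra.
  apply Rmult_le_compat_l; [lra|].
  pose proof (ln_nonneg x Hx) as HL. set (L := ln x) in *.
  pose proof (COS_bound (t * L + phi)) as Hc. pose proof (SIN_bound (t * L + phi)) as Hs.
  set (c := cos _) in *. set (s := sin _) in *.
  pose proof (pow_le L j HL) as H0. pose proof (pow_le L (pred j) HL) as H1.
  pose proof (pow_le L (pred (pred j)) HL) as H2.
  pose proof (pos_INR j) as J0. pose proof (pos_INR (pred j)) as J1.
  unfold psi_major. set (A0 := L ^ j) in *. 
  assert (P1 : 0 <= INR j * L ^ pred j) by nra.
  assert (P2 : 0 <= INR j * INR (pred j) * L ^ pred (pred j)) by (apply Rmult_le_pos; [nra|assumption]).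
  replace (INR j * (INR (pred j) * L ^ pred (pred j))) with (INR j * INR (pred j) * L ^ pred (pred j)) by ring.
  set (A1 := INR j * L ^ pred j) in *. set (A2 := INR j * INR (pred j) * L ^ pred (pred j)) in *.
  replace (- u * ((A1 + (1 - u) * A0) * c - t * A0 * s) + (A2 + (1 - u) * A1) * c - t * (A1 + (1 - u) * A0) * s - t * A1 * s - t * t * A0 * c)
    with (A2 * c + (A1 * ((1 - 2 * u) * c) + A1 * (- 2 * t * s)) + (A0 * ((- u * (1 - u) - t * t) * c) + A0 * ((u * t - t * (1 - u)) * s))) by ring.
  assert (K1 : Rabs (A1 * ((1 - 2 * u) * c)) <= A1 * (1 + 2 * u)).
  { rewrite Rabs_mult, (Rabs_pos_eq A1) by assumption. apply Rmult_le_compat_l; [assumption|].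
    eapply Rle_trans; [apply Rabs_mul_unit; exact Hc|]. apply Rabs_le; lra. }
  assert (K2 : Rabs (A1 * (- 2 * t * s)) <= A1 * (2 * t)).
  { rewrite Rabs_mult, (Rabs_pos_eq A1) by assumption. apply Rmult_le_compat_l; [assumption|].
    eapply Rle_trans; [apply Rabs_mul_unit; exact Hs|]. apply Rabs_le; lra. }
  assert (K3 : Rabs (A0 * ((- u * (1 - u) - t * t) * c)) <= A0 * (u * (1 + u) + t * t)).
  { rewrite Rabs_mult, (Rabs_pos_eq A0) by assumption. apply Rmult_le_compat_l; [assumption|].
    eapply Rle_trans; [apply Rabs_mul_unit; exact Hc|]. apply Rabs_le; nra. }
  assert (K4 : Rabs (A0 * ((u * t - t * (1 - u)) * s)) <= A0 * (t * (1 + 2 * u))).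
  { rewrite Rabs_mult, (Rabs_pos_eq A0) by assumption. apply Rmult_le_compat_l; [assumption|].
    eapply Rle_trans; [apply Rabs_mul_unit; exact Hs|]. apply Rabs_le; nra. }
  assert (K0 : Rabs (A2 * c) <= A2).
  { eapply Rle_trans; [apply Rabs_mul_unit; exact Hc|]. rewrite Rabs_pos_eq; lra. }
  eapply Rle_trans; [apply Rabs_triang|].
  eapply Rle_trans; [apply Rplus_le_compat; [apply Rabs_triang|apply Rabs_triang]|].
  pose proof (Rabs_triang (A1 * ((1 - 2 * u) * c)) (A1 * (- 2 * t * s))) as K5.
  assert (K6 : A0 * (u * (1 + u) + t * t) + A0 * (t * (1 + 2 * u)) <= (1 + u + t) * (1 + u + t) * A0) by nra.
  assert (K7 : A1 * (1 + 2 * u) + A1 * (2 * t) <= 2 * (1 + u + t) * A1) by nra.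
  lra.
Qed.

(** Two applications of the mean value theorem turn the expression into a second derivative times a
    factor of modulus at most 1. The gain of [1 / a] makes the series over [a] converge for every
    [u > 0]. *)
Lemma psi_second_difference t phi u j a : 0 < u -> 0 <= t -> 1 <= a ->
  Rabs (psi t phi u j (a + 1) - psi t phi u j a - psi' t phi u j (a + 1))
  <= Rpower a (- u) / a * psi_major (1 + u + t) (ln (a + 1)) j.
Proof.
  intros Hu Ht Ha.
  destruct (MVT_cor2 (psi t phi u j) (psi' t phi u j) a (a + 1)) as [x [Hx1 Hx2]]; [lra| |].
  { intros; apply psi_derive; lra. }
  destruct (MVT_cor2 (psi' t phi u j) (psi'' t phi u j) x (a + 1)) as [y [Hy1 Hy2]]; [lra| |].
  { intros; apply psi'_derive; lra. }
  replace (a + 1 - a) with 1 in Hx1 by ring.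
  rewrite Hx1. replace (psi' t phi u j x * 1 - psi' t phi u j (a + 1)) with (- (psi'' t phi u j y * (a + 1 - x))) by lra.
  rewrite Rabs_Ropp. eapply Rle_trans; [apply Rabs_mul_unit; lra|].
  eapply Rle_trans; [apply psi''_bound; lra|].
  apply Rmult_le_compat.
  - left. apply Rdiv_lt_0_compat; [apply Rpower_pos|lra].
  - unfold psi_major. pose proof (ln_nonneg y ltac:(lra)).
    pose proof (pos_INR j). pose proof (pos_INR (pred j)).
    pose proof (pow_le (ln y) j H). pose proof (pow_le (ln y) (pred j) H).
    pose proof (pow_le (ln y) (pred (pred j)) H).
    repeat apply Rplus_le_le_0_compat; repeat apply Rmult_le_pos; lra.
  - apply Rmult_le_compat; [left; apply Rpower_pos|left; apply Rinv_0_lt_compat; lra| |].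
    + apply Rpower_decr; lra.
    + apply Rinv_le_contravar; lra.
  - apply psi_major_mono; [lra|]. split; [apply ln_nonneg; lra|apply ln_le_ln; lra].
Qed.

Lemma psi_major_series B L rho : 0 <= B -> 0 <= L -> 0 <= rho ->
  forall J, sum_n (fun j => rho ^ j / INR (fact j) * psi_major B L j) J
            <= (rho + B) * (rho + B) * exp (rho * L).
Proof.
  intros HB HL Hr. apply sum_n_le_series.
  - intro j. apply Rmult_le_pos.
    + apply Rmult_le_pos; [apply pow_le, Hr|left; apply Rinv_0_lt_compat, INR_fact_lt_0].
    + unfold psi_major.
      pose proof (pos_INR j). pose proof (pos_INR (pred j)).
      pose proof (pow_le L j HL). pose proof (pow_le L (pred j) HL).
      pose proof (pow_le L (pred (pred j)) HL).
      repeat apply Rplus_le_le_0_compat; repeat apply Rmult_le_pos; lra.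
  - assert (E0 : is_series (fun j => / INR (fact j) * L ^ j * rho ^ j) (exp (rho * L))).
    { eapply is_series_ext; [|apply is_series_exp]. intro j. simpl. rewrite Rpow_mult_distr. field.
      apply INR_fact_neq_0. }
    pose proof (is_series_shift _ _ _ E0) as E1.
    pose proof (is_series_shift _ _ _ E1) as E2.
    pose proof (is_series_scal (V := R_NormedModule) (B * B) _ _ E0) as F0.
    pose proof (is_series_scal (V := R_NormedModule) (2 * B) _ _ E1) as F1.
    pose proof (is_series_plus (V := R_NormedModule) _ _ _ _ E2 (is_series_plus (V := R_NormedModule) _ _ _ _ F1 F0)) as F.
    match type of F with is_series _ ?l => replace ((rho + B) * (rho + B) * exp (rho * L)) with l end.
    2:{ unfold plus, scal; simpl; unfold mult; simpl. ring. }
    eapply is_series_ext; [|exact F]. intro j.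
    unfold plus, scal; simpl; unfold mult; simpl. unfold psi_major.
    destruct j as [|[|j]]; [simpl; field|simpl; field|].
    rewrite !fact_simpl, !mult_INR. simpl pred. cbv beta iota.
    change (L ^ S (S j)) with (L * (L * L ^ j)). change (L ^ S j) with (L * L ^ j).
    field. split; [apply INR_fact_neq_0|]. split; apply not_0_INR; lia.
Qed.

Lemma Rpower_1_l (a : R) : Rpower 1 a = 1.
Proof. unfold Rpower. rewrite ln_1, Rmult_0_r. apply exp_0. Qed.

Lemma ex_series_scal_R (c : R) (a : nat -> R) : ex_series a -> ex_series (fun n => c * a n).
Proof. apply (ex_series_scal_l (K := R_AbsRing) c a). Qed.

Lemma INR_S_ge1 k : 1 <= INR (S k).
Proof. rewrite S_INR. pose proof (pos_INR k). lra. Qed.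

Lemma Rpower_telescope (kap a : R) : 0 < kap -> 1 <= a ->
  Rpower (a + 1) (- (1 + kap)) <= (Rpower a (- kap) - Rpower (a + 1) (- kap)) / kap.
Proof.
  intros Hk Ha.
  destruct (MVT_cor2 (fun x => - Rpower x (- kap)) (fun x => kap * Rpower x (- (1 + kap))) a (a + 1)) as [x [Hx1 Hx2]]; [lra| |].
  - intros c Hc. apply is_derive_Reals. unfold Rpower. auto_derive; [lra|].
    replace (- (1 + kap) * ln c) with (- kap * ln c + - ln c) by ring.
    rewrite exp_plus, exp_Ropp, exp_ln by lra. field. lra.
  - replace (a + 1 - a) with 1 in Hx1 by ring.
    replace (Rpower a (- kap) - Rpower (a + 1) (- kap)) with (kap * Rpower x (- (1 + kap))) by lra.
    replace (kap * Rpower x (- (1 + kap)) / kap) with (Rpower x (- (1 + kap))) by (field; lra).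
    apply Rpower_decr; lra.
Qed.

(** Integral comparison in telescoped form. With [X = 1] it bounds zeta at [1 + kap] by
    [1 + / kap]. *)
Lemma sum_Rpower_tail (kap : R) (X : nat) : 0 < kap -> (1 <= X)%nat -> forall N,
  sum_n (fun k => Rpower (INR (X + k)) (- (1 + kap))) N
  <= Rpower (INR X) (- (1 + kap)) + Rpower (INR X) (- kap) / kap.
Proof.
  intros Hk HX.
  assert (G : forall N, sum_n (fun k => Rpower (INR (X + k)) (- (1 + kap))) N
     <= Rpower (INR X) (- (1 + kap)) + (Rpower (INR X) (- kap) - Rpower (INR (X + N)) (- kap)) / kap).
  { induction N as [|N IH].
    - rewrite sum_O, Nat.add_0_r. unfold Rminus, Rdiv. rewrite Rplus_opp_r. lra.
    - rewrite sum_Sn. change plus with Rplus.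
      assert (E : INR (X + S N) = INR (X + N) + 1) by (rewrite <- S_INR; f_equal; lia).
      pose proof (Rpower_telescope kap (INR (X + N)) Hk) as T.
      rewrite <- E in T. specialize (T ltac:(destruct X; [lia|apply INR_S_ge1])).
      unfold Rdiv in *. nra. }
  intro N. specialize (G N). pose proof (Rpower_pos (INR (X + N)) (- kap)).
  assert (0 <= Rpower (INR (X + N)) (- kap) / kap) by (apply Rmult_le_pos; [lra|left; apply Rinv_0_lt_compat; lra]).
  unfold Rdiv in *. lra.
Qed.

Lemma ex_series_of_bounded (a : nat -> R) (M : R) :
  (forall n, 0 <= a n) -> (forall N, sum_n a N <= M) -> ex_series a.
Proof.
  intros H0 HM. destruct (ex_finite_lim_seq_incr (sum_n a) M) as [l Hl]; [|exact HM|exists l; exact Hl].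
  intro n. rewrite sum_Sn. unfold plus; simpl. specialize (H0 (S n)). lra.
Qed.

Lemma Series_le_bound (a : nat -> R) (M : R) :
  (forall n, 0 <= a n) -> (forall N, sum_n a N <= M) -> Series a <= M.
Proof.
  intros H0 HM. pose proof (ex_series_of_bounded a M H0 HM) as E.
  apply Series_correct in E. 
  exact (is_lim_seq_le _ (fun _ => M) (Series a) M HM E (is_lim_seq_const M)).
Qed.

Lemma ex_series_Rpower (kap : R) : 0 < kap -> ex_series (fun k => Rpower (INR (S k)) (- (1 + kap))).
Proof.
  intro Hk. eapply ex_series_of_bounded.
  - intro n. left. apply Rpower_pos.
  - exact (sum_Rpower_tail kap 1 Hk (le_n 1)).
Qed.

Lemma osc_step_bound t phi u k : 0 < u -> 0 <= t ->
  Rabs (osc_step t phi u k) <= (1 + u + t) * (1 + u + t) * Rpower (INR (S k)) (- (1 + u)).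
Proof.
  intros Hu Ht. pose proof (INR_S_ge1 k) as Ha.
  pose proof (psi_second_difference t phi u 0 (INR (S k)) Hu Ht Ha) as H.
  unfold psi, psi', psi_major in H. simpl pow in H. simpl pred in H. simpl (INR 0) in H.
  eapply Rle_trans; [|eapply Rle_trans; [exact H|]].
  - right. f_equal. unfold osc_step, osc'. ring.
  - right. replace (- (1 + u)) with (- u + - (1)) by ring. rewrite Rpower_plus, (Rpower_Ropp _ 1), Rpower_1 by lra.
    field. lra.
Qed.

Lemma is_series_osc_step t phi u0 z k :
  is_series (fun j => (-1) ^ j / INR (fact j)
      * (psi t phi u0 j (INR (S k) + 1) - psi t phi u0 j (INR (S k)) - psi' t phi u0 j (INR (S k) + 1)) * z ^ j)
    (osc_step t phi (u0 + z) k).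
Proof.
  pose proof (INR_S_ge1 k) as Ha. set (a := INR (S k)) in *.
  assert (E1 : forall x, 0 < x -> is_series (fun j => (-1) ^ j / INR (fact j) * psi t phi u0 j x * z ^ j) (osc t phi (u0 + z) x)).
  { intros x Hx. pose proof (is_series_scal (V := R_NormedModule) (osc t phi u0 x) _ _ (is_series_exp_neg (ln x) z)) as H.
    match type of H with is_series _ ?l => replace (osc t phi (u0 + z) x) with l end.
    - eapply is_series_ext; [|exact H]. intro j. unfold scal; simpl; unfold mult; simpl. unfold psi. ring.
    - unfold scal; simpl; unfold mult; simpl. unfold osc. replace (- (u0 + z)) with (- u0 + - z) by ring.
      rewrite Rpower_plus. unfold Rpower at 3. replace (- z * ln x) with (- (z * ln x)) by ring. ring. }
  assert (E2 : is_series (fun j => (-1) ^ j / INR (fact j) * psi' t phi u0 j (a + 1) * z ^ j) (osc' t phi (u0 + z) (a + 1))).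
  { set (x := a + 1). 
    pose proof (is_series_scal (V := R_NormedModule) (Rpower x (- u0) * cos (t * ln x + phi)) _ _ (is_series_exp_neg_lin (1 - u0) (ln x) z)) as H1.
    pose proof (is_series_scal (V := R_NormedModule) (Rpower x (- u0) * - (t * sin (t * ln x + phi))) _ _ (is_series_exp_neg (ln x) z)) as H2.
    pose proof (is_series_plus (V := R_NormedModule) _ _ _ _ H1 H2) as H.
    match type of H with is_series _ ?l => replace (osc' t phi (u0 + z) x) with l end.
    - eapply is_series_ext; [|exact H]. intro j. unfold plus, scal; simpl; unfold mult; simpl. unfold psi'. ring.
    - unfold plus, scal; simpl; unfold mult; simpl. unfold osc'. replace (- (u0 + z)) with (- u0 + - z) by ring.
      rewrite Rpower_plus. unfold Rpower at 4. replace (- z * ln x) with (- (z * ln x)) by ring. ring. }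
  pose proof (is_series_minus (V := R_NormedModule) _ _ _ _ (is_series_minus (V := R_NormedModule) _ _ _ _ (E1 (a + 1) ltac:(lra)) (E1 a ltac:(lra))) E2) as H.
  match type of H with is_series _ ?l => replace (osc_step t phi (u0 + z) k) with l end.
  - eapply is_series_ext; [|exact H]. intro j. unfold plus, opp; simpl. ring.
  - unfold plus, opp; simpl. unfold osc_step. fold a. ring.
Qed.

(** Each term is expanded in [u] and the sums are interchanged. On the disc of radius [rho = u0 / 2]
    the absolute expansion of the term at [a] is [O(a^(-u0 - 1) (a + 1)^rho)], that is
    [O(a^(-1 - rho))]: half of the decay pays for the expansion, the other half for convergence. *)
Lemma osc_sum_analytic t phi u0 : 0 < u0 -> 0 <= t ->
  real_analytic_at (fun u => Series (osc_step t phi u)) u0.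
Proof.
  intros Hu Ht.
  set (cf := fun k j => (-1) ^ j / INR (fact j)
      * (psi t phi u0 j (INR (S k) + 1) - psi t phi u0 j (INR (S k)) - psi' t phi u0 j (INR (S k) + 1))).
  exists (fun j => Series (fun k => cf k j)), (u0 / 2). split; [lra|].
  intros z Hz.
  apply (is_series_ext (fun j => Series (fun k => cf k j * z ^ j))).
  { intro j. apply Series_scal_r. }
  set (rho := u0 / 2) in *. set (B := 1 + u0 + t).
  apply (double_series _ _ (fun k => (rho + B) * (rho + B) * Rpower 2 rho * Rpower (INR (S k)) (- (1 + rho)))).
  - intro k. apply is_series_osc_step.
  - intros k J. pose proof (INR_S_ge1 k) as Ha.
    assert (HW : 0 <= Rpower (INR (S k)) (- u0) / INR (S k)) by (left; apply Rdiv_lt_0_compat; [apply Rpower_pos|lra]).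
    apply Rle_trans with (sum_n (fun j => Rpower (INR (S k)) (- u0) / INR (S k) * (rho ^ j / INR (fact j) * psi_major B (ln (INR (S k) + 1)) j)) J).
    + apply sum_n_m_le. intro j. unfold cf. rewrite !Rabs_mult, <- RPow_abs.
      unfold Rdiv at 1. rewrite Rabs_mult, <- RPow_abs. replace (Rabs (-1)) with 1 by (rewrite Rabs_left; lra). rewrite pow1.
      rewrite (Rabs_pos_eq (/ _)) by (left; apply Rinv_0_lt_compat, INR_fact_lt_0).
      pose proof (psi_second_difference t phi u0 j (INR (S k)) Hu Ht Ha) as H.
      pose proof (pow_incr (Rabs z) rho j (conj (Rabs_pos z) (Rlt_le _ _ Hz))) as Hp.
      pose proof (pow_le (Rabs z) j (Rabs_pos z)) as Hp0.
      assert (Hf : 0 < / INR (fact j)) by apply Rinv_0_lt_compat, INR_fact_lt_0.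
      set (D := Rabs (psi t phi u0 j (INR (S k) + 1) - _ - _)) in *. fold B in H.
      set (W := Rpower (INR (S k)) (- u0) / INR (S k)) in *. set (Mj := psi_major B _ j) in *.
      assert (0 <= D) by apply Rabs_pos.
      replace (W * (rho ^ j / INR (fact j) * Mj)) with (/ INR (fact j) * (W * Mj) * rho ^ j) by (unfold Rdiv; ring).
      rewrite Rmult_1_l.
      apply Rmult_le_compat; [nra|assumption| |assumption].
      apply Rmult_le_compat_l; lra.
    + rewrite (sum_n_mult_l (K := R_Ring)). set (a := INR (S k)) in *. unfold mult; simpl.
      eapply Rle_trans.
      { apply Rmult_le_compat_l; [exact HW|]. apply psi_major_series; [unfold B; lra|apply ln_nonneg; lra|unfold rho; lra]. }
      assert (E : exp (rho * ln (a + 1)) <= Rpower 2 rho * Rpower a rho).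
      { change (exp (rho * ln (a + 1))) with (Rpower (a + 1) rho). rewrite Rpower_mult_distr by lra.
        apply Rle_Rpower_l; [unfold rho; lra|]. lra. }
      assert (E2 : Rpower a (- u0) / a * Rpower a rho = Rpower a (- (1 + rho))).
      { replace (- (1 + rho)) with (- u0 + - (1) + rho) by (unfold rho; field). rewrite !Rpower_plus, (Rpower_Ropp _ 1), Rpower_1 by lra.
        unfold Rdiv. ring. }
      rewrite <- E2. set (W := Rpower a (- u0) / a) in *.
      replace ((rho + B) * (rho + B) * Rpower 2 rho * (W * Rpower a rho)) with (W * ((rho + B) * (rho + B) * (Rpower 2 rho * Rpower a rho))) by ring.
      apply Rmult_le_compat_l; [exact HW|]. apply Rmult_le_compat_l; [unfold B, rho; nra|exact E].
  - apply ex_series_scal_R. apply ex_series_Rpower. unfold rho; lra.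
Qed.

Lemma ex_series_osc_step t phi u : 0 < u -> 0 <= t -> ex_series (osc_step t phi u).
Proof.
  intros Hu Ht. eapply ex_series_dominated; [intro k; apply osc_step_bound; assumption|].
  apply ex_series_scal_R. apply ex_series_Rpower. exact Hu.
Qed.

Lemma osc_tail_bound t phi u X : 0 < u -> 0 <= t -> (1 <= X)%nat ->
  Rabs (Series (fun k => osc_step t phi u (pred X + k)%nat))
  <= (1 + u + t) * (1 + u + t) * (1 + 1 / u) * Rpower (INR X) (- u).
Proof.
  intros Hu Ht HX.
  assert (HB : 0 <= (1 + u + t) * (1 + u + t)) by nra.
  assert (Ex : ex_series (fun k => Rpower (INR (X + k)) (- (1 + u)))).
  { eapply ex_series_of_bounded; [intro; left; apply Rpower_pos|]. apply sum_Rpower_tail; assumption. }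
  eapply Rle_trans.
  { apply (Series_abs_le _ (fun k => (1 + u + t) * (1 + u + t) * Rpower (INR (X + k)) (- (1 + u)))).
    - intro k. replace (X + k)%nat with (S (pred X + k)) by lia. apply osc_step_bound; assumption.
    - apply ex_series_scal_R. exact Ex. }
  rewrite Series_scal_l, (Rmult_assoc _ (1 + 1 / u)). apply Rmult_le_compat_l; [exact HB|].
  eapply Rle_trans; [apply Series_le_bound; [intro; left; apply Rpower_pos|apply sum_Rpower_tail; assumption]|].
  assert (1 <= INR X) by (destruct X; [lia|apply INR_S_ge1]).
  assert (Rpower (INR X) (- (1 + u)) <= Rpower (INR X) (- u)) by (apply Rle_Rpower; lra).
  unfold Rdiv. lra.
Qed.

(** * Real and imaginary parts of complex series, and restriction to lines *)

Lemma sum_n_C (a : nat -> C) N :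
  sum_n a N = (sum_n (fun k => fst (a k)) N, sum_n (fun k => snd (a k)) N).
Proof.
  induction N as [|N IH].
  - rewrite !sum_O. apply surjective_pairing.
  - rewrite !sum_Sn, IH. reflexivity.
Qed.

Lemma is_series_C_parts (a : nat -> C) (l : C) :
  @is_series C_AbsRing C_NormedModule a l ->
  is_series (fun k => fst (a k)) (fst l) /\ is_series (fun k => snd (a k)) (snd l).
Proof.
  intro H.
  assert (G : forall e : posreal, eventually (fun N => Rabs (fst (sum_n a N) - fst l) < e /\ Rabs (snd (sum_n a N) - snd l) < e)).
  { intro e.
    pose proof (H (fun z => Rabs (fst z - fst l) < e /\ Rabs (snd z - snd l) < e)) as K.
    apply K. apply (locally_le_locally_norm (K := C_AbsRing) (V := C_NormedModule)).
    exists e. intros y Hy. unfold ball_norm in Hy. simpl in Hy.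
    change (Cmod (Cminus y l) < e) in Hy.
    split; (eapply Rle_lt_trans; [|exact Hy]).
    - eapply Rle_trans; [|apply (Rmax_Cmod (Cminus y l))]. apply Rmax_l.
    - eapply Rle_trans; [|apply (Rmax_Cmod (Cminus y l))]. apply Rmax_r. }
  split.
  - change (is_lim_seq (sum_n (fun k => fst (a k))) (fst l)).
    apply is_lim_seq_spec. intro e. destruct (G e) as [N HN]. exists N. intros n Hn.
    specialize (HN n Hn). rewrite sum_n_C in HN. apply HN.
  - change (is_lim_seq (sum_n (fun k => snd (a k))) (snd l)).
    apply is_lim_seq_spec. intro e. destruct (G e) as [N HN]. exists N. intros n Hn.
    specialize (HN n Hn). rewrite sum_n_C in HN. apply HN.
Qed.

Lemma pow_n_RtoC_mult (z : R) (w : C) k :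
  pow_n (K := C_AbsRing) (Cmult (RtoC z) w) k = Cmult (RtoC (z ^ k)) (pow_n (K := C_AbsRing) w k).
Proof.
  induction k as [|k IH]; [simpl; unfold one; simpl; unfold Cmult, RtoC; simpl; f_equal; ring|].
  simpl pow_n. rewrite IH. change (@mult C_AbsRing) with Cmult.
  simpl pow. rewrite RtoC_mult. match goal with |- ?a = ?b => change (@eq C a b) end. ring.
Qed.

(** Along [s0 + z w] the coefficients become [w^k a k]. The horizontal direction serves the identity
    theorem, the vertical direction [Ci] the continuity of zeta on the line of abscissa [sigma]. *)
Lemma C_analytic_along (f : C -> C) (s0 w : C) :
  Cmod w = 1 -> C_analytic_at f s0 ->
  real_analytic_at (fun z => fst (f (Cplus s0 (Cmult (RtoC z) w)))) 0 /\
  real_analytic_at (fun z => snd (f (Cplus s0 (Cmult (RtoC z) w)))) 0.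
Proof.
  intros Hw (a & r & Hr & H).
  set (b := fun k => Cmult (pow_n (K := C_AbsRing) w k) (a k)).
  assert (G : forall z, Rabs z < r ->
     is_series (fun k => fst (b k) * z ^ k) (fst (f (Cplus s0 (Cmult (RtoC (0 + z)) w)))) /\
     is_series (fun k => snd (b k) * z ^ k) (snd (f (Cplus s0 (Cmult (RtoC (0 + z)) w))))).
  { intros z Hz. rewrite Rplus_0_l.
    assert (E : Cminus (Cplus s0 (Cmult (RtoC z) w)) s0 = Cmult (RtoC z) w) by ring.
    specialize (H (Cplus s0 (Cmult (RtoC z) w))).
    rewrite E, Cmod_mult, Hw, Cmod_R, Rmult_1_r in H. specialize (H Hz).
    apply is_series_C_parts in H. destruct H as [H1 H2].
    split; eapply is_series_ext; [|exact H1| |exact H2]; intro k; cbv beta;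
      rewrite pow_n_RtoC_mult; change (@scal C_AbsRing C_NormedModule) with Cmult;
      unfold b; destruct (pow_n w k), (a k); unfold Cmult, RtoC; simpl; ring. }
  split; [exists (fun k => fst (b k)), r|exists (fun k => snd (b k)), r]; (split; [exact Hr|]); intros z Hz; apply G, Hz.
Qed.

Lemma C_analytic_line (f : C -> C) (u0 t : R) :
  C_analytic_at f (u0, t) ->
  real_analytic_at (fun u => fst (f (u, t))) u0 /\ real_analytic_at (fun u => snd (f (u, t))) u0.
Proof.
  intro H. destruct (C_analytic_along f (u0, t) (RtoC 1) Cmod_1 H) as [H1 H2].
  assert (E : forall z, Cplus (u0, t) (Cmult (RtoC z) (RtoC 1)) = (u0 + z, t)).
  { intro z. unfold Cplus, Cmult, RtoC. simpl. f_equal; ring. }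
  split; [destruct H1 as (a & r & Hr & K)|destruct H2 as (a & r & Hr & K)];
    exists a, r; (split; [exact Hr|]); intros z Hz; specialize (K z Hz);
    rewrite E, Rplus_0_l in K; exact K.
Qed.

Lemma real_analytic_continuous (f : R -> R) u0 : real_analytic_at f u0 -> continuity_pt f u0.
Proof.
  intros (a & r & Hr & H).
  apply (continuity_pt_ext_loc (fun u => PSeries a (u - u0))).
  { exists (mkposreal r Hr). intros y Hy. change (Rabs (y - u0) < r) in Hy.
    specialize (H (y - u0) Hy). assert (E : forall v : R, u0 + (v - u0) = v) by (intro; ring). rewrite (E y) in H.
    apply is_series_unique in H. exact H. }
  apply (continuity_pt_comp (fun u => u - u0) (PSeries a)).
  - apply continuity_pt_minus; [apply continuity_pt_id|apply continuity_pt_const; intros ? ?; reflexivity].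
  - replace (u0 - u0) with 0 by ring. apply PSeries_continuity. rewrite Rabs_R0.
    apply (CV_radius_pos a r Hr). intros z Hz. eexists. apply H, Hz.
Qed.

Lemma zeta_vertical_maximum (zeta : C -> C) (sigma T : R) :
  is_riemann_zeta zeta -> 1 <= T ->
  exists M, is_maximum (fun y => exists t, 1 <= t <= T /\ y = Cmod (zeta (sigma, t)) ^ 2) M.
Proof.
  intros [Hz _] HT.
  destruct (continuity_ab_maj (fun t => Cmod (zeta (sigma, t)) ^ 2) 1 T HT) as [x [Hx1 Hx2]].
  - intros t Ht.
    apply (continuity_pt_ext (fun t => fst (zeta (sigma, t)) * fst (zeta (sigma, t)) + snd (zeta (sigma, t)) * snd (zeta (sigma, t)))).
    { intro y. unfold Cmod. rewrite pow2_sqrt; [ring|]. pose proof (pow2_ge_0 (fst (zeta (sigma, y)))).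
      pose proof (pow2_ge_0 (snd (zeta (sigma, y)))). lra. }
    destruct (C_analytic_along zeta (sigma, t) Ci) as [H1 H2].
    { unfold Cmod, Ci. simpl. replace (_ + _) with 1 by ring. apply sqrt_1. }
    { apply Hz. intro E. apply (f_equal snd) in E. simpl in E. lra. }
    assert (E : forall z, Cplus (sigma, t) (Cmult (RtoC z) Ci) = (sigma, t + z)).
    { intro z. unfold Cplus, Cmult, RtoC, Ci. simpl. f_equal; ring. }
    assert (C1 : continuity_pt (fun t => fst (zeta (sigma, t))) t).
    { apply real_analytic_continuous. destruct H1 as (a & r & Hr & K).
      exists a, r. split; [exact Hr|]. intros z Hz'. specialize (K z Hz'). rewrite E, Rplus_0_l in K. exact K. }
    assert (C2 : continuity_pt (fun t => snd (zeta (sigma, t))) t).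
    { apply real_analytic_continuous. destruct H2 as (a & r & Hr & K).
      exists a, r. split; [exact Hr|]. intros z Hz'. specialize (K z Hz'). rewrite E, Rplus_0_l in K. exact K. }
    apply continuity_pt_plus; apply continuity_pt_mult; assumption.
  - exists (Cmod (zeta (sigma, x)) ^ 2). split; [exists x; split; [exact Hx2|reflexivity]|].
    intros y (t & Ht & ->). apply Hx1, Ht.
Qed.

(** * The continued identity for (s - 1) zeta(s) and truncation of the Dirichlet series *)

Lemma lim_Rpower_neg (kap : R) : 0 < kap -> is_lim_seq (fun n => Rpower (INR (S n)) (- kap)) 0.
Proof.
  intro Hk. apply is_lim_seq_spec. intros [e He]. simpl.
  destruct (nfloor_ex (Rpower e (- / kap))) as [N HN]; [left; apply Rpower_pos|].
  exists N. intros n Hn. rewrite Rminus_0_r, Rabs_pos_eq by (left; apply Rpower_pos).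
  assert (Hlt : Rpower e (- / kap) < INR (S n)).
  { apply Rlt_le_trans with (INR N + 1); [apply HN|]. rewrite S_INR. apply le_INR in Hn. lra. }
  rewrite Rpower_Ropp.
  assert (K : / e < Rpower (INR (S n)) kap).
  { replace (/ e) with (Rpower (Rpower e (- / kap)) kap).
    - apply Rlt_Rpower_l; [exact Hk|]. split; [apply Rpower_pos|exact Hlt].
    - rewrite Rpower_mult. replace (- / kap * kap) with (- (1)) by (field; lra).
      rewrite Rpower_Ropp, Rpower_1; auto. }
  rewrite <- (Rinv_inv e). apply Rinv_lt_contravar; [|exact K].
  apply Rmult_lt_0_compat; [apply Rinv_0_lt_compat, He|apply Rpower_pos].
Qed.

Lemma zeta_series_parts (zeta : C -> C) (u t : R) : is_riemann_zeta zeta -> 1 < u ->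
  is_series (fun n => Rpower (INR (S n)) (- u) * cos (t * ln (INR (S n)))) (fst (zeta (u, t))) /\
  is_series (fun n => - (Rpower (INR (S n)) (- u) * sin (t * ln (INR (S n))))) (snd (zeta (u, t))).
Proof.
  intros [_ Hz] Hu. specialize (Hz (u, t) Hu). apply is_series_C_parts in Hz.
  destruct Hz as [H1 H2].
  split; eapply is_series_ext; [|exact H1| |exact H2]; intro k; cbv beta;
    unfold nat_Cpow, Cexp, Cmult, Copp, RtoC; cbn [fst snd Re Im].
  - f_equal; [unfold Rpower; f_equal; ring|].
    rewrite <- cos_neg. f_equal. ring.
  - rewrite <- Ropp_mult_distr_r_reverse. f_equal; [unfold Rpower; f_equal; ring|].
    rewrite <- sin_neg. f_equal. ring.
Qed.

(** Telescoping. The sum of [osc'] on the right starts at 1 to match the Dirichlet series, while the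
    first derivative in [osc_step] is taken at 2; the last summand corrects this. *)
Lemma sum_osc_step t phi u N :
  sum_n (osc_step t phi u) N
  = osc t phi u (INR (S (S N))) - cos phi + (sum_n (fun n => - osc' t phi u (INR (S n))) (S N) + osc' t phi u 1).
Proof.
  induction N as [|N IH].
  - rewrite sum_Sn, !sum_O. unfold plus; simpl plus. unfold osc_step. rewrite <- (S_INR 1).
    unfold osc at 2. change (INR 1) with 1. rewrite ln_1, Rmult_0_r, Rplus_0_l, Rpower_1_l. simpl. ring.
  - rewrite sum_Sn, IH, (sum_Sn _ (S N)). unfold plus; simpl plus. unfold osc_step.
    rewrite <- !(S_INR (S (S N))). unfold Hierarchy.plus; simpl. ring.
Qed.

(** The real part, after multiplication by [exp(- i phi)], of [(s - 1) zeta(s) = s + sum_(m >= 2)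
    (m^(1-s) - (m-1)^(1-s) + (s-1) m^(-s))] at [s = u + i t]. The free phase covers real and
    imaginary parts in one statement. *)
Lemma zeta_identity_right (zeta : C -> C) (u t phi : R) : is_riemann_zeta zeta -> 1 < u -> 0 <= t ->
  (u - 1) * (cos phi * fst (zeta (u, t)) + sin phi * snd (zeta (u, t)))
  + t * (sin phi * fst (zeta (u, t)) - cos phi * snd (zeta (u, t)))
  = u * cos phi + t * sin phi + Series (osc_step t phi u).
Proof.
  intros Hz Hu Ht. destruct (zeta_series_parts zeta u t Hz Hu) as [H1 H2].
  set (L := (u - 1) * _ + t * _).
  assert (HL : is_series (fun n => - osc' t phi u (INR (S n))) L).
  { pose proof (is_series_scal (V := R_NormedModule) ((u - 1) * cos phi + t * sin phi) _ _ H1) as A1.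
    pose proof (is_series_scal (V := R_NormedModule) ((u - 1) * sin phi - t * cos phi) _ _ H2) as A2.
    pose proof (is_series_plus (V := R_NormedModule) _ _ _ _ A1 A2) as A.
    match type of A with is_series _ ?l => replace L with l end.
    - eapply is_series_ext; [|exact A]. intro n. unfold osc'.
      set (x := INR (S n)). rewrite cos_plus, sin_plus.
      unfold plus, scal; simpl; unfold mult; simpl. ring.
    - unfold L, plus, scal; simpl; unfold mult; simpl. ring. }
  assert (Hs : is_series (osc_step t phi u) (0 - cos phi + (L + osc' t phi u 1))).
  { change (is_lim_seq (sum_n (osc_step t phi u)) (0 - cos phi + (L + osc' t phi u 1))).
    eapply is_lim_seq_ext; [intro N; symmetry; apply sum_osc_step|].
    apply is_lim_seq_plus'; [apply is_lim_seq_minus'; [|apply is_lim_seq_const]|].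
    - apply (is_lim_seq_incr_1 (fun N => osc t phi u (INR (S N)))).
      apply (is_lim_seq_le_le (fun N => - Rpower (INR (S N)) (- (u - 1))) _ (fun N => Rpower (INR (S N)) (- (u - 1)))).
      + intro N. set (x := INR (S N)). assert (Hx : 1 <= x) by apply INR_S_ge1.
        assert (E : x * Rpower x (- u) = Rpower x (- (u - 1))).
        { rewrite <- (Rpower_1 x) at 1 by lra. rewrite <- Rpower_plus. f_equal. ring. }
        unfold osc. rewrite E. pose proof (COS_bound (t * ln x + phi)). pose proof (Rpower_pos x (- (u - 1))). nra.
      + replace (Finite 0) with (Rbar_opp 0) by (simpl; f_equal; ring).
        apply -> is_lim_seq_opp. apply lim_Rpower_neg. lra.
      + apply lim_Rpower_neg. lra.
    - apply is_lim_seq_plus'; [|apply is_lim_seq_const].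
      apply (is_lim_seq_incr_1 (sum_n (fun n => - osc' t phi u (INR (S n))))). exact HL. }
  rewrite (is_series_unique _ _ Hs). unfold osc'. rewrite ln_1, Rmult_0_r, Rplus_0_l, Rpower_1_l. ring.
Qed.

(** Since [t > 0] keeps the horizontal half-line off the pole, both sides are real analytic in [u],
    and the identity continues from [u > 1] to [u > 0]. *)
Lemma zeta_identity (zeta : C -> C) (u t phi : R) : is_riemann_zeta zeta -> 0 < u -> 0 < t ->
  (u - 1) * (cos phi * fst (zeta (u, t)) + sin phi * snd (zeta (u, t)))
  + t * (sin phi * fst (zeta (u, t)) - cos phi * snd (zeta (u, t)))
  = u * cos phi + t * sin phi + Series (osc_step t phi u).
Proof.
  intros Hz Hu Ht.
  (* Written with sums, scalar multiples and multiplication by [v] only, the operations under which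
     analyticity was shown to be stable. *)
  set (D := fun v => v * (cos phi * fst (zeta (v, t)) + sin phi * snd (zeta (v, t)))
    + (-1) * (cos phi * fst (zeta (v, t)) + sin phi * snd (zeta (v, t)))
    + t * (sin phi * fst (zeta (v, t)) + (- cos phi) * snd (zeta (v, t)))
    + (-1) * (v * cos phi + t * sin phi + Series (osc_step t phi v))).
  assert (HD : D u = 0).
  { apply (identity_theorem_halfline D); [| |exact Hu].
    - intros v Hv.
      destruct (C_analytic_line zeta v t) as [A1 A2].
      { apply Hz. intro E. apply (f_equal snd) in E. simpl in E. lra. }
      unfold D.
      repeat first [ apply real_analytic_plus | apply real_analytic_scal | apply real_analytic_mul_id | assumption
                   | apply real_analytic_const | apply osc_sum_analytic; lra].
    - intros v Hv. pose proof (zeta_identity_right zeta v t phi Hz Hv ltac:(lra)) as E. unfold D. lra. }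
  unfold D in HD. lra.
Qed.

Definition dirichlet_cos (s : R) (X : nat) (t : R) : R :=
  sum_n_m (fun m => Rpower (INR m) (- s) * cos (t * ln (INR m))) 1 X.

(** With [w = s + i t], cutting the series of [zeta_identity] at [X] gives [(w - 1) (zeta(w) -
    sum_(m <= X) m^(-w)) = X^(1-w) + tail], where the tail is [O(t^2 X^(-s))]. Division by [w - 1],
    of modulus at least [t], produces the two error terms. *)
Lemma zeta_re_approx (zeta : C -> C) (s t : R) (X : nat) :
  is_riemann_zeta zeta -> 0 < s -> 1 <= t -> (1 <= X)%nat ->
  dirichlet_cos s X t <= fst (zeta (s, t)) + 2 * Rpower (INR X) (1 - s) / t
     + 2 * (2 + s) ^ 2 * (1 + 1 / s) * t * Rpower (INR X) (- s).
Proof.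
  intros Hz Hs Ht HX.
  set (F2 := sum_n_m (fun m => Rpower (INR m) (- s) * sin (t * ln (INR m))) 1 X).
  set (tail := fun phi => Series (fun k => osc_step t phi s (pred X + k)%nat)).
  assert (K : forall phi,
    (s - 1) * (cos phi * (fst (zeta (s, t)) - dirichlet_cos s X t) + sin phi * (snd (zeta (s, t)) + F2))
    + t * (sin phi * (fst (zeta (s, t)) - dirichlet_cos s X t) - cos phi * (snd (zeta (s, t)) + F2))
    = osc t phi s (INR X) + tail phi).
  { intro phi.
    assert (E : Series (osc_step t phi s) =
       osc t phi s (INR X) - cos phi + (sum_n_m (fun n => - osc' t phi s (INR n)) 1 X + osc' t phi s 1) + tail phi).
    { destruct X as [|[|X]]; [lia| |].
      - rewrite sum_n_n. unfold tail. simpl pred. cbn [Nat.add]. unfold osc.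
        change (INR 1) with 1. rewrite ln_1, Rmult_0_r, Rplus_0_l, Rpower_1_l.
        rewrite (Series_ext (fun k => osc_step t phi s k) (osc_step t phi s)) by reflexivity. ring.
      - rewrite (Series_incr_n (osc_step t phi s) (S X)); [|lia|apply ex_series_osc_step; lra].
        simpl (pred (S X)). rewrite <- sum_n_Reals, sum_osc_step.
        rewrite <- (sum_n_m_S (fun n => - osc' t phi s (INR n)) 0 (S X)). reflexivity. }
    pose proof (zeta_identity zeta s t phi Hz Hs ltac:(lra)) as I. rewrite E in I.
    assert (S1 : sum_n_m (fun n => - osc' t phi s (INR n)) 1 X
      = ((s - 1) * cos phi + t * sin phi) * dirichlet_cos s X t + (t * cos phi - (s - 1) * sin phi) * F2).
    { unfold dirichlet_cos, F2.
      rewrite <- (sum_n_m_mult_l (K := R_Ring) (_ + _)), <- (sum_n_m_mult_l (K := R_Ring) (_ - _)).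
      rewrite <- (sum_n_m_plus (G := R_AbelianMonoid)). apply sum_n_m_ext. intro n.
      unfold mult, plus; simpl. unfold osc'. rewrite cos_plus, sin_plus. ring. }
    assert (S2 : osc' t phi s 1 = (1 - s) * cos phi - t * sin phi).
    { unfold osc'. rewrite ln_1, Rmult_0_r, Rplus_0_l, Rpower_1_l. ring. }
    rewrite S1, S2 in I. lra. }
  pose proof (K 0) as K0. pose proof (K (PI / 2)) as K1.
  rewrite cos_0, sin_0 in K0. rewrite cos_PI2, sin_PI2 in K1.
  set (p := fst (zeta (s, t)) - dirichlet_cos s X t) in *. set (q := snd (zeta (s, t)) + F2) in *.
  assert (HX1 : 1 <= INR X) by (destruct X; [lia|apply INR_S_ge1]).
  set (W := (1 + s + t) * (1 + s + t) * (1 + 1 / s) * Rpower (INR X) (- s)).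
  set (Y := Rpower (INR X) (1 - s)).
  assert (HB : forall phi, Rabs (osc t phi s (INR X) + tail phi) <= Y + W).
  { intro phi. eapply Rle_trans; [apply Rabs_triang|]. apply Rplus_le_compat.
    - unfold osc. eapply Rle_trans; [apply Rabs_mul_unit; apply COS_bound|].
      replace (INR X * Rpower (INR X) (- s)) with Y.
      + rewrite Rabs_pos_eq; [lra|left; apply Rpower_pos].
      + unfold Y. rewrite <- (Rpower_1 (INR X)) at 2 by lra. rewrite <- Rpower_plus. f_equal. 
    - apply osc_tail_bound; try lra. exact HX. }
  pose proof (HB 0) as B0. pose proof (HB (PI / 2)) as B1. rewrite <- K0 in B0. rewrite <- K1 in B1.
  set (al := (s - 1) * (1 * p + 0 * q) + t * (0 * p - 1 * q)) in *.
  set (be := (s - 1) * (0 * p + 1 * q) + t * (1 * p - 0 * q)) in *.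
  (* [al + i be = (s - 1 + i t) (p + i q)]; multiplication by the conjugate of the first factor
     isolates [p]. *)
  assert (Hp : p * ((s - 1) ^ 2 + t ^ 2) = (s - 1) * al + t * be) by (unfold al, be; ring).
  assert (HYW : 0 <= Y + W) by (eapply Rle_trans; [apply Rabs_pos|exact B0]).
  assert (Hpl : - p * t <= 2 * (Y + W)).
  { assert (Q : - p * ((s - 1) ^ 2 + t ^ 2) * t <= 2 * (Y + W) * ((s - 1) ^ 2 + t ^ 2)).
    { replace (- p * ((s - 1) ^ 2 + t ^ 2) * t) with (- ((s - 1) * t) * al - t ^ 2 * be) by (replace (- p * ((s - 1) ^ 2 + t ^ 2) * t) with (- (p * ((s - 1) ^ 2 + t ^ 2)) * t) by ring; rewrite Hp; ring).
      apply Rabs_le_between in B0. apply Rabs_le_between in B1.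
      assert (M1 : - ((s - 1) * t) * al <= Rabs ((s - 1) * t) * (Y + W)).
      { eapply Rle_trans; [apply Rle_abs|]. rewrite Rabs_mult, Rabs_Ropp.
        apply Rmult_le_compat_l; [apply Rabs_pos|]. apply Rabs_le. exact B0. }
      assert (M2 : Rabs ((s - 1) * t) <= (s - 1) ^ 2 + t ^ 2) by (pose proof (pow2_ge_0 ((s - 1) - t)); pose proof (pow2_ge_0 ((s - 1) + t)); pose proof (pow2_ge_0 (s - 1)); pose proof (pow2_ge_0 t); apply Rabs_le; split; lra).
      assert (M3 : - t ^ 2 * be <= t ^ 2 * (Y + W)) by (pose proof (pow2_ge_0 t); assert (t ^ 2 * (- be) <= t ^ 2 * (Y + W)) by (apply Rmult_le_compat_l; lra); lra).
      assert (M4 : t ^ 2 * (Y + W) <= ((s - 1) ^ 2 + t ^ 2) * (Y + W)) by (apply Rmult_le_compat_r; [exact HYW|]; pose proof (pow2_ge_0 (s - 1)); lra).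
      assert (M5 : Rabs ((s - 1) * t) * (Y + W) <= ((s - 1) ^ 2 + t ^ 2) * (Y + W)) by (apply Rmult_le_compat_r; assumption).
      lra. }
    assert (0 < (s - 1) ^ 2 + t ^ 2) by (pose proof (pow2_ge_0 (s - 1)); assert (0 < t ^ 2) by (apply pow_lt; lra); lra).
    apply (Rmult_le_reg_r ((s - 1) ^ 2 + t ^ 2)); [assumption|]. lra. }
  assert (HW : W <= (2 + s) ^ 2 * (1 + 1 / s) * t * t * Rpower (INR X) (- s)).
  { unfold W. pose proof (Rpower_pos (INR X) (- s)). apply Rmult_le_compat_r; [lra|].
    assert (0 < 1 + 1 / s) by (assert (0 < 1 / s) by (apply Rdiv_lt_0_compat; lra); lra).
    replace ((2 + s) ^ 2 * (1 + 1 / s) * t * t) with (((2 + s) * t) * ((2 + s) * t) * (1 + 1 / s)) by ring.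
    apply Rmult_le_compat_r; [lra|]. apply Rmult_le_compat; nra. }
  assert (- p <= 2 * (Y + W) / t).
  { apply (Rmult_le_reg_r t); [lra|]. unfold Rdiv. rewrite Rmult_assoc, Rinv_l by lra. lra. }
  assert (2 * W / t <= 2 * (2 + s) ^ 2 * (1 + 1 / s) * t * Rpower (INR X) (- s)).
  { apply (Rmult_le_reg_r t); [lra|]. unfold Rdiv at 1. rewrite Rmult_assoc, Rinv_l by lra. lra. }
  unfold p in H. fold Y. unfold Rdiv in *. lra.
Qed.

(** * Finite sums over lists *)

(** Convertible to [sum_over] on lists of [nat]; polymorphic because resonators are lists of
    pairs. *)
Definition lsum {A : Type} (l : list A) (f : A -> R) : R := fold_right Rplus 0 (map f l).

Lemma lsum_cons {A} (x : A) l f : lsum (x :: l) f = f x + lsum l f.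
Proof. reflexivity. Qed.

Lemma lsum_app {A} (l l' : list A) f : lsum (l ++ l') f = lsum l f + lsum l' f.
Proof.
  induction l as [|x l IH]; [unfold lsum; simpl; ring|]. simpl. rewrite !lsum_cons, IH. ring.
Qed.

Lemma lsum_ext {A} (l : list A) f g : (forall x, In x l -> f x = g x) -> lsum l f = lsum l g.
Proof.
  induction l as [|x l IH]; intro H; [reflexivity|]. rewrite !lsum_cons, H by (left; reflexivity).
  rewrite IH; [reflexivity|]. intros y Hy. apply H. right. exact Hy.
Qed.

Lemma lsum_le {A} (l : list A) f g : (forall x, In x l -> f x <= g x) -> lsum l f <= lsum l g.
Proof.
  induction l as [|x l IH]; intro H; [unfold lsum; simpl; lra|]. rewrite !lsum_cons.
  apply Rplus_le_compat; [apply H; left; reflexivity|]. apply IH. intros y Hy. apply H. right. exact Hy.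
Qed.

Lemma lsum_0 {A} (l : list A) : lsum l (fun _ => 0) = 0.
Proof. induction l as [|x l IH]; [reflexivity|]. rewrite lsum_cons, IH. ring. Qed.

Lemma lsum_nonneg {A} (l : list A) f : (forall x, In x l -> 0 <= f x) -> 0 <= lsum l f.
Proof. intro H. rewrite <- (lsum_0 l). apply lsum_le. exact H. Qed.

Lemma lsum_plus {A} (l : list A) f g : lsum l (fun x => f x + g x) = lsum l f + lsum l g.
Proof. induction l as [|x l IH]; [unfold lsum; simpl; ring|]. rewrite !lsum_cons, IH. ring. Qed.

Lemma lsum_scal {A} (l : list A) c f : lsum l (fun x => c * f x) = c * lsum l f.
Proof. induction l as [|x l IH]; [unfold lsum; simpl; ring|]. rewrite !lsum_cons, IH. ring. Qed.

Lemma lsum_scal_r {A} (l : list A) c f : lsum l (fun x => f x * c) = lsum l f * c.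
Proof. rewrite Rmult_comm, <- lsum_scal. apply lsum_ext. intros; ring. Qed.

Lemma lsum_const {A} (l : list A) c : lsum l (fun _ => c) = INR (length l) * c.
Proof.
  induction l as [|x l IH]; [unfold lsum; simpl; ring|]. rewrite lsum_cons, IH.
  change (length (x :: l)) with (S (length l)). rewrite S_INR. ring.
Qed.

Lemma lsum_map {A B} (g : A -> B) l f : lsum (map g l) f = lsum l (fun x => f (g x)).
Proof. unfold lsum. now rewrite map_map. Qed.

Lemma lsum_swap {A B} (l : list A) (l' : list B) f :
  lsum l (fun x => lsum l' (fun y => f x y)) = lsum l' (fun y => lsum l (fun x => f x y)).
Proof.
  induction l as [|x l IH].
  - unfold lsum at 1; simpl. symmetry. apply (lsum_0 l').
  - rewrite lsum_cons, IH, <- lsum_plus. apply lsum_ext. intros; now rewrite lsum_cons.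
Qed.

Lemma lsum_list_prod {A B} (l : list A) (l' : list B) f :
  lsum (list_prod l l') f = lsum l (fun x => lsum l' (fun y => f (x, y))).
Proof.
  induction l as [|x l IH]; [reflexivity|]. simpl. rewrite lsum_app, lsum_map, IH. reflexivity.
Qed.

Lemma lsum_perm {A} (l l' : list A) f : Permutation l l' -> lsum l f = lsum l' f.
Proof.
  induction 1; rewrite ?lsum_cons; try lra.
Qed.

Lemma lsum_filter {A} (p : A -> bool) l f :
  lsum (filter p l) f = lsum l (fun x => if p x then f x else 0).
Proof.
  induction l as [|x l IH]; [reflexivity|]. simpl. rewrite lsum_cons.
  destruct (p x); rewrite ?lsum_cons, IH; ring.
Qed.

Lemma lsum_incl {A} (l l' : list A) f :
  NoDup l -> incl l l' -> (forall x, In x l' -> 0 <= f x) -> lsum l f <= lsum l' f.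
Proof.
  revert l'. induction l as [|x l IH]; intros l' Hn Hi Hf.
  - apply lsum_nonneg. exact Hf.
  - inversion Hn as [|? ? Hx Hn']; subst.
    destruct (in_split x l') as (l1 & l2 & ->); [apply Hi; left; reflexivity|].
    rewrite (lsum_perm (l1 ++ x :: l2) (x :: l1 ++ l2)) by (symmetry; apply Permutation_middle).
    rewrite !lsum_cons. apply Rplus_le_compat_l. apply IH; [exact Hn'| |].
    + intros y Hy. assert (In y (l1 ++ x :: l2)) as H by (apply Hi; right; exact Hy).
      apply in_app_or in H. apply in_or_app. destruct H as [H|[H|H]]; [now left| |now right].
      subst. contradiction.
    + intros y Hy. apply Hf. apply in_app_or in Hy. apply in_or_app. destruct Hy; [now left|right; now right].
Qed.

(** For upper bounds through a parametrisation that may reach an index several times, such as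
    writing a divisor of [a * b] as a product. [lsum_le_inj] is the opposite comparison, for
    injective parametrisations. *)
Lemma lsum_le_surj {A B} (g : B -> A) (l : list A) (l' : list B) f :
  NoDup l -> (forall x, In x l -> exists y, In y l' /\ g y = x) -> (forall y, In y l' -> 0 <= f (g y)) ->
  lsum l f <= lsum l' (fun y => f (g y)).
Proof.
  intros Hn Hs Hf. rewrite <- (lsum_map g l' f). apply lsum_incl; [exact Hn| |].
  - intros x Hx. destruct (Hs x Hx) as (y & Hy & <-). now apply in_map.
  - intros x Hx. apply in_map_iff in Hx. destruct Hx as (y & <- & Hy). auto.
Qed.

Lemma NoDup_map_inj {A B} (g : A -> B) l :
  NoDup l -> (forall x y, In x l -> In y l -> g x = g y -> x = y) -> NoDup (map g l).
Proof.
  induction 1 as [|x l Hx Hn IH]; intro Hg; [constructor|]. simpl. constructor.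
  - intro H. apply in_map_iff in H. destruct H as (y & E & Hy). apply Hx.
    rewrite (Hg x y); [exact Hy|now left|now right|now symmetry].
  - apply IH. intros; apply Hg; try (right; assumption). assumption.
Qed.

Lemma lsum_le_inj {A B} (g : B -> A) (l : list A) (l' : list B) f :
  NoDup l' -> (forall x y, In x l' -> In y l' -> g x = g y -> x = y) ->
  (forall y, In y l' -> In (g y) l) -> (forall x, In x l -> 0 <= f x) ->
  lsum l' (fun y => f (g y)) <= lsum l f.
Proof.
  intros Hn Hi Hm Hf. rewrite <- (lsum_map g l' f). apply lsum_incl; [now apply NoDup_map_inj| |exact Hf].
  intros x Hx. apply in_map_iff in Hx. destruct Hx as (y & <- & Hy). auto.
Qed.

Lemma lsum_seq_S f s n : lsum (seq s (S n)) f = lsum (seq s n) f + f (s + n)%nat.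
Proof. rewrite seq_S, lsum_app, lsum_cons. change (lsum [] f) with 0. ring. Qed.

Lemma sum_n_m_lsum (f : nat -> R) X : (1 <= X)%nat -> sum_n_m f 1 X = lsum (seq 1 X) f.
Proof.
  induction X as [|X IH]; intro H; [lia|]. rewrite lsum_seq_S. destruct X as [|X].
  - rewrite sum_n_n. symmetry. exact (Rplus_0_l (f 1%nat)).
  - rewrite sum_n_Sm by lia. rewrite IH by lia. reflexivity.
Qed.

Lemma lsum_single_le {A} (l : list A) f x :
  In x l -> (forall y, In y l -> 0 <= f y) -> f x <= lsum l f.
Proof.
  intros Hx Hf. pose proof (lsum_incl [x] l f) as H. unfold lsum at 1 in H; simpl in H.
  enough (f x + 0 <= lsum l f) by lra. apply H; [constructor; [easy|constructor]| |exact Hf].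
  intros y [<-|[]]. exact Hx.
Qed.

Lemma lsum_square {A} (l : list A) f : lsum l f * lsum l f = lsum l (fun x => lsum l (fun y => f x * f y)).
Proof.
  rewrite <- lsum_scal_r. apply lsum_ext. intros. rewrite lsum_scal. reflexivity.
Qed.

Lemma lsum_cauchy {A} (l : list A) f g :
  lsum l (fun x => f x * g x) * lsum l (fun x => f x * g x)
  <= lsum l (fun x => f x * f x) * lsum l (fun x => g x * g x).
Proof.
  induction l as [|x l IH]; [unfold lsum; simpl; lra|]. rewrite !lsum_cons.
  set (a := lsum l (fun x => f x * g x)) in *. set (b := lsum l (fun x => f x * f x)) in *.
  set (c := lsum l (fun x => g x * g x)) in *.
  assert (Hb : 0 <= b) by (apply lsum_nonneg; intros; nra).
  assert (Hc : 0 <= c) by (apply lsum_nonneg; intros; nra).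
  set (u := f x). set (v := g x).
  assert (2 * (a * (u * v)) <= u * u * c + v * v * b); [|nra].
  assert (Hq : (u * u * c + v * v * b) ^ 2 >= (2 * (a * (u * v))) ^ 2).
  { assert (0 <= (u*u)*(v*v)) by nra. assert ((u*u)*(v*v)*(a*a) <= (u*u)*(v*v)*(b*c)) by (apply Rmult_le_compat_l; assumption).
    pose proof (pow2_ge_0 (u*u*c - v*v*b)). nra. }
  assert (0 <= u * u * c + v * v * b) by (apply Rplus_le_le_0_compat; apply Rmult_le_pos; nra).
  destruct (Rle_or_lt (2 * (a * (u * v))) 0) as [L|L]; [lra|].
  apply Rnot_lt_le. intro K. assert ((u * u * c + v * v * b) ^ 2 < (2 * (a * (u * v))) ^ 2) by nra. lra.
Qed.

(** [a - b + (b - a)] is the distance in truncated subtraction; each distance is attained at most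
    once on either side of [a]. *)
Lemma lsum_dist_le (phi : nat -> R) (S : list nat) (a N : nat) :
  NoDup S -> (forall k, 0 <= phi k) -> (forall b, In b S -> (a - b + (b - a) < N)%nat) ->
  lsum S (fun b => phi (a - b + (b - a))%nat) <= 2 * lsum (seq 0 N) phi.
Proof.
  intros Hn Hphi HN.
  rewrite (lsum_ext S _ (fun b => (if (b <=? a)%nat then phi (a - b + (b - a))%nat else 0) + (if (negb (b <=? a))%nat then phi (a - b + (b - a))%nat else 0)))
    by (intros b Hb; destruct (b <=? a)%nat; simpl; ring).
  rewrite lsum_plus, <- !lsum_filter.
  assert (H1 : lsum (filter (fun b => b <=? a)%nat S) (fun b => phi (a - b + (b - a))%nat) <= lsum (seq 0 N) phi).
  { apply (lsum_le_inj (fun b => a - b + (b - a))%nat); [now apply NoDup_filter| | |auto].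
    - intros x y Hx Hy. apply filter_In in Hx, Hy. destruct Hx as [_ Hx], Hy as [_ Hy].
      apply Nat.leb_le in Hx, Hy. lia.
    - intros y Hy. apply filter_In in Hy. apply in_seq. specialize (HN y). intuition lia. }
  assert (H2 : lsum (filter (fun b => negb (b <=? a))%nat S) (fun b => phi (a - b + (b - a))%nat) <= lsum (seq 0 N) phi).
  { apply (lsum_le_inj (fun b => a - b + (b - a))%nat); [now apply NoDup_filter| | |auto].
    - intros x y Hx Hy. apply filter_In in Hx, Hy. destruct Hx as [_ Hx], Hy as [_ Hy].
      apply Bool.negb_true_iff, Nat.leb_gt in Hx, Hy. lia.
    - intros y Hy. apply filter_In in Hy. apply in_seq. specialize (HN y). intuition lia. }
  lra.
Qed.

Lemma INR_dist a b : Rabs (INR a - INR b) = INR (a - b + (b - a)).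
Proof.
  rewrite plus_INR. destruct (Nat.le_ge_cases a b) as [H|H].
  - replace (a - b)%nat with 0%nat by lia. rewrite minus_INR by lia. apply le_INR in H.
    rewrite Rabs_left1 by lra. simpl. ring.
  - replace (b - a)%nat with 0%nat by lia. rewrite minus_INR by lia. apply le_INR in H.
    rewrite Rabs_pos_eq by lra. simpl. ring.
Qed.

(** * Resonance *)

(* The average over differences of grid points is a discrete Fejer kernel,
   hence nonnegative on every cosine. *)
Definition grid_avg (n : nat) (h : R) (f : R -> R) : R :=
  lsum (seq 0 n) (fun i => lsum (seq 0 n) (fun j => f ((INR i - INR j) * h))) / (INR n * INR n).

Lemma grid_avg_ext n h f g : (forall t, f t = g t) -> grid_avg n h f = grid_avg n h g.
Proof.
  intro H. unfold grid_avg. f_equal. apply lsum_ext; intros; apply lsum_ext; intros; apply H.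
Qed.

Lemma grid_avg_plus n h f g : grid_avg n h (fun t => f t + g t) = grid_avg n h f + grid_avg n h g.
Proof.
  unfold grid_avg, Rdiv. rewrite <- Rmult_plus_distr_r. f_equal. rewrite <- lsum_plus.
  apply lsum_ext; intros. apply lsum_plus.
Qed.

Lemma grid_avg_scal n h c f : grid_avg n h (fun t => c * f t) = c * grid_avg n h f.
Proof.
  unfold grid_avg, Rdiv. rewrite <- Rmult_assoc. f_equal. rewrite <- lsum_scal.
  apply lsum_ext; intros. apply lsum_scal.
Qed.

Lemma grid_avg_lsum {A} n h (l : list A) (f : A -> R -> R) :
  grid_avg n h (fun t => lsum l (fun x => f x t)) = lsum l (fun x => grid_avg n h (f x)).
Proof.
  induction l as [|x l IH].
  - unfold lsum at 2. simpl. rewrite (grid_avg_ext _ _ _ (fun t => 0 * 0)) by (intro; unfold lsum; simpl; ring).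
    rewrite grid_avg_scal. ring.
  - rewrite lsum_cons, <- IH, <- grid_avg_plus. reflexivity.
Qed.

Lemma INR_pos_ge1 n : (1 <= n)%nat -> 1 <= INR n.
Proof. intro H. apply le_INR in H. exact H. Qed.

Lemma grid_avg_const n h c : (1 <= n)%nat -> grid_avg n h (fun _ => c) = c.
Proof.
  intro Hn. apply INR_pos_ge1 in Hn. unfold grid_avg.
  rewrite (lsum_ext _ _ (fun _ => INR n * c)) by (intros; rewrite lsum_const, length_seq; reflexivity).
  rewrite lsum_const, length_seq. field. lra.
Qed.

Lemma grid_avg_le n h f g T : (1 <= n)%nat -> INR n * h = T -> 0 < h ->
  (forall t, Rabs t <= T -> f t <= g t) -> grid_avg n h f <= grid_avg n h g.
Proof.
  intros Hn HT Hh H. apply INR_pos_ge1 in Hn. unfold grid_avg. apply Rmult_le_compat_r.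
  - left. apply Rinv_0_lt_compat. nra.
  - apply lsum_le; intros i Hi; apply lsum_le; intros j Hj. apply H.
    apply in_seq in Hi, Hj. rewrite Rabs_mult, (Rabs_pos_eq h) by lra. rewrite <- HT.
    apply Rmult_le_compat_r; [lra|]. rewrite INR_dist. apply le_INR. lia.
Qed.

(** The double sum is [|sum_j exp(i j h xi)|^2 / n^2], hence nonnegative. *)
Lemma grid_avg_cos n h xi :
  grid_avg n h (fun t => cos (xi * t))
  = (lsum (seq 0 n) (fun j => cos (INR j * (h * xi))) * lsum (seq 0 n) (fun j => cos (INR j * (h * xi)))
     + lsum (seq 0 n) (fun j => sin (INR j * (h * xi))) * lsum (seq 0 n) (fun j => sin (INR j * (h * xi)))) / (INR n * INR n).
Proof.
  unfold grid_avg. f_equal. rewrite !lsum_square, <- lsum_plus. apply lsum_ext; intros i _.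
  rewrite <- lsum_plus. apply lsum_ext; intros j _. rewrite <- cos_minus. f_equal. ring.
Qed.

Lemma grid_avg_cos_nonneg n h xi : (1 <= n)%nat -> 0 <= grid_avg n h (fun t => cos (xi * t)).
Proof.
  intro Hn. apply INR_pos_ge1 in Hn. rewrite grid_avg_cos. apply Rmult_le_pos.
  - nra.
  - left. apply Rinv_0_lt_compat. nra.
Qed.

Lemma sin_lower x : 0 <= x <= 1 / 2 -> x / 2 <= sin x.
Proof.
  intro Hx. destruct (Req_dec x 0) as [->|Hne]; [rewrite sin_0; lra|].
  destruct (MVT_cor2 sin cos 0 x) as [c [Hc1 Hc2]]; [lra|intros; apply derivable_pt_lim_sin|].
  rewrite sin_0 in Hc1.
  assert (1 / 2 <= cos c).
  { rewrite <- cos_PI3. pose proof PI2_3_2. apply cos_decr_1; lra. }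
  nra.
Qed.

Lemma one_minus_cos_lower x : Rabs x <= 1 -> x * x / 4 <= 2 - 2 * cos x.
Proof.
  intro Hx.
  assert (G : forall y, 0 <= y <= 1 -> y * y / 4 <= 2 - 2 * cos y).
  { intros y Hy. pose proof (sin_lower (y / 2) ltac:(lra)) as H.
    replace (cos y) with (1 - 2 * sin (y/2) * sin (y/2)).
    - nra.
    - rewrite <- cos_2a_sin. f_equal. field. }
  destruct (Rle_or_lt 0 x) as [L|L].
  - apply G. rewrite Rabs_pos_eq in Hx; lra.
  - rewrite <- (cos_neg x). replace (x * x) with ((- x) * (- x)) by ring. apply G. rewrite Rabs_left in Hx; lra.
Qed.

(** Real and imaginary parts of [(1 - z) sum_(j < n) z^j = 1 - z^n] at [z = exp(i th)]. *)
Lemma geometric_cos_sin th n :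
  (1 - cos th) * lsum (seq 0 n) (fun j => cos (INR j * th)) + sin th * lsum (seq 0 n) (fun j => sin (INR j * th)) = 1 - cos (INR n * th) /\
  (1 - cos th) * lsum (seq 0 n) (fun j => sin (INR j * th)) - sin th * lsum (seq 0 n) (fun j => cos (INR j * th)) = - sin (INR n * th).
Proof.
  induction n as [|n [IH1 IH2]].
  - unfold lsum; simpl. rewrite Rmult_0_l, cos_0, sin_0. split; ring.
  - rewrite !lsum_seq_S, Nat.add_0_l, S_INR. replace ((INR n + 1) * th) with (INR n * th + th) by ring.
    rewrite cos_plus, sin_plus. split; nra.
Qed.

(** The geometric sum is at most [2 / |1 - exp(i h xi)|], and [|1 - exp(i x)| >= |x| / 2] for
    [|x| <= 1]. The condition on [h * xi] excludes aliasing on the grid. *)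
Lemma grid_avg_cos_small n h xi : (1 <= n)%nat -> 0 < h -> xi <> 0 -> Rabs (h * xi) <= 1 ->
  grid_avg n h (fun t => cos (xi * t)) <= 16 / (INR n * h * xi) ^ 2.
Proof.
  intros Hn Hh Hxi Hs. apply INR_pos_ge1 in Hn. rewrite grid_avg_cos.
  destruct (geometric_cos_sin (h * xi) n) as [E1 E2].
  set (C := lsum _ _) in *. set (D := lsum _ (fun j => sin _)) in *.
  set (th := h * xi) in *.
  assert (E : (2 - 2 * cos th) * (C * C + D * D) <= 4).
  { pose proof (sin2_cos2 th) as S1. pose proof (sin2_cos2 (INR n * th)) as S2. unfold Rsqr in S1, S2.
    replace ((2 - 2 * cos th) * (C * C + D * D)) with (((1 - cos th) * C + sin th * D) ^ 2 + ((1 - cos th) * D - sin th * C) ^ 2).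
    - rewrite E1, E2. pose proof (COS_bound (INR n * th)). nra.
    - replace (2 - 2 * cos th) with (1 - 2 * cos th + (sin th * sin th + cos th * cos th)) by lra. ring. }
  pose proof (one_minus_cos_lower th Hs) as HL.
  assert (Hth : 0 < th * th) by (assert (th <> 0) by (unfold th; apply Rmult_integral_contrapositive; split; lra); nra).
  assert (HCD : C * C + D * D <= 16 / (th * th)).
  { apply (Rmult_le_reg_l (th * th / 4)); [lra|].
    replace (th * th / 4 * (16 / (th * th))) with 4 by (field; intro Z; rewrite Z in Hth; lra).
    eapply Rle_trans; [|exact E]. apply Rmult_le_compat_r; [nra|exact HL]. }
  replace (16 / (INR n * h * xi) ^ 2) with (16 / (th * th) / (INR n * INR n)) by (unfold th; field; repeat split; lra).
  apply Rmult_le_compat_r; [left; apply Rinv_0_lt_compat; nra|exact HCD].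
Qed.

Lemma ln_distance (a b : nat) (T : R) : (1 <= a)%nat -> (1 <= b)%nat -> INR a <= T -> INR b <= T ->
  Rabs (INR a - INR b) / T <= Rabs (ln (INR a) - ln (INR b)).
Proof.
  intros Ha Hb HaT HbT.
  apply INR_pos_ge1 in Ha, Hb.
  assert (G : forall x y, 1 <= x -> x < y -> y <= T -> (y - x) / T <= ln y - ln x).
  { intros x y Hx Hxy Hy.
    destruct (MVT_cor2 ln (fun z => / z) x y Hxy) as [c [Hc1 Hc2]].
    - intros z Hz. apply derivable_pt_lim_ln. lra.
    - rewrite Hc1. unfold Rdiv. rewrite Rmult_comm. apply Rmult_le_compat_r; [lra|].
      apply Rinv_le_contravar; lra. }
  destruct (Rtotal_order (INR a) (INR b)) as [L|[E|L]].
  - specialize (G _ _ Ha L HbT). rewrite (Rabs_left (INR a - INR b)) by lra.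
    rewrite Rabs_left1; [|pose proof (ln_increasing (INR a) (INR b) ltac:(lra) L); lra].
    unfold Rdiv in *. lra.
  - rewrite E. unfold Rminus, Rdiv. rewrite !Rplus_opp_r, Rabs_R0. lra.
  - specialize (G _ _ Hb L HaT). rewrite (Rabs_pos_eq (INR a - INR b)) by lra.
    rewrite Rabs_pos_eq; [|pose proof (ln_increasing (INR b) (INR a) ltac:(lra) L); lra].
    unfold Rdiv in *. lra.
Qed.

(** It majorises the bound [16 / k^2] for [k >= 1], as [(k + 1) (k + 2) <= 6 k^2], is at least 1 at
    [k = 0], and telescopes to a total of 96. *)
Definition schur_weight (k : nat) : R := 96 / ((INR k + 1) * (INR k + 2)).

Lemma schur_weight_sum N : lsum (seq 0 N) schur_weight <= 96.
Proof.
  enough (lsum (seq 0 N) schur_weight = 96 - 96 / (INR N + 1)) as ->.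
  { pose proof (pos_INR N). assert (0 < 96 / (INR N + 1)) by (apply Rdiv_lt_0_compat; lra). lra. }
  induction N as [|N IH]; [unfold lsum; simpl; field|].
  rewrite lsum_seq_S, IH, Nat.add_0_l, S_INR. unfold schur_weight. pose proof (pos_INR N). field. lra.
Qed.

Lemma grid_avg_cos_schur n h T a b :
  (1 <= n)%nat -> 0 < h -> INR n * h = T -> 1 <= T -> h * ln T <= 1 ->
  (1 <= a)%nat -> (1 <= b)%nat -> INR a <= T -> INR b <= T ->
  grid_avg n h (fun t => cos ((ln (INR a) - ln (INR b)) * t)) <= schur_weight (a - b + (b - a)).
Proof.
  intros Hn Hh HT HT1 HhT Ha Hb HaT HbT. unfold schur_weight.
  destruct (Nat.eq_dec a b) as [->|Hne].
  - rewrite Nat.sub_diag. simpl. replace (96 / ((0 + 1) * (0 + 2))) with 48 by field.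
    apply Rle_trans with 1; [|lra].
    rewrite (grid_avg_ext _ _ _ (fun _ => 1)); [rewrite grid_avg_const by assumption; lra|].
    intro t. unfold Rminus. rewrite Rplus_opp_r, Rmult_0_l. apply cos_0.
  - pose proof (ln_distance a b T Ha Hb HaT HbT) as Hd. rewrite INR_dist in Hd.
    set (k := (a - b + (b - a))%nat) in *.
    assert (Hk : 1 <= INR k) by (apply INR_pos_ge1; unfold k; lia).
    pose proof (INR_pos_ge1 a Ha) as Ha1. pose proof (INR_pos_ge1 b Hb) as Hb1.
    set (xi := ln (INR a) - ln (INR b)) in *.
    assert (Hxi0 : 0 < Rabs xi) by (eapply Rlt_le_trans; [|exact Hd]; apply Rdiv_lt_0_compat; lra).
    assert (Hxi : Rabs xi <= ln T).
    { pose proof (ln_nonneg _ Ha1). pose proof (ln_nonneg _ Hb1).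
      pose proof (ln_le_ln (INR a) T ltac:(lra) HaT). pose proof (ln_le_ln (INR b) T ltac:(lra) HbT).
      unfold xi. apply Rabs_le. lra. }
    eapply Rle_trans; [apply grid_avg_cos_small; [assumption|assumption| |]|].
    + intro E. rewrite E, Rabs_R0 in Hxi0. lra.
    + rewrite Rabs_mult, (Rabs_pos_eq h) by lra. eapply Rle_trans; [apply Rmult_le_compat_l; [lra|exact Hxi]|exact HhT].
    + rewrite HT.
      assert (Hkx : INR k <= T * Rabs xi).
      { apply (Rmult_le_reg_r (/ T)); [apply Rinv_0_lt_compat; lra|].
        replace (T * Rabs xi * / T) with (Rabs xi) by (field; lra). exact Hd. }
      assert (Hsq : INR k ^ 2 <= (T * xi) ^ 2).
      { replace ((T * xi) ^ 2) with ((T * Rabs xi) ^ 2).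
        - apply pow_incr. lra.
        - rewrite !Rpow_mult_distr, pow2_abs. reflexivity. }
      apply Rle_trans with (16 / INR k ^ 2).
      * apply Rmult_le_compat_l; [lra|]. apply Rinv_le_contravar; [apply pow_lt; lra|exact Hsq].
      * apply (Rmult_le_reg_r (INR k ^ 2 * ((INR k + 1) * (INR k + 2)))); [apply Rmult_lt_0_compat; nra|].
        replace (16 / INR k ^ 2 * (INR k ^ 2 * ((INR k + 1) * (INR k + 2)))) with (16 * ((INR k + 1) * (INR k + 2))) by (field; lra).
        replace (96 / ((INR k + 1) * (INR k + 2)) * (INR k ^ 2 * ((INR k + 1) * (INR k + 2)))) with (96 * INR k ^ 2) by (field; lra).
        nra.
Qed.

Lemma ln_step (x d : R) : 0 < x -> 0 < d -> d / (x + d) <= ln (x + d) - ln x.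
Proof.
  intros Hx Hd.
  destruct (MVT_cor2 ln (fun z => / z) x (x + d)) as [c [Hc1 Hc2]]; [lra| |].
  - intros z Hz. apply derivable_pt_lim_ln. lra.
  - rewrite Hc1. replace (x + d - x) with d by ring. unfold Rdiv. rewrite Rmult_comm.
    apply Rmult_le_compat_r; [lra|]. apply Rinv_le_contravar; lra.
Qed.

Lemma harmonic_bound X : (1 <= X)%nat -> lsum (seq 1 X) (fun m => / INR m) <= 1 + ln (INR X).
Proof.
  induction X as [|X IH]; intro H; [lia|]. rewrite lsum_seq_S. destruct X as [|X].
  - change (lsum (seq 1 0) (fun m => / INR m)) with 0. simpl. rewrite ln_1, Rinv_1. lra.
  - specialize (IH ltac:(lia)). change (1 + S X)%nat with (S (S X)).
    pose proof (INR_S_ge1 X). pose proof (ln_step (INR (S X)) 1 ltac:(lra) ltac:(lra)) as L.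
    rewrite <- (S_INR (S X)) in L. unfold Rdiv in L. lra.
Qed.

Lemma grid_recip_sum n h T : 0 < h -> INR n * h = T ->
  lsum (seq 0 n) (fun k => / (1 + INR k * h)) <= 1 + / h * ln (1 + T).
Proof.
  intros Hh <-. assert (Hh' : 0 < / h) by now apply Rinv_0_lt_compat.
  assert (G : forall m, lsum (seq 0 (S m)) (fun k => / (1 + INR k * h)) <= 1 + / h * ln (1 + INR m * h)).
  { induction m as [|m IH]; rewrite lsum_seq_S, Nat.add_0_l.
    - change (lsum (seq 0 0) (fun k => / (1 + INR k * h))) with 0. simpl.
      rewrite Rmult_0_l, Rplus_0_r, ln_1, Rinv_1. lra.
    - assert (Hm : 0 <= INR m) by apply pos_INR.
      pose proof (ln_step (1 + INR m * h) h ltac:(nra) Hh) as L.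
      replace (1 + INR m * h + h) with (1 + INR (S m) * h) in L by (rewrite (S_INR m); ring).
      assert (L2 : / (1 + INR (S m) * h) <= / h * (ln (1 + INR (S m) * h) - ln (1 + INR m * h))).
      { apply (Rmult_le_reg_l h); [exact Hh|]. rewrite <- Rmult_assoc, Rinv_r, Rmult_1_l by lra. exact L. }
      lra. }
  destruct n as [|m].
  - change (lsum (seq 0 0) (fun k => / (1 + INR k * h))) with 0. simpl. rewrite Rmult_0_l, Rplus_0_r, ln_1. lra.
  - eapply Rle_trans; [apply G|]. apply Rplus_le_compat_l, Rmult_le_compat_l; [lra|].
    pose proof (pos_INR m). apply ln_le_ln; rewrite ?S_INR; nra.
Qed.

(** Grid differences spread up to [T], so a bounded neighbourhood of 0 has relative weight
    [O(1 / T)]; the harmonic sum over the grid adds the logarithm. *)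
Lemma grid_avg_recip n h T : (1 <= n)%nat -> 0 < h <= 1 -> INR n * h = T ->
  grid_avg n h (fun t => / (1 + Rabs t)) <= 2 * (1 + ln (1 + T)) / T.
Proof.
  intros Hn Hh HT. pose proof (INR_pos_ge1 n Hn) as Hn1.
  assert (HTp : 0 < T) by (rewrite <- HT; nra).
  assert (HL : 0 <= ln (1 + T)) by (apply ln_nonneg; lra).
  assert (S1 : lsum (seq 0 n) (fun i => lsum (seq 0 n) (fun j => / (1 + Rabs ((INR i - INR j) * h))))
     <= INR n * (2 * (1 + / h * ln (1 + T)))).
  { eapply Rle_trans; [apply lsum_le|rewrite lsum_const, length_seq; apply Rle_refl].
    intros i Hi. apply in_seq in Hi.
    rewrite (lsum_ext _ _ (fun j => (fun k => / (1 + INR k * h)) (i - j + (j - i))%nat)).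
    2:{ intros j _. rewrite Rabs_mult, (Rabs_pos_eq h), INR_dist by lra. reflexivity. }
    eapply Rle_trans; [apply (lsum_dist_le (fun k => / (1 + INR k * h)) (seq 0 n) i n)|].
    - apply seq_NoDup.
    - intro k. left. apply Rinv_0_lt_compat. pose proof (pos_INR k). nra.
    - intros j Hj. apply in_seq in Hj. lia.
    - apply Rmult_le_compat_l; [lra|]. apply grid_recip_sum; [lra|exact HT]. }
  unfold grid_avg. apply (Rmult_le_reg_r (INR n * INR n)); [nra|].
  unfold Rdiv at 1. rewrite Rmult_assoc, Rinv_l, Rmult_1_r by nra.
  eapply Rle_trans; [exact S1|].
  replace (2 * (1 + ln (1 + T)) / T * (INR n * INR n)) with (INR n * (2 * ((1 + ln (1 + T)) * / h))).
  2:{ rewrite <- HT. field. split; lra. }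
  apply Rmult_le_compat_l; [lra|]. apply Rmult_le_compat_l; [lra|].
  assert (1 <= / h) by (rewrite <- Rinv_1; apply Rinv_le_contravar; lra). nra.
Qed.

(** * Upper and lower bounds for the resonance average *)

Lemma dirichlet_cos_even s X t : dirichlet_cos s X (- t) = dirichlet_cos s X t.
Proof.
  unfold dirichlet_cos. apply sum_n_m_ext. intro m. f_equal. rewrite <- cos_neg. f_equal. ring.
Qed.

(** Trivial bound, used for [|t| < 1]. That [m^(1-s) <= G] for all [m <= X] comes from the endpoint
    [X] if [s <= 1] and from the endpoint 1 if [s > 1]. *)
Lemma dirichlet_cos_max s X t G : (1 <= X)%nat -> 1 <= G -> Rpower (INR X) (1 - s) <= G ->
  dirichlet_cos s X t <= G * (1 + ln (INR X)).
Proof.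
  intros HX HG HXG. unfold dirichlet_cos. rewrite sum_n_m_lsum by exact HX.
  apply Rle_trans with (G * lsum (seq 1 X) (fun m => / INR m)).
  - rewrite <- lsum_scal. apply lsum_le. intros m Hm. apply in_seq in Hm.
    assert (Hm1 : 1 <= INR m) by (apply INR_pos_ge1; lia).
    assert (HmX : INR m <= INR X) by (apply le_INR; lia).
    apply Rle_trans with (Rpower (INR m) (- s)).
    { pose proof (COS_bound (t * ln (INR m))). pose proof (Rpower_pos (INR m) (- s)). nra. }
    replace (- s) with ((1 - s) + - (1)) by ring. rewrite Rpower_plus, (Rpower_Ropp _ 1), Rpower_1 by lra.
    apply Rmult_le_compat_r; [left; apply Rinv_0_lt_compat; lra|].
    destruct (Rle_or_lt 0 (1 - s)) as [L|L].
    + eapply Rle_trans; [|exact HXG]. apply Rle_Rpower_l; [exact L|lra].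
    + eapply Rle_trans; [|exact HG]. apply Rle_trans with (Rpower 1 (1 - s)); [|right; apply Rpower_1_l].
      replace (1 - s) with (- (s - 1)) by ring. apply Rpower_decr; lra.
  - apply Rmult_le_compat_l; [lra|]. apply harmonic_bound. exact HX.
Qed.

(** For [1 <= |t| <= T] the partial sum is replaced by zeta, evenness reducing to positive [t]. The
    term [X^(1-s) / t] and the trivial bound for [|t| < 1] are dominated by a multiple of
    [1 / (1 + |t|)], whose average is so small that the crude bound [Q <= Qmax] is affordable. *)
Lemma resonance_upper (zeta : C -> C) (s T h S G Qmax : R) (n X : nat) (Q : R -> R) :
  is_riemann_zeta zeta -> 0 < s -> 1 <= T -> (1 <= n)%nat -> 0 < h <= 1 -> INR n * h = T ->
  (1 <= X)%nat -> 0 <= S -> (forall t, 1 <= t <= T -> fst (zeta (s, t)) <= S) ->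
  (forall t, Q (- t) = Q t) -> (forall t, 0 <= Q t <= Qmax) ->
  1 <= G -> Rpower (INR X) (1 - s) <= G ->
  grid_avg n h (fun t => dirichlet_cos s X t * Q t)
  <= (S + 2 * (2 + s) ^ 2 * (1 + 1 / s) * T * Rpower (INR X) (- s)) * grid_avg n h Q
     + Qmax * (G * (2 + ln (INR X)) * (4 * (1 + ln (1 + T)) / T)).
Proof.
  intros Hz Hs HT1 Hn Hh HT HX HS HzS Qev Qb HG HXG.
  set (E := 2 * (2 + s) ^ 2 * (1 + 1 / s) * T * Rpower (INR X) (- s)).
  pose proof (Rpower_pos (INR X) (- s)) as HXs.
  assert (H1s : 0 < 1 / s) by (apply Rdiv_lt_0_compat; lra).
  assert (HK : 0 <= 2 * (2 + s) ^ 2 * (1 + 1 / s)) by (apply Rmult_le_pos; [nra|lra]).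
  assert (HE : 0 <= E) by (unfold E; apply Rmult_le_pos; [apply Rmult_le_pos; lra|lra]).
  assert (HlnX : 0 <= ln (INR X)) by (apply ln_nonneg, INR_pos_ge1, HX).
  assert (HQm : 0 <= Qmax) by (destruct (Qb 0); lra).
  set (W := G * (2 + ln (INR X))).
  assert (HWG : 2 * G <= W) by (unfold W; nra).
  assert (Hpt : forall t, Rabs t <= T ->
     dirichlet_cos s X t * Q t <= (S + E) * Q t + Qmax * (2 * W) * / (1 + Rabs t)).
  { intros t Ht. destruct (Qb t) as [Q0 Q1].
    assert (EV : dirichlet_cos s X t = dirichlet_cos s X (Rabs t)).
    { unfold Rabs. destruct (Rcase_abs t); [symmetry; apply dirichlet_cos_even|reflexivity]. }
    pose proof (Rabs_pos t) as Ht0.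
    set (g := 2 * W * / (1 + Rabs t)).
    assert (Hg0 : 0 <= g) by (unfold g; apply Rmult_le_pos; [lra|left; apply Rinv_0_lt_compat; lra]).
    assert (F : dirichlet_cos s X t <= S + E + g).
    { destruct (Rle_or_lt 1 (Rabs t)) as [L|L].
      - rewrite EV. eapply Rle_trans; [apply (zeta_re_approx zeta s (Rabs t) X Hz Hs L HX)|].
        specialize (HzS (Rabs t) (conj L Ht)).
        assert (2 * Rpower (INR X) (1 - s) / Rabs t <= g).
        { unfold g. apply Rle_trans with (2 * G / Rabs t).
          - apply Rmult_le_compat_r; [left; apply Rinv_0_lt_compat; lra|lra].
          - apply (Rmult_le_reg_r (Rabs t * (1 + Rabs t))); [nra|].
            replace (2 * G / Rabs t * (Rabs t * (1 + Rabs t))) with (2 * G * (1 + Rabs t)) by (field; lra).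
            replace (2 * W * / (1 + Rabs t) * (Rabs t * (1 + Rabs t))) with (W * (2 * Rabs t)) by (field; lra).
            apply Rmult_le_compat; lra. }
        assert (2 * (2 + s) ^ 2 * (1 + 1 / s) * Rabs t * Rpower (INR X) (- s) <= E).
        { unfold E. apply Rmult_le_compat_r; [lra|]. apply Rmult_le_compat_l; lra. }
        lra.
      - assert (dirichlet_cos s X t <= G * (1 + ln (INR X))) by (apply dirichlet_cos_max; assumption).
        assert (W <= g); [|unfold W in *; nra].
        unfold g. apply (Rmult_le_reg_r (1 + Rabs t)); [lra|]. rewrite Rmult_assoc, Rinv_l by lra. nra. }
    replace (Qmax * (2 * W) * / (1 + Rabs t)) with (Qmax * g) by (unfold g; ring).
    assert (dirichlet_cos s X t * Q t <= (S + E + g) * Q t) by (apply Rmult_le_compat_r; assumption).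
    assert (g * Q t <= g * Qmax) by (apply Rmult_le_compat_l; assumption). lra. }
  eapply Rle_trans; [apply (grid_avg_le _ _ _ _ T Hn HT (proj1 Hh) Hpt)|].
  rewrite grid_avg_plus, !grid_avg_scal. apply Rplus_le_compat_l. rewrite Rmult_assoc.
  apply Rmult_le_compat_l; [exact HQm|].
  pose proof (grid_avg_recip n h T Hn Hh HT) as R0.
  replace (W * (4 * (1 + ln (1 + T)) / T)) with (2 * W * (2 * (1 + ln (1 + T)) / T)) by (unfold Rdiv; ring).
  apply Rmult_le_compat_l; [lra|exact R0].
Qed.

(** With [n] about [T (1 + ln T)], every frequency [ln a - ln b] with [1 <= a, b <= T] is at most
    [1 / h], as [grid_avg_cos_small] demands. *)
Lemma grid_exists (T : R) : 3 <= T -> exists n h, (1 <= n)%nat /\ 0 < h <= 1 /\ INR n * h = T /\ h * ln T <= 1.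
Proof.
  intro HT. assert (HL : 0 <= ln T) by (apply ln_nonneg; lra).
  destruct (nfloor_ex (T * (1 + ln T))) as [n [_ Hn]]; [nra|].
  exists (Datatypes.S n), (T / INR (Datatypes.S n)).
  assert (HN : T * (1 + ln T) < INR (Datatypes.S n)) by (rewrite S_INR; exact Hn).
  assert (HNp : 0 < INR (Datatypes.S n)) by nra.
  split; [lia|]. split; [split; [apply Rdiv_lt_0_compat; lra|]|split].
  - apply (Rmult_le_reg_r (INR (Datatypes.S n))); [lra|]. unfold Rdiv. rewrite Rmult_assoc, Rinv_l by lra. nra.
  - field. lra.
  - apply (Rmult_le_reg_r (INR (Datatypes.S n))); [lra|].
    replace (T / INR (Datatypes.S n) * ln T * INR (Datatypes.S n)) with (T * ln T) by (field; lra). nra.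
Qed.

(* A resonator [sum_j y_j n_j^(it)] is encoded as the list of the pairs [(n_j, y_j)]. *)
Definition res_norm (Y : list (nat * R)) : R := lsum Y (fun p => snd p * snd p).
Definition res_sum (Y : list (nat * R)) : R := lsum Y snd.
(** The weight [m^(-s)] of the solution of [m * a = b], or 0 if there is none: the diagonal
    contribution of the pair [(a, b)]. *)
Definition div_kernel (s : R) (a b : nat) : R :=
  if Nat.eqb (b mod a) 0 then Rpower (INR (b / a)) (- s) else 0.
Definition res_form (s : R) (Y : list (nat * R)) : R :=
  lsum Y (fun p => lsum Y (fun q => snd p * snd q * div_kernel s (fst p) (fst q))).

(** [|R(t)|^2], kept as a cosine sum because averages are computed frequency by frequency. *)
Definition res_sq (Y : list (nat * R)) (t : R) : R :=
  lsum Y (fun p => lsum Y (fun q => snd p * snd q * cos ((ln (INR (fst p)) - ln (INR (fst q))) * t))).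

Lemma res_sq_eq Y t : res_sq Y t =
  lsum Y (fun p => snd p * cos (ln (INR (fst p)) * t)) * lsum Y (fun p => snd p * cos (ln (INR (fst p)) * t))
  + lsum Y (fun p => snd p * sin (ln (INR (fst p)) * t)) * lsum Y (fun p => snd p * sin (ln (INR (fst p)) * t)).
Proof.
  unfold res_sq. rewrite !lsum_square, <- lsum_plus. apply lsum_ext; intros p _.
  rewrite <- lsum_plus. apply lsum_ext; intros q _. rewrite Rmult_minus_distr_r, cos_minus. ring.
Qed.

Lemma res_sq_bounds Y t : (forall p, In p Y -> 0 <= snd p) -> 0 <= res_sq Y t <= res_sum Y * res_sum Y.
Proof.
  intro H. split; [rewrite res_sq_eq; nra|].
  unfold res_sum. rewrite lsum_square. apply lsum_le; intros p Hp; apply lsum_le; intros q Hq.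
  pose proof (COS_bound ((ln (INR (fst p)) - ln (INR (fst q))) * t)).
  pose proof (Rmult_le_pos _ _ (H p Hp) (H q Hq)). nra.
Qed.

Lemma res_sq_even Y t : res_sq Y (- t) = res_sq Y t.
Proof.
  apply lsum_ext; intros p _; apply lsum_ext; intros q _. f_equal. rewrite <- cos_neg. f_equal. ring.
Qed.

(** Schur's test: [2 y_p y_q <= y_p^2 + y_q^2], and by symmetry each [y_p^2] collects the sum of its
    row of the kernel, at most [2 * 96]. *)
Lemma grid_avg_res_sq_le Y n h T :
  (1 <= n)%nat -> 0 < h -> INR n * h = T -> 1 <= T -> h * ln T <= 1 ->
  NoDup (map fst Y) -> (forall p, In p Y -> (1 <= fst p)%nat /\ INR (fst p) <= T /\ 0 <= snd p) ->
  grid_avg n h (res_sq Y) <= 192 * res_norm Y.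
Proof.
  intros Hn Hh HT HT1 HhT HND HY. unfold res_sq, res_norm.
  rewrite grid_avg_lsum.
  set (w := fun p q : nat * R => schur_weight (fst p - fst q + (fst q - fst p))).
  assert (Hw : forall k, 0 <= schur_weight k).
  { intro k. unfold schur_weight. pose proof (pos_INR k). left. apply Rdiv_lt_0_compat; nra. }
  apply Rle_trans with (lsum Y (fun p => lsum Y (fun q => (snd p * snd p + snd q * snd q) / 2 * w p q))).
  - apply lsum_le; intros p Hp. rewrite grid_avg_lsum. apply lsum_le; intros q Hq. rewrite grid_avg_scal.
    destruct (HY p Hp) as (P1 & P2 & P3). destruct (HY q Hq) as (Q1 & Q2 & Q3).
    apply Rmult_le_compat.
    + apply Rmult_le_pos; assumption.
    + apply grid_avg_cos_nonneg. exact Hn.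
    + pose proof (Rle_0_sqr (snd p - snd q)) as K. unfold Rsqr in K. lra.
    + apply (grid_avg_cos_schur n h T); assumption.
  - assert (S1 : forall p, In p Y -> lsum Y (fun q => w p q) <= 192).
    { intros p Hp.
      change (lsum Y (fun q => w p q)) with (lsum Y (fun q => (fun b => schur_weight (fst p - b + (b - fst p))) (fst q))).
      rewrite <- (lsum_map fst Y). set (N := Datatypes.S (fst p + list_max (map fst Y))).
      eapply Rle_trans; [apply (lsum_dist_le schur_weight _ _ N HND Hw)|pose proof (schur_weight_sum N); lra].
      intros b Hb. pose proof (proj1 (list_max_le (map fst Y) (list_max (map fst Y))) (le_n _)) as LM.
      rewrite Forall_forall in LM. specialize (LM b Hb). unfold N. lia. }
    assert (Hsym : forall p q, w p q = w q p) by (intros; unfold w; f_equal; lia).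
    assert (E : lsum Y (fun p => lsum Y (fun q => (snd p * snd p + snd q * snd q) / 2 * w p q))
       = lsum Y (fun p => snd p * snd p * lsum Y (fun q => w p q))).
    { transitivity (lsum Y (fun p => lsum Y (fun q => snd p * snd p / 2 * w p q)) + lsum Y (fun p => lsum Y (fun q => snd q * snd q / 2 * w p q))).
      - rewrite <- lsum_plus. apply lsum_ext; intros. rewrite <- lsum_plus. apply lsum_ext; intros. field.
      - rewrite (lsum_swap Y Y (fun p q => snd q * snd q / 2 * w p q)), <- lsum_plus. apply lsum_ext; intros p _.
        rewrite <- lsum_plus, <- lsum_scal. apply lsum_ext; intros q _. rewrite (Hsym q p). field. }
    rewrite E, <- lsum_scal. apply lsum_le; intros p Hp. rewrite Rmult_comm.
    apply Rmult_le_compat_r; [nra|]. auto.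
Qed.

(** By the product-to-sum formulas the average is a sum over [m <= X] of nonnegative averages. The
    quotient [b / a] or [a / b], if integral, is one of these [m] and produces the frequency 0; the
    other terms are dropped. *)
Lemma grid_avg_kernel_lower s X n h a b :
  (1 <= n)%nat -> (1 <= a <= X)%nat -> (1 <= b <= X)%nat ->
  (div_kernel s a b + div_kernel s b a) / 2
  <= grid_avg n h (fun t => dirichlet_cos s X t * cos ((ln (INR a) - ln (INR b)) * t)).
Proof.
  intros Hn Ha Hb. set (d := ln (INR a) - ln (INR b)).
  set (term := fun m => Rpower (INR m) (- s) * ((grid_avg n h (fun t => cos ((ln (INR m) + d) * t)) + grid_avg n h (fun t => cos ((ln (INR m) - d) * t))) / 2)).
  assert (E : grid_avg n h (fun t => dirichlet_cos s X t * cos (d * t)) = lsum (seq 1 X) term).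
  { rewrite (grid_avg_ext _ _ _ (fun t => lsum (seq 1 X) (fun m => Rpower (INR m) (- s) * / 2 * (cos ((ln (INR m) + d) * t) + cos ((ln (INR m) - d) * t))))).
    - rewrite grid_avg_lsum. apply lsum_ext; intros m _. rewrite grid_avg_scal, grid_avg_plus. unfold term. field.
    - intro t. unfold dirichlet_cos. rewrite sum_n_m_lsum by lia. rewrite <- lsum_scal_r. apply lsum_ext; intros m _.
      rewrite Rmult_plus_distr_r, Rmult_minus_distr_r, cos_plus, cos_minus. 
      rewrite (Rmult_comm t). field. }
  rewrite E.
  assert (Hpos : forall m, In m (seq 1 X) -> 0 <= term m).
  { intros m _. unfold term. apply Rmult_le_pos; [left; apply Rpower_pos|].
    pose proof (grid_avg_cos_nonneg n h (ln (INR m) + d) Hn). pose proof (grid_avg_cos_nonneg n h (ln (INR m) - d) Hn). lra. }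
  assert (Hone : forall xi, xi = 0 -> grid_avg n h (fun t => cos (xi * t)) = 1).
  { intros xi ->. rewrite (grid_avg_ext _ _ _ (fun _ => 1)); [now apply grid_avg_const|].
    intro t. rewrite Rmult_0_l. apply cos_0. }
  assert (Hdiv : forall x y, (1 <= x)%nat -> (1 <= y <= X)%nat -> Nat.eqb (y mod x) 0 = true ->
      (1 <= y / x <= X)%nat /\ ln (INR (y / x)) = ln (INR y) - ln (INR x)).
  { intros x y Hx Hy Hm. apply Nat.eqb_eq in Hm.
    assert (Hyx : y = (x * (y / x))%nat) by (pose proof (Nat.div_mod_eq y x); lia).
    assert (1 <= y / x)%nat by (destruct (y / x)%nat; lia).
    split; [split; [assumption|nia]|].
    rewrite Hyx at 2. rewrite mult_INR, ln_mult; [ring| |]; apply lt_0_INR; lia. }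
  (* If [a = b], both frequencies of [m = 1] vanish, matching the two equal kernels on the left. *)
  destruct (Nat.eq_dec a b) as [Eab|Nab].
  - subst b. unfold div_kernel. rewrite Nat.Div0.mod_same, Nat.div_same by lia. simpl Nat.eqb. cbv iota.
    change (INR 1) with 1. rewrite Rpower_1_l. 
    eapply Rle_trans; [|apply (lsum_single_le _ term 1%nat); [apply in_seq; lia|exact Hpos]].
    unfold term. change (INR 1) with 1. rewrite ln_1, Rpower_1_l. unfold d. rewrite !Hone by ring. lra.
  - unfold div_kernel. destruct (Nat.eqb (b mod a) 0) eqn:E1.
    + assert (E2 : Nat.eqb (a mod b) 0 = false).
      { destruct (Nat.eqb (a mod b) 0) eqn:E2; [|reflexivity]. exfalso. apply Nab.
        apply Nat.eqb_eq in E1, E2. apply Nat.Lcm0.mod_divide in E1, E2. apply Nat.divide_antisym; assumption. }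
      rewrite E2. destruct (Hdiv a b ltac:(lia) Hb E1) as [D1 D2].
      eapply Rle_trans; [|apply (lsum_single_le _ term (b / a)%nat); [apply in_seq; lia|exact Hpos]].
      unfold term. rewrite (Hone (ln (INR (b / a)) + d)) by (rewrite D2; unfold d; ring).
      pose proof (grid_avg_cos_nonneg n h (ln (INR (b / a)) - d) Hn). pose proof (Rpower_pos (INR (b / a)) (- s)). nra.
    + destruct (Nat.eqb (a mod b) 0) eqn:E2.
      * destruct (Hdiv b a ltac:(lia) Ha E2) as [D1 D2].
        eapply Rle_trans; [|apply (lsum_single_le _ term (a / b)%nat); [apply in_seq; lia|exact Hpos]].
        unfold term. rewrite (Hone (ln (INR (a / b)) - d)) by (rewrite D2; unfold d; ring).
        pose proof (grid_avg_cos_nonneg n h (ln (INR (a / b)) + d) Hn). pose proof (Rpower_pos (INR (a / b)) (- s)). nra.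
      * replace ((0 + 0) / 2) with 0 by field. apply lsum_nonneg. exact Hpos.
Qed.

Lemma resonance_lower s X n h Y :
  (1 <= n)%nat -> (forall p, In p Y -> (1 <= fst p <= X)%nat /\ 0 <= snd p) ->
  res_form s Y <= grid_avg n h (fun t => dirichlet_cos s X t * res_sq Y t).
Proof.
  intros Hn HY.
  rewrite (grid_avg_ext _ _ _ (fun t => lsum Y (fun p => lsum Y (fun q => snd p * snd q * (dirichlet_cos s X t * cos ((ln (INR (fst p)) - ln (INR (fst q))) * t)))))).
  2:{ intro t. unfold res_sq. rewrite <- lsum_scal. apply lsum_ext; intros. rewrite <- lsum_scal. apply lsum_ext; intros. ring. }
  rewrite grid_avg_lsum.
  apply Rle_trans with (lsum Y (fun p => lsum Y (fun q => snd p * snd q * ((div_kernel s (fst p) (fst q) + div_kernel s (fst q) (fst p)) / 2)))).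
  - right. unfold res_form.
    transitivity (lsum Y (fun p => lsum Y (fun q => / 2 * (snd p * snd q * div_kernel s (fst p) (fst q)))) + lsum Y (fun q => lsum Y (fun p => / 2 * (snd p * snd q * div_kernel s (fst p) (fst q))))).
    + rewrite <- (lsum_swap Y Y (fun p q => / 2 * (snd p * snd q * div_kernel s (fst p) (fst q)))), <- lsum_plus.
      apply lsum_ext; intros. rewrite <- lsum_plus. apply lsum_ext; intros. field.
    + rewrite <- lsum_plus. apply lsum_ext; intros. rewrite <- lsum_plus. apply lsum_ext; intros. field.
  - apply lsum_le; intros p Hp. rewrite grid_avg_lsum. apply lsum_le; intros q Hq. rewrite grid_avg_scal.
    destruct (HY p Hp), (HY q Hq). apply Rmult_le_compat_l; [nra|]. apply grid_avg_kernel_lower; assumption.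
Qed.

(** [T <= INR X] guarantees that all quotients of resonator indices occur in the partial sum. Beyond
    that [X] is free, to balance the truncation error [T X^(-s)] against [G], a bound for
    [X^(1-s)]. *)
Lemma resonance (zeta : C -> C) (s T S G : R) (X : nat) (Y : list (nat * R)) :
  is_riemann_zeta zeta -> 0 < s -> 3 <= T -> T <= INR X ->
  0 <= S -> (forall t, 1 <= t <= T -> fst (zeta (s, t)) <= S) ->
  1 <= G -> Rpower (INR X) (1 - s) <= G ->
  NoDup (map fst Y) -> (forall p, In p Y -> (1 <= fst p)%nat /\ INR (fst p) <= T /\ 0 <= snd p) ->
  res_form s Y <= 192 * (S + 2 * (2 + s) ^ 2 * (1 + 1 / s) * T * Rpower (INR X) (- s)) * res_norm Y
     + res_sum Y * res_sum Y * (G * (2 + ln (INR X)) * (4 * (1 + ln (1 + T)) / T)).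
Proof.
  intros Hz Hs HT HX HS HzS HG HXG HND HY.
  destruct (grid_exists T HT) as (n & h & Hn & Hh & HnT & HhT).
  assert (HX1 : (1 <= X)%nat) by (apply INR_le; simpl; lra).
  eapply Rle_trans; [apply (resonance_lower s X n h Y Hn)|].
  { intros p Hp. destruct (HY p Hp) as (P1 & P2 & P3). split; [split; [exact P1|apply INR_le; lra]|exact P3]. }
  eapply Rle_trans.
  { apply (resonance_upper zeta s T h S G (res_sum Y * res_sum Y) n X (res_sq Y)); try assumption; try lra.
    - apply res_sq_even.
    - intro t. apply res_sq_bounds. intros p Hp. apply HY, Hp. }
  apply Rplus_le_compat_r.
  set (E := 2 * (2 + s) ^ 2 * (1 + 1 / s) * T * Rpower (INR X) (- s)).
  assert (HE : 0 <= E).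
  { unfold E. pose proof (Rpower_pos (INR X) (- s)). assert (0 < 1 / s) by (apply Rdiv_lt_0_compat; lra).
    repeat apply Rmult_le_pos; try lra; nra. }
  pose proof (grid_avg_res_sq_le Y n h T Hn (proj1 Hh) HnT ltac:(lra) HhT HND HY) as HQ.
  replace (192 * (S + E) * res_norm Y) with ((S + E) * (192 * res_norm Y)) by ring.
  apply Rmult_le_compat_l; [lra|exact HQ].
Qed.

(** * Primes and smooth numbers *)

Definition nprime (p : nat) : Prop := (2 <= p)%nat /\ forall d, Nat.divide d p -> d = 1%nat \/ d = p.

Lemma nprime_divide_mul p a b : nprime p -> Nat.divide p (a * b) -> Nat.divide p a \/ Nat.divide p b.
Proof.
  intros [H2 Hp] H. destruct (Hp (Nat.gcd p a) (Nat.gcd_divide_l p a)) as [E|E].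
  - right. apply (Nat.gauss p a b H E).
  - left. rewrite <- E. apply Nat.gcd_divide_r.
Qed.

Lemma nprime_divisor n : (2 <= n)%nat -> exists p, nprime p /\ Nat.divide p n.
Proof.
  induction n as [n IH] using lt_wf_ind. intro Hn.
  destruct (classic (nprime n)) as [H|H]; [exists n; split; [exact H|apply Nat.divide_refl]|].
  apply not_and_or in H. destruct H as [H|H]; [contradiction|].
  apply not_all_ex_not in H. destruct H as [d H]. apply imply_to_and in H. destruct H as [Hd H].
  apply not_or_and in H. destruct H as [H1 H2].
  assert (d <= n)%nat by (apply Nat.divide_pos_le; [lia|exact Hd]).
  assert (d <> 0)%nat by (intros ->; apply Nat.divide_0_l in Hd; lia).
  destruct (IH d ltac:(lia) ltac:(lia)) as (p & Hp & Hpd).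
  exists p. split; [exact Hp|]. eapply Nat.divide_trans; eassumption.
Qed.

Lemma in_divisors d n : (1 <= n)%nat -> In d (divisors n) <-> Nat.divide d n.
Proof.
  intro Hn. unfold divisors. rewrite filter_In, in_seq, Nat.eqb_eq. split.
  - intros [_ H]. apply Nat.Lcm0.mod_divide. exact H.
  - intro H. split; [|apply Nat.Lcm0.mod_divide; exact H].
    pose proof (Nat.divide_pos_le d n ltac:(lia) H).
    assert (d <> 0)%nat by (intros ->; apply Nat.divide_0_l in H; lia). lia.
Qed.

Lemma divisors_NoDup n : NoDup (divisors n).
Proof. apply NoDup_filter, seq_NoDup. Qed.

Lemma divide_pos d n : (1 <= n)%nat -> Nat.divide d n -> (1 <= d <= n)%nat.
Proof.
  intros Hn H. pose proof (Nat.divide_pos_le d n ltac:(lia) H).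
  assert (d <> 0)%nat by (intros ->; apply Nat.divide_0_l in H; lia). lia.
Qed.

Lemma divide_mul_div d n : (1 <= n)%nat -> Nat.divide d n -> n = (d * (n / d))%nat /\ (1 <= n / d)%nat /\ Nat.divide (n / d) n.
Proof.
  intros Hn H. pose proof (divide_pos d n Hn H) as Hd. destruct H as [q Hq].
  assert (E : (n / d = q)%nat) by (subst n; apply Nat.div_mul; lia).
  rewrite E. split; [lia|]. split; [destruct q; lia|]. exists d. lia.
Qed.

Inductive psmooth (P : list nat) : nat -> Prop :=
| psmooth_1 : psmooth P 1
| psmooth_mul p b : In p P -> psmooth P b -> psmooth P (p * b).

Definition pfree (P : list nat) (a : nat) : Prop := forall p, In p P -> ~ Nat.divide p a.

Lemma psmooth_pos P b : (forall p, In p P -> (1 <= p)%nat) -> psmooth P b -> (1 <= b)%nat.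
Proof. intros HP. induction 1 as [|p b Hp Hb IH]; [lia|]. specialize (HP p Hp). nia. Qed.

Lemma psmooth_divide P b d : (forall p, In p P -> nprime p) -> psmooth P b -> Nat.divide d b -> psmooth P d.
Proof.
  intros HP Hb. revert d. induction Hb as [|p b Hp Hb IH]; intros d Hd.
  - apply Nat.divide_1_r in Hd. subst. constructor.
  - destruct (Nat.divide_mul_split d p b) as (q & r & -> & Hq & Hr); [|exact Hd|].
    + intros ->. apply Nat.divide_0_l in Hd. assert (1 <= b)%nat by (apply (psmooth_pos P); [intros x Hx; destruct (HP x Hx); lia|exact Hb]).
      destruct (HP p Hp). nia.
    + destruct (proj2 (HP p Hp) q Hq) as [->| ->].
      * rewrite Nat.mul_1_l. auto.
      * constructor; auto.
Qed.

Lemma psmooth_restrict P P' d : psmooth P d -> (forall p, In p P -> Nat.divide p d -> In p P') -> psmooth P' d.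
Proof.
  induction 1 as [|p b Hp Hb IH]; intro H; [constructor|]. constructor.
  - apply H; [exact Hp|]. apply Nat.divide_mul_l, Nat.divide_refl.
  - apply IH. intros q Hq Hqb. apply H; [exact Hq|]. now apply Nat.divide_mul_r.
Qed.

Lemma psmooth_cases P b : psmooth P b -> b = 1%nat \/ exists p c, In p P /\ b = (p * c)%nat.
Proof. destruct 1 as [|p c Hp _]; [now left|right; exists p, c; auto]. Qed.

Lemma psmooth_pfree_coprime P a b : (forall p, In p P -> nprime p) -> psmooth P b -> pfree P a -> Nat.gcd b a = 1%nat.
Proof.
  intros HP Hb Ha.
  pose proof (psmooth_divide P b (Nat.gcd b a) HP Hb (Nat.gcd_divide_l b a)) as Hg.
  destruct (psmooth_cases P _ Hg) as [E|(p & c & Hp & E)]; [exact E|]. exfalso.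
  apply (Ha p Hp). eapply Nat.divide_trans; [|apply (Nat.gcd_divide_r b a)]. rewrite E. apply Nat.divide_mul_l, Nat.divide_refl.
Qed.

Lemma smooth_free_split P n : (forall p, In p P -> nprime p) -> (1 <= n)%nat ->
  exists b a, n = (b * a)%nat /\ psmooth P b /\ pfree P a.
Proof.
  intro HP. induction n as [n IH] using lt_wf_ind. intro Hn.
  destruct (classic (pfree P n)) as [H|H].
  - exists 1%nat, n. split; [lia|]. split; [constructor|exact H].
  - apply not_all_ex_not in H. destruct H as [p H]. apply imply_to_and in H. destruct H as [Hp H].
    apply NNPP in H. destruct (HP p Hp) as [Hp2 _].
    destruct (divide_mul_div p n Hn H) as (E & E1 & _).
    destruct (IH (n / p)%nat ltac:(nia) E1) as (b & a & E2 & Hb & Ha).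
    exists (p * b)%nat, a. split; [lia|]. split; [now constructor|exact Ha].
Qed.

Lemma smooth_free_unique P b a b' a' : (forall p, In p P -> nprime p) ->
  psmooth P b -> pfree P a -> psmooth P b' -> pfree P a' -> (b * a = b' * a')%nat -> b = b' /\ a = a'.
Proof.
  intros HP Hb Ha Hb' Ha' E.
  assert (Pos : forall x, psmooth P x -> (1 <= x)%nat) by (intros x; apply psmooth_pos; intros y Hy; destruct (HP y Hy); lia).
  assert (b = b').
  { apply Nat.divide_antisym.
    - apply (Nat.gauss b a' b'); [exists a; lia|]. eapply psmooth_pfree_coprime; eassumption.
    - apply (Nat.gauss b' a b); [exists a'; lia|]. eapply psmooth_pfree_coprime; eassumption. }
  subst. split; [reflexivity|]. specialize (Pos b' Hb'). nia.
Qed.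

Lemma psmooth_all_primes P n : (1 <= n)%nat -> (forall p, nprime p -> Nat.divide p n -> In p P) -> psmooth P n.
Proof.
  induction n as [n IH] using lt_wf_ind. intros Hn H.
  destruct (Nat.eq_dec n 1) as [->|Hne]; [constructor|].
  destruct (nprime_divisor n ltac:(lia)) as (p & Hp & Hd).
  destruct (divide_mul_div p n Hn Hd) as (E & E1 & E2). destruct Hp as [Hp2 Hp'].
  rewrite E. constructor; [apply H; [split; assumption|exact Hd]|].
  apply IH; [nia|exact E1|]. intros q Hq Hqn. apply H; [exact Hq|]. eapply Nat.divide_trans; eassumption.
Qed.

Definition lprod {A : Type} (l : list A) (f : A -> R) : R := fold_right Rmult 1 (map f l).

Lemma lprod_cons {A} (x : A) l f : lprod (x :: l) f = f x * lprod l f.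
Proof. reflexivity. Qed.

Lemma lprod_le {A} (l : list A) f g : (forall x, In x l -> 0 <= f x <= g x) -> lprod l f <= lprod l g.
Proof.
  induction l as [|x l IH]; intro H; [unfold lprod; simpl; lra|]. rewrite !lprod_cons.
  assert (0 <= lprod l f).
  { clear IH. assert (H' : forall y, In y l -> 0 <= f y <= g y) by (intros; apply H; now right). clear H.
    induction l as [|y l IH]; [unfold lprod; simpl; lra|]. rewrite lprod_cons.
    apply Rmult_le_pos; [apply H'; now left|]. apply IH. intros; apply H'. now right. }
  destruct (H x (or_introl eq_refl)). apply Rmult_le_compat; try assumption. apply IH. intros; apply H. now right.
Qed.

Lemma lprod_const {A} (l : list A) c : lprod l (fun _ => c) = c ^ length l.
Proof. induction l as [|x l IH]; [reflexivity|]. rewrite lprod_cons, IH. reflexivity. Qed.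

Lemma lprod_exp {A} (l : list A) f : lprod l (fun x => exp (f x)) = exp (lsum l f).
Proof.
  induction l as [|x l IH]; [unfold lprod, lsum; simpl; now rewrite exp_0|]. rewrite lprod_cons, IH, lsum_cons, exp_plus. reflexivity.
Qed.

Lemma Rpower_INR_mult a b x : (1 <= a)%nat -> (1 <= b)%nat -> Rpower (INR (a * b)) x = Rpower (INR a) x * Rpower (INR b) x.
Proof. intros Ha Hb. rewrite mult_INR. symmetry. apply Rpower_mult_distr; apply lt_0_INR; lia. Qed.

Lemma Rpower_INR_pow p j x : (1 <= p)%nat -> Rpower (INR (p ^ j)) x = Rpower (INR p) x ^ j.
Proof.
  intro Hp. induction j as [|j IH]; [apply Rpower_1_l|]. rewrite Nat.pow_succ_r', Rpower_INR_mult, IH; [reflexivity|exact Hp|].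
  assert (p ^ j <> 0)%nat by (apply Nat.pow_nonzero; lia). lia.
Qed.

Lemma geometric_lsum x J : 0 <= x < 1 -> lsum (seq 0 J) (fun j => x ^ j) <= / (1 - x).
Proof.
  intro Hx. assert (E : (1 - x) * lsum (seq 0 J) (fun j => x ^ j) = 1 - x ^ J).
  { induction J as [|J IH]; [change (lsum (seq 0 0) (fun j => x ^ j)) with 0; simpl; ring|].
    rewrite lsum_seq_S, Rmult_plus_distr_l, IH, Nat.add_0_l. simpl. ring. }
  apply (Rmult_le_reg_l (1 - x)); [lra|]. rewrite E, Rinv_r by lra. pose proof (pow_le x J (proj1 Hx)). lra.
Qed.

Lemma Rpower_neg_lt_1 (p : nat) a : (2 <= p)%nat -> 0 < a -> 0 < Rpower (INR p) (- a) < 1.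
Proof.
  intros Hp Ha. split; [apply Rpower_pos|]. rewrite Rpower_Ropp.
  assert (1 < INR p) by (apply le_INR in Hp; simpl in Hp; lra).
  assert (1 < Rpower (INR p) a) by (rewrite <- (Rpower_O (INR p)) by lra; apply Rpower_lt; lra).
  rewrite <- Rinv_1. apply Rinv_lt_contravar; lra.
Qed.

(** Truncated Euler product, by induction on [P]: every smooth number is some [p^j * c], and the sum
    over all such pairs factors into a geometric series and the sum for the remaining primes. *)
Lemma euler_bound (a : R) (P : list nat) : 0 < a -> (forall p, In p P -> (2 <= p)%nat) ->
  forall D, NoDup D -> (forall d, In d D -> psmooth P d) ->
  lsum D (fun d => Rpower (INR d) (- a)) <= lprod P (fun p => / (1 - Rpower (INR p) (- a))).
Proof.
  intros Ha. induction P as [|p P IH]; intros HP D HD HS.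
  - assert (H1 : forall d, In d D -> d = 1%nat).
    { intros d Hd. destruct (psmooth_cases _ _ (HS d Hd)) as [E|(q & c & [] & _)]. exact E. }
    unfold lprod; simpl. rewrite <- (Rpower_1_l (- a)). change 1 with (INR 1) at 1.
    replace (Rpower (INR 1) (- a)) with (lsum [1%nat] (fun d => Rpower (INR d) (- a))) by (unfold lsum; simpl; ring).
    apply lsum_incl; [exact HD| |intros; left; apply Rpower_pos].
    intros d Hd. left. symmetry. auto.
  - assert (Hp2 : (2 <= p)%nat) by (apply HP; now left).
    assert (HP' : forall q, In q P -> (2 <= q)%nat) by (intros; apply HP; now right).
    assert (split_p : forall d, psmooth (p :: P) d -> exists j c, d = (p ^ j * c)%nat /\ psmooth P c).
    { induction 1 as [|q b Hq Hb (j & c & -> & Hc)]; [exists 0%nat, 1%nat; split; [reflexivity|constructor]|].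
      destruct Hq as [<-|Hq].
      - exists (S j), c. split; [simpl; ring|exact Hc].
      - exists j, (q * c)%nat. split; [ring|now constructor]. }
    (* One bound for exponents and cofactors alike, because [j < p^j]. *)
    set (N := S (list_max D)).
    set (D' := filter (fun c => if excluded_middle_informative (psmooth P c) then true else false) (seq 1 N)).
    assert (HDmax : forall d, In d D -> (d < N)%nat).
    { pose proof (proj1 (list_max_le D (list_max D)) (le_n _)) as LM. rewrite Forall_forall in LM.
      intros d Hd. specialize (LM d Hd). unfold N. lia. }
    assert (HD' : forall c, In c D' -> psmooth P c /\ (1 <= c)%nat).
    { intros c Hc. apply filter_In in Hc. destruct Hc as [Hc1 Hc2]. apply in_seq in Hc1.
      destruct (excluded_middle_informative (psmooth P c)); [split; [assumption|lia]|discriminate]. }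
    apply Rle_trans with (lsum (list_prod (seq 0 N) D') (fun y => Rpower (INR (p ^ fst y * snd y)) (- a))).
    + apply (lsum_le_surj (fun y : nat * nat => (p ^ fst y * snd y)%nat) D _ (fun d => Rpower (INR d) (- a))); [exact HD| |intros; left; apply Rpower_pos].
      intros d Hd. destruct (split_p d (HS d Hd)) as (j & c & E & Hc). exists (j, c). split; [|simpl; lia].
      specialize (HDmax d Hd).
      assert (1 <= c)%nat by (apply (psmooth_pos P); [intros q Hq; specialize (HP' q Hq); lia|exact Hc]).
      assert (j < p ^ j)%nat by (apply Nat.pow_gt_lin_r; lia).
      apply in_prod; [apply in_seq; nia|]. apply filter_In. split; [apply in_seq; nia|].
      destruct (excluded_middle_informative (psmooth P c)); [reflexivity|contradiction].
    + rewrite lsum_list_prod, lprod_cons. cbn [fst snd].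
      pose proof (Rpower_neg_lt_1 p a Hp2 Ha) as Hx.
      apply Rle_trans with (lsum (seq 0 N) (fun j => Rpower (INR p) (- a) ^ j * lsum D' (fun c => Rpower (INR c) (- a)))).
      * right. apply lsum_ext; intros j _. rewrite <- lsum_scal. apply lsum_ext; intros c Hc.
        destruct (HD' c Hc). rewrite Rpower_INR_mult, Rpower_INR_pow by (try assumption; try lia; assert (p ^ j <> 0)%nat by (apply Nat.pow_nonzero; lia); lia). reflexivity.
      * rewrite lsum_scal_r. apply Rmult_le_compat.
        -- apply lsum_nonneg; intros; apply pow_le; lra.
        -- apply lsum_nonneg; intros; left; apply Rpower_pos.
        -- apply geometric_lsum. lra.
        -- apply IH; [exact HP'|apply NoDup_filter, seq_NoDup|]. intros d Hd. apply HD', Hd.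
Qed.

Lemma prime_list_product_le (P : list nat) n : NoDup P -> (forall p, In p P -> nprime p /\ Nat.divide p n) -> (1 <= n)%nat ->
  Nat.divide (fold_right Nat.mul 1%nat P) n.
Proof.
  intros HN HP Hn. 
  assert (G : forall q l, nprime q -> (forall p, In p l -> nprime p) -> Nat.divide q (fold_right Nat.mul 1%nat l) -> In q l).
  { intros q l Hq. induction l as [|p l IH]; intros Hl Hd.
    - simpl in Hd. apply Nat.divide_1_r in Hd. destruct Hq; lia.
    - simpl in Hd. apply nprime_divide_mul in Hd; [|exact Hq]. destruct Hd as [Hd|Hd].
      + left. destruct (Hl p (or_introl eq_refl)) as [_ Hp]. destruct (Hp q Hd) as [E|E]; [destruct Hq; lia|auto].
      + right. apply IH; [intros; apply Hl; now right|exact Hd]. }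
  induction HN as [|p P Hp HN IH]; [exists n; simpl; lia|]. simpl.
  destruct IH as [k Hk]; [intros; apply HP; now right|].
  destruct (HP p (or_introl eq_refl)) as [Pp Pd]. rewrite Hk in Pd.
  apply nprime_divide_mul in Pd; [|exact Pp]. destruct Pd as [[k' Hk']|Pd].
  - exists k'. rewrite Hk, Hk'. ring.
  - exfalso. apply Hp. apply G; [exact Pp| |exact Pd]. intros; apply HP; now right.
Qed.

Lemma pow_length_le (P : list nat) n (Q : R) : NoDup P -> (forall p, In p P -> nprime p /\ Nat.divide p n) -> (1 <= n)%nat ->
  0 <= Q -> (forall p, In p P -> Q <= INR p) -> Q ^ length P <= INR n.
Proof.
  intros HN HP Hn HQ HQp. apply Rle_trans with (INR (fold_right Nat.mul 1%nat P)).
  - clear HN HP. induction P as [|p P IH]; [simpl; lra|]. simpl fold_right. simpl length. rewrite mult_INR. simpl pow.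
    apply Rmult_le_compat; [exact HQ|apply pow_le, HQ|apply HQp; now left|apply IH; intros; apply HQp; now right].
  - apply le_INR, Nat.divide_pos_le; [lia|]. now apply prime_list_product_le.
Qed.

(** * Divisor sums *)

Lemma divide_prime_pow p e q : nprime p -> Nat.divide q (p ^ e) -> exists j, (j <= e)%nat /\ q = (p ^ j)%nat.
Proof.
  intro Hp. revert q. induction e as [|e IH]; intros q Hq.
  - apply Nat.divide_1_r in Hq. exists 0%nat. split; [lia|exact Hq].
  - simpl in Hq. destruct (Nat.divide_mul_split q p (p ^ e)) as (x & y & -> & Hx & Hy); [|exact Hq|].
    + intros ->. apply Nat.divide_0_l in Hq. assert (p ^ S e <> 0)%nat by (apply Nat.pow_nonzero; destruct Hp; lia). simpl in H. lia.
    + destruct (IH y Hy) as (j & Hj & ->). destruct (proj2 Hp x Hx) as [->| ->].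
      * exists j. split; lia.
      * exists (S j). split; [lia|reflexivity].
Qed.

Lemma prime_power_split p n : (2 <= p)%nat -> (1 <= n)%nat ->
  exists e m, n = (p ^ e * m)%nat /\ ~ Nat.divide p m /\ (1 <= m)%nat.
Proof.
  intro Hp. induction n as [n IH] using lt_wf_ind. intro Hn.
  destruct (classic (Nat.divide p n)) as [H|H].
  - destruct (divide_mul_div p n Hn H) as (E & E1 & _).
    destruct (IH (n / p)%nat ltac:(nia) E1) as (e & m & E2 & H2 & H3).
    exists (S e), m. split; [simpl; lia|]. split; assumption.
  - exists 0%nat, n. split; [simpl; lia|]. split; assumption.
Qed.

Lemma divisors_prime_power p e m : nprime p -> (1 <= m)%nat ->
  INR (length (divisors (p ^ e * m))) <= (INR e + 1) * INR (length (divisors m)).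
Proof.
  intros Hp Hm.
  assert (Hpe : (p ^ e <> 0)%nat) by (apply Nat.pow_nonzero; destruct Hp; lia).
  assert (H : lsum (divisors (p ^ e * m)) (fun _ => 1) <= lsum (list_prod (seq 0 (S e)) (divisors m)) (fun _ => 1)).
  { apply (lsum_le_surj (fun y : nat * nat => (p ^ fst y * snd y)%nat) _ _ (fun _ => 1)); [apply divisors_NoDup| |intros; lra].
    intros d Hd. apply in_divisors in Hd; [|nia].
    assert (d <> 0)%nat by (intros ->; apply Nat.divide_0_l in Hd; nia).
    destruct (Nat.divide_mul_split d (p ^ e) m H Hd) as (q & r & -> & Hq & Hr).
    destruct (divide_prime_pow p e q Hp Hq) as (j & Hj & ->).
    exists (j, r). split; [|reflexivity]. apply in_prod; [apply in_seq; lia|]. apply in_divisors; assumption. }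
  rewrite !lsum_const, !Rmult_1_r, length_prod, mult_INR, length_seq, S_INR in H. exact H.
Qed.

Lemma linear_le_exp (c : R) (e : nat) : 0 < c -> INR e + 1 <= (1 + / c) * exp (c * INR e).
Proof.
  intro Hc. pose proof (exp_ineq1_le (c * INR e)) as H. pose proof (pos_INR e).
  assert (0 < / c) by now apply Rinv_0_lt_compat.
  apply Rle_trans with ((1 + / c) * (1 + c * INR e)); [|apply Rmult_le_compat_l; lra].
  replace ((1 + / c) * (1 + c * INR e)) with (1 + / c + c * INR e + INR e * (/ c * c)) by ring.
  rewrite Rinv_l by lra. nra.
Qed.

(** [e + 1 <= 2^e <= p^(theta e)] for every prime power [p^e] exactly dividing [n]. *)
Lemma divisor_bound_large (theta : R) (B : nat) : 0 < theta -> (2 <= B)%nat -> 2 <= Rpower (INR B) theta ->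
  forall n, (1 <= n)%nat -> (forall p, nprime p -> Nat.divide p n -> (B <= p)%nat) ->
  INR (length (divisors n)) <= Rpower (INR n) theta.
Proof.
  intros Ht HB2 HB. induction n as [n IH] using lt_wf_ind. intros Hn Hp.
  destruct (Nat.eq_dec n 1) as [->|Hne]; [rewrite Rpower_1_l; simpl; lra|].
  destruct (nprime_divisor n ltac:(lia)) as (p & Pp & Pd).
  destruct (prime_power_split p n (proj1 Pp) Hn) as (e & m & E & Hm & Hm1).
  assert (e <> 0)%nat. { intros ->. apply Hm. rewrite E in Pd. simpl in Pd. rewrite Nat.add_0_r in Pd. exact Pd. }
  assert (Hpe : (1 <= p ^ e)%nat) by (assert (p ^ e <> 0)%nat by (apply Nat.pow_nonzero; destruct Pp; lia); lia).
  assert (Hpe2 : (2 <= p ^ e)%nat) by (destruct e; [lia|]; simpl; assert (p ^ e <> 0)%nat by (apply Nat.pow_nonzero; destruct Pp; lia); destruct Pp; nia).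
  rewrite E. eapply Rle_trans; [apply divisors_prime_power; assumption|].
  rewrite Rpower_INR_mult, Rpower_INR_pow by (try assumption; destruct Pp; lia).
  apply Rmult_le_compat; [pose proof (pos_INR e); lra|apply pos_INR| |].
  - apply Rle_trans with (2 ^ e).
    + clear. induction e as [|e IH]; [simpl; lra|]. rewrite S_INR. simpl pow.
      assert (1 <= 2 ^ e) by (apply pow_R1_Rle; lra). lra.
    + apply pow_incr. split; [lra|]. eapply Rle_trans; [exact HB|]. apply Rle_Rpower_l; [lra|].
      split; [apply lt_0_INR; lia|apply le_INR, Hp; assumption].
  - apply IH; [nia|exact Hm1|]. intros q Hq Hqm. apply Hp; [exact Hq|]. rewrite E. now apply Nat.divide_mul_r.
Qed.

Lemma divisor_bound (theta : R) : 0 < theta -> exists C, 0 < C /\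
  forall n, (1 <= n)%nat -> INR (length (divisors n)) <= C * Rpower (INR n) theta.
Proof.
  intro Ht.
  destruct (nfloor_ex (Rpower 2 (/ theta))) as [B0 [_ HB0]]; [left; apply Rpower_pos|].
  set (B := (S (S B0))%nat).
  assert (HB : 2 <= Rpower (INR B) theta).
  { replace 2 with (Rpower (Rpower 2 (/ theta)) theta).
    - apply Rle_Rpower_l; [lra|]. split; [apply Rpower_pos|]. unfold B. rewrite !S_INR. lra.
    - rewrite Rpower_mult, Rinv_l, Rpower_1 by lra. reflexivity. }
  assert (G : forall k, (k <= B - 2)%nat -> exists C, 0 < C /\ forall n, (1 <= n)%nat ->
     (forall p, nprime p -> Nat.divide p n -> (B - k <= p)%nat) -> INR (length (divisors n)) <= C * Rpower (INR n) theta).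
  { induction k as [|k IH]; intro Hk.
    - exists 1. split; [lra|]. intros n Hn H. rewrite Rmult_1_l. apply (divisor_bound_large theta B); try assumption. unfold B; lia.
    - destruct (IH ltac:(lia)) as (C & HC & H). set (p := (B - S k)%nat).
      assert (Hc : 0 < theta * ln 2) by (apply Rmult_lt_0_compat; [exact Ht|]; rewrite <- ln_1; apply ln_increasing; lra).
      destruct (classic (nprime p)) as [Hp|Hp].
      + exists ((1 + / (theta * ln 2)) * C). split.
        { apply Rmult_lt_0_compat; [|exact HC]. pose proof (Rinv_0_lt_compat _ Hc). lra. }
        intros n Hn Hq. destruct (prime_power_split p n (proj1 Hp) Hn) as (e & m & E & Hm & Hm1).
        assert (Hpe : (1 <= p ^ e)%nat) by (assert (p ^ e <> 0)%nat by (apply Nat.pow_nonzero; destruct Hp; lia); lia).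
        rewrite E. eapply Rle_trans; [apply divisors_prime_power; assumption|].
        rewrite Rpower_INR_mult, Rpower_INR_pow by (try assumption; destruct Hp; lia).
        replace ((1 + / (theta * ln 2)) * C * (Rpower (INR p) theta ^ e * Rpower (INR m) theta))
          with (((1 + / (theta * ln 2)) * Rpower (INR p) theta ^ e) * (C * Rpower (INR m) theta)) by ring.
        apply Rmult_le_compat; [pose proof (pos_INR e); lra|apply pos_INR| |].
        * eapply Rle_trans; [apply (linear_le_exp _ e Hc)|]. apply Rmult_le_compat_l; [pose proof (Rinv_0_lt_compat _ Hc); lra|].
          replace (exp (theta * ln 2 * INR e)) with (Rpower 2 theta ^ e).
          -- apply pow_incr. split; [left; apply Rpower_pos|]. apply Rle_Rpower_l; [lra|]. split; [lra|].
             destruct Hp as [Hp _]. apply le_INR in Hp. simpl in Hp. lra.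
          -- rewrite <- Rpower_pow by apply Rpower_pos. rewrite Rpower_mult. unfold Rpower. f_equal. ring.
        * apply H; [exact Hm1|]. intros q Pq Qm.
          assert (Hqn : Nat.divide q n) by (rewrite E; now apply Nat.divide_mul_r).
          specialize (Hq q Pq Hqn). fold p in Hq. assert (q <> p) by (intros ->; contradiction). unfold p in *. lia.
      + exists C. split; [exact HC|]. intros n Hn Hq. apply H; [exact Hn|]. intros q Pq Qn. specialize (Hq q Pq Qn).
        fold p in Hq. assert (q <> p) by (intros ->; contradiction). unfold p in *. lia. }
  destruct (G (B - 2)%nat (le_n _)) as (C & HC & H). exists C. split; [exact HC|]. intros n Hn. apply H; [exact Hn|].
  intros p [Hp _] _. unfold B. lia.
Qed.

(** * The coefficients c and b and their l2 norms *)

Definition wt (e : R) (n : nat) : R := Rpower (INR n) (- e).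

(** The [b_n] of the overview in convolution form, with [wt e] for [c_n]; [conv_sigma] recovers the
    divisor function of the theorem. *)
Definition conv (s e : R) (n : nat) : R := lsum (divisors n) (fun d => wt s d * wt e (n / d)).

Lemma wt_pos e n : 0 < wt e n.
Proof. apply Rpower_pos. Qed.

Lemma wt_mult e a b : (1 <= a)%nat -> (1 <= b)%nat -> wt e (a * b) = wt e a * wt e b.
Proof. apply Rpower_INR_mult. Qed.

Lemma wt_le_1 e n : 0 <= e -> (1 <= n)%nat -> wt e n <= 1.
Proof.
  intros He Hn. apply Rle_trans with (Rpower 1 (- e)); [|right; apply Rpower_1_l].
  apply Rpower_decr; [|exact He]. split; [lra|apply INR_pos_ge1, Hn].
Qed.

Lemma wt_1 e : wt e 1 = 1.
Proof. apply Rpower_1_l. Qed.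

Lemma conv_nonneg s e n : 0 <= conv s e n.
Proof. apply lsum_nonneg; intros. apply Rmult_le_pos; left; apply wt_pos. Qed.

Lemma conv_ge_wt s e n : (1 <= n)%nat -> wt e n <= conv s e n.
Proof.
  intro Hn. pose proof (lsum_single_le (divisors n) (fun d => wt s d * wt e (n / d)) 1%nat) as H.
  cbv beta in H. rewrite wt_1, Rmult_1_l, Nat.div_1_r in H. apply H.
  - apply in_divisors; [exact Hn|apply Nat.divide_1_l].
  - intros. apply Rmult_le_pos; left; apply wt_pos.
Qed.

Lemma conv_sigma s e n : (1 <= n)%nat -> conv s e n = wt e n * sigma_div (- s + e) n.
Proof.
  intro Hn. unfold sigma_div. change (sum_over (divisors n)) with (@lsum nat (divisors n)). rewrite <- lsum_scal.
  apply lsum_ext. intros d Hd. apply in_divisors in Hd; [|exact Hn].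
  destruct (divide_mul_div d n Hn Hd) as (E & E1 & _). pose proof (divide_pos d n Hn Hd).
  rewrite E at 2. rewrite wt_mult by lia. unfold wt.
  replace (- s + e) with (- s + - (- e)) by ring. rewrite Rpower_plus, (Rpower_Ropp _ (- e)).
  pose proof (Rpower_pos (INR d) (- e)). field. lra.
Qed.

Lemma conv_le_divisors s e n : 0 <= e <= s -> (1 <= n)%nat -> conv s e n <= wt e n * INR (length (divisors n)).
Proof.
  intros He Hn. rewrite conv_sigma by exact Hn. apply Rmult_le_compat_l; [left; apply wt_pos|].
  unfold sigma_div. change (sum_over (divisors n)) with (@lsum nat (divisors n)).
  rewrite <- (Rmult_1_r (INR _)), <- lsum_const. apply lsum_le. intros d Hd. apply in_divisors in Hd; [|exact Hn].
  pose proof (divide_pos d n Hn Hd). replace (- s + e) with (- (s - e)) by ring. apply wt_le_1; [lra|lia].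
Qed.

(** Divisors of [a * b] are products of a divisor of [a] and one of [b], possibly in several ways,
    hence an inequality for arbitrary [a] and [b]. *)
Lemma conv_submult s e a b : (1 <= a)%nat -> (1 <= b)%nat -> conv s e (a * b) <= conv s e a * conv s e b.
Proof.
  intros Ha Hb.
  apply Rle_trans with (lsum (list_prod (divisors a) (divisors b)) (fun y => wt s (fst y * snd y) * wt e (a * b / (fst y * snd y)))).
  - apply (lsum_le_surj (fun y : nat * nat => (fst y * snd y)%nat) (divisors (a * b)) _ (fun d => wt s d * wt e (a * b / d))); [apply divisors_NoDup| |].
    + intros d Hd. apply in_divisors in Hd; [|nia]. assert (d <> 0)%nat by (intros ->; apply Nat.divide_0_l in Hd; nia).
      destruct (Nat.divide_mul_split d a b H Hd) as (q & r & -> & Hq & Hr). exists (q, r). split; [|reflexivity].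
      apply in_prod; apply in_divisors; assumption.
    + intros. apply Rmult_le_pos; left; apply wt_pos.
  - rewrite lsum_list_prod. unfold conv. rewrite <- lsum_scal_r. right. apply lsum_ext; intros q Hq. rewrite <- lsum_scal.
    apply lsum_ext; intros r Hr. cbn [fst snd]. apply in_divisors in Hq, Hr; try assumption.
    destruct (divide_mul_div q a Ha Hq) as (E1 & F1 & _). destruct (divide_mul_div r b Hb Hr) as (E2 & F2 & _).
    pose proof (divide_pos q a Ha Hq). pose proof (divide_pos r b Hb Hr).
    assert (E : (a * b / (q * r) = (a / q) * (b / r))%nat).
    { rewrite E1 at 1. rewrite E2 at 1. replace (q * (a / q) * (r * (b / r)))%nat with ((a / q) * (b / r) * (q * r))%nat by ring.
      apply Nat.div_mul. nia. }
    rewrite E, !wt_mult by lia. ring.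
Qed.

(** Cauchy-Schwarz with [d^(-s) = d^(-(s - tau) / 2) d^(-(s + tau) / 2)], then [n = d * k] with [d]
    and [k] again in [B]. The parameter [tau] moves weight between [S1], a sum over the divisors of
    a single [n], which has few prime factors, and [S2], a sum over the whole set. *)
Lemma conv_l2_bound (s e tau S1 S2 : R) (B : list nat) :
  NoDup B -> (forall n, In n B -> (1 <= n)%nat) -> factor_closed B ->
  (forall n, In n B -> lsum (divisors n) (wt (s - tau)) <= S1) -> lsum B (wt (s + tau)) <= S2 ->
  lsum B (fun n => conv s e n * conv s e n) <= S1 * S2 * lsum B (fun n => wt e n * wt e n).
Proof.
  intros HN HB HF H1 H2.
  assert (HS0 : forall n, In n B -> 0 <= S1).
  { intros n Hn. eapply Rle_trans; [|apply (H1 n Hn)]. apply lsum_nonneg; intros; left; apply wt_pos. }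
  set (f := fun d k => wt (s + tau) d * (wt e k * wt e k)).
  assert (Hf : forall d k, 0 <= f d k) by (intros; unfold f; pose proof (wt_pos (s + tau) d); pose proof (wt_pos e k); nra).
  assert (C1 : forall n, In n B -> conv s e n * conv s e n <= S1 * lsum (divisors n) (fun d => f d (n / d)%nat)).
  { intros n Hn.
    set (u := fun d : nat => Rpower (INR d) (- ((s - tau) / 2))). set (v := fun d => Rpower (INR d) (- ((s + tau) / 2)) * wt e (n / d)).
    assert (E : conv s e n = lsum (divisors n) (fun d => u d * v d)).
    { apply lsum_ext; intros d _. unfold u, v, wt. rewrite <- Rmult_assoc, <- Rpower_plus. do 2 f_equal. field. }
    rewrite E. eapply Rle_trans; [apply lsum_cauchy|]. apply Rmult_le_compat.
    - apply lsum_nonneg; intros; unfold u; pose proof (Rpower_pos (INR x) (- ((s - tau) / 2))); nra.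
    - apply lsum_nonneg; intros. apply Rle_0_sqr.
    - eapply Rle_trans; [|apply (H1 n Hn)]. apply lsum_le; intros d _. unfold u, wt. rewrite <- Rpower_plus. right. f_equal. field.
    - apply lsum_le; intros d _. unfold v, f, wt. right.
      transitivity (Rpower (INR d) (- ((s + tau) / 2)) * Rpower (INR d) (- ((s + tau) / 2)) * (Rpower (INR (n / d)) (- e) * Rpower (INR (n / d)) (- e))); [ring|].
      f_equal. rewrite <- Rpower_plus. f_equal. field. }
  apply Rle_trans with (lsum B (fun n => S1 * lsum (divisors n) (fun d => f d (n / d)%nat))).
  { apply lsum_le. exact C1. }
  rewrite lsum_scal.
  destruct B as [|n0 B0]; [unfold lsum; simpl; lra|]. set (B := n0 :: B0) in *.
  rewrite Rmult_assoc. apply Rmult_le_compat_l; [apply (HS0 n0); now left|].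
  apply Rle_trans with (lsum B (fun d => lsum B (fun k => f d k))).
  2:{ unfold f. rewrite (lsum_ext B _ (fun d => wt (s + tau) d * lsum B (fun k => wt e k * wt e k))) by (intros; apply lsum_scal).
      rewrite lsum_scal_r. apply Rmult_le_compat_r; [|exact H2]. apply lsum_nonneg; intros k _. pose proof (wt_pos e k). nra. }
  (* For fixed [d] the map [n -> n / d] is injective on multiples of [d] and stays in the
     factor-closed [B]. *)
  set (dv := fun d n => Nat.eqb (n mod d) 0).
  apply Rle_trans with (lsum B (fun n => lsum B (fun d => if dv d n then f d (n / d)%nat else 0))).
  - apply lsum_le; intros n Hn. rewrite <- lsum_filter. apply lsum_incl; [apply divisors_NoDup| |intros; apply Hf].
    intros d Hd. apply in_divisors in Hd; [|auto]. apply filter_In. split; [exact (HF d n Hd Hn)|].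
    unfold dv. apply Nat.eqb_eq, Nat.Lcm0.mod_divide. exact Hd.
  - rewrite lsum_swap. apply lsum_le; intros d Hd. rewrite <- lsum_filter.
    apply (lsum_le_inj (fun n => n / d)%nat B _ (fun k => f d k)); [now apply NoDup_filter| | |intros; apply Hf].
    + intros x y Hx Hy E. apply filter_In in Hx, Hy. destruct Hx as [Hx1 Hx2], Hy as [Hy1 Hy2].
      apply Nat.eqb_eq, Nat.Lcm0.mod_divide in Hx2, Hy2.
      destruct (divide_mul_div d x (HB x Hx1) Hx2) as (E1 & _). destruct (divide_mul_div d y (HB y Hy1) Hy2) as (E2 & _).
      rewrite E1, E2, E. reflexivity.
    + intros n Hn. apply filter_In in Hn. destruct Hn as [Hn1 Hn2]. apply Nat.eqb_eq, Nat.Lcm0.mod_divide in Hn2.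
      destruct (divide_mul_div d n (HB n Hn1) Hn2) as (_ & _ & E). exact (HF _ n E Hn1).
Qed.

(** * Fibres and resonators *)

Definition pbool (P : Prop) : bool := if excluded_middle_informative P then true else false.

Lemma pbool_true P : pbool P = true <-> P.
Proof. unfold pbool. destruct (excluded_middle_informative P); split; auto; discriminate. Qed.

Lemma in_filter_pbool {A} (P : A -> Prop) l x : In x (filter (fun y => pbool (P y)) l) <-> In x l /\ P x.
Proof. rewrite filter_In, pbool_true. reflexivity. Qed.

Lemma NoDup_list_prod {A B} (l : list A) (l' : list B) : NoDup l -> NoDup l' -> NoDup (list_prod l l').
Proof.
  intros H H'. induction H as [|x l Hx Hl IH]; [constructor|]. simpl. apply NoDup_app.
  - apply NoDup_map_inj; [exact H'|]. intros a b _ _ E. now injection E.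
  - exact IH.
  - intros [a b] Ha Hb. apply in_map_iff in Ha. destruct Ha as (y & E & _). injection E as <- _.
    apply in_prod_iff in Hb. now apply Hx.
Qed.

Definition sqsum (K : list nat) (f : nat -> R) : R := lsum K (fun n => f n * f n).

Lemma sqsum_nonneg K f : 0 <= sqsum K f.
Proof. apply lsum_nonneg; intros. apply Rle_0_sqr. Qed.

(* Split [K] into fibres over the P-smooth part [b] of its elements. The weights
   are multiplicative, so averaging the fibres against [wt e b ^ 2] produces one
   fibre that keeps both the l2 ratio and the l1 bound, up to [S1 * S2]. *)
Lemma fibre_selection (s e tau S1 S2 : R) (P K : list nat) :
  (forall p, In p P -> nprime p) -> NoDup K -> (forall n, In n K -> (1 <= n)%nat) -> factor_closed K -> In 1%nat K ->
  0 < S1 -> 0 < S2 ->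
  (forall n, In n K -> psmooth P n -> lsum (divisors n) (wt (s - tau)) <= S1) ->
  lsum (filter (fun n => pbool (psmooth P n)) K) (wt (s + tau)) <= S2 ->
  exists A, NoDup A /\ incl A K /\ factor_closed A /\ In 1%nat A /\ (forall a, In a A -> pfree P a) /\
    sqsum K (conv s e) * sqsum A (wt e) <= 4 * (S1 * S2) * sqsum K (wt e) * sqsum A (conv s e) /\
    sqsum K (conv s e) * (lsum A (wt e) * lsum A (wt e)) <= 4 * (S1 * S2) * (lsum K (wt e) * lsum K (wt e)) * sqsum A (conv s e).
Proof.
  intros HP HN Hpos HF H1 HS1 HS2 HB1 HB2. set (S := S1 * S2).
  assert (HS : 0 < S) by (unfold S; nra).
  (* [Bs] and [Af] hold the smooth and the free parts. The unique factorisation [n = b * a]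
     identifies [K] with the pairs selected by [ind], and [filter (ind b) Af] is the fibre over
     [b]. *)
  set (Bs := filter (fun n => pbool (psmooth P n)) K). set (Af := filter (fun n => pbool (pfree P n)) K).
  set (ind := fun b a => pbool (In (b * a)%nat K)).
  assert (HBs : forall b, In b Bs -> In b K /\ psmooth P b) by (intro b; apply in_filter_pbool).
  assert (HAf : forall a, In a Af -> In a K /\ pfree P a) by (intro a; apply in_filter_pbool).
  assert (NBs : NoDup Bs) by now apply NoDup_filter. assert (NAf : NoDup Af) by now apply NoDup_filter.
  set (pairs := filter (fun y => ind (fst y) (snd y)) (list_prod Bs Af)).
  assert (Npairs : NoDup pairs) by (apply NoDup_filter, NoDup_list_prod; assumption).
  assert (Hpairs : forall y, In y pairs <-> In (fst y) Bs /\ In (snd y) Af /\ In (fst y * snd y)%nat K).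
  { intros [b a]. unfold pairs, ind. rewrite filter_In, pbool_true, in_prod_iff. simpl. tauto. }
  assert (Inj : forall x y, In x pairs -> In y pairs -> (fst x * snd x = fst y * snd y)%nat -> x = y).
  { intros [b a] [b' a'] Hx Hy E. apply Hpairs in Hx, Hy. simpl in *. destruct Hx as (X1 & X2 & _), Hy as (Y1 & Y2 & _).
    destruct (HBs b X1), (HAf a X2), (HBs b' Y1), (HAf a' Y2).
    destruct (smooth_free_unique P b a b' a' HP) as [-> ->]; auto. }
  assert (PSum : forall f : nat -> nat -> R, lsum pairs (fun y => f (fst y) (snd y)) = lsum Bs (fun b => lsum (filter (ind b) Af) (f b))).
  { intro f. unfold pairs. rewrite lsum_filter, lsum_list_prod. apply lsum_ext; intros b _. rewrite lsum_filter. reflexivity. }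
  set (V := sqsum K (conv s e)).
  set (Nb := fun b => sqsum (filter (ind b) Af) (conv s e)). set (Nc := fun b => sqsum (filter (ind b) Af) (wt e)).
  set (L := fun b => lsum (filter (ind b) Af) (wt e)).
  (* Submultiplicativity separates [a] and [b]. For fixed [a] the admissible [b] form a
     factor-closed set of smooth numbers, on which [conv_l2_bound] replaces [conv] by [wt] at the
     cost [S]. *)
  assert (U1 : V <= S * lsum Bs (fun b => wt e b * wt e b * Nb b)).
  { apply Rle_trans with (lsum pairs (fun y => conv s e (fst y) * conv s e (fst y) * (conv s e (snd y) * conv s e (snd y)))).
    - apply Rle_trans with (lsum pairs (fun y => conv s e (fst y * snd y) * conv s e (fst y * snd y))).
      + apply (lsum_le_surj (fun y : nat * nat => (fst y * snd y)%nat) K pairs (fun n => conv s e n * conv s e n)); [exact HN| |intros; apply Rle_0_sqr].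
        intros n Hn. destruct (smooth_free_split P n HP (Hpos n Hn)) as (b & a & E & Hb & Ha).
        exists (b, a). split; [|simpl; lia]. apply Hpairs. simpl. rewrite <- E. split; [|split; [|exact Hn]].
        * apply in_filter_pbool. split; [|exact Hb]. apply (HF b n); [|exact Hn]. exists a. lia.
        * apply in_filter_pbool. split; [|exact Ha]. apply (HF a n); [|exact Hn]. exists b. lia.
      + apply lsum_le. intros y Hy. apply Hpairs in Hy. destruct Hy as (Y1 & Y2 & _).
        assert (K1 := conv_submult s e (fst y) (snd y) (Hpos _ (proj1 (HBs _ Y1))) (Hpos _ (proj1 (HAf _ Y2)))).
        pose proof (conv_nonneg s e (fst y * snd y)). 
        replace (conv s e (fst y) * conv s e (fst y) * (conv s e (snd y) * conv s e (snd y))) with ((conv s e (fst y) * conv s e (snd y)) * (conv s e (fst y) * conv s e (snd y))) by ring.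
        apply Rmult_le_compat; assumption.
    - unfold pairs. rewrite lsum_filter, lsum_list_prod, lsum_swap. cbn [fst snd].
      assert (SW : lsum Bs (fun b => wt e b * wt e b * Nb b) = lsum Af (fun a => conv s e a * conv s e a * sqsum (filter (fun b => ind b a) Bs) (wt e))).
      { transitivity (lsum Bs (fun b => lsum Af (fun a => if ind b a then wt e b * wt e b * (conv s e a * conv s e a) else 0))).
        - apply lsum_ext; intros b _. unfold Nb, sqsum. rewrite lsum_filter, <- lsum_scal. apply lsum_ext; intros a _. destruct (ind b a); ring.
        - rewrite lsum_swap. apply lsum_ext; intros a _. unfold sqsum. rewrite lsum_filter, <- lsum_scal. apply lsum_ext; intros b _. destruct (ind b a); ring. }
      rewrite SW, <- lsum_scal. apply lsum_le. intros a Ha. destruct (HAf a Ha) as [Ha1 Ha2].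
      set (B := filter (fun b => ind b a) Bs).
      assert (HB : forall b, In b B -> In b K /\ psmooth P b /\ In (b * a)%nat K).
      { intros b Hb. apply filter_In in Hb. destruct Hb as [Hb Hb']. unfold ind in Hb'. apply (proj1 (pbool_true _)) in Hb'.
        destruct (HBs b Hb). auto. }
      assert (K1 : sqsum B (conv s e) <= S * sqsum B (wt e)).
      { apply (conv_l2_bound s e tau).
        - now apply NoDup_filter.
        - intros n Hn. apply Hpos, HB, Hn.
        - intros d b Hd Hb. destruct (HB b Hb) as (X1 & X2 & X3). apply filter_In. split; [apply in_filter_pbool; split|].
          + exact (HF d b Hd X1).
          + eapply psmooth_divide; eassumption.
          + unfold ind. apply (proj2 (pbool_true _)). apply (HF (d * a)%nat (b * a)%nat); [|exact X3]. now apply Nat.mul_divide_mono_r.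
        - intros n Hn. destruct (HB n Hn) as (X1 & X2 & _). auto.
        - eapply Rle_trans; [|exact HB2]. apply lsum_incl; [now apply NoDup_filter| |intros; left; apply wt_pos].
          intros b Hb. apply filter_In in Hb. apply Hb. }
      replace (S * (conv s e a * conv s e a * sqsum B (wt e))) with (conv s e a * conv s e a * (S * sqsum B (wt e))) by ring.
      eapply Rle_trans; [|apply Rmult_le_compat_l; [apply Rle_0_sqr|exact K1]].
      right. unfold sqsum, B. rewrite lsum_filter, <- lsum_scal. apply lsum_ext; intros b _. destruct (ind b a); ring. }
  assert (U2 : lsum Bs (fun b => wt e b * wt e b * Nc b) <= sqsum K (wt e)).
  { apply Rle_trans with (lsum pairs (fun y => wt e (fst y * snd y) * wt e (fst y * snd y))).
    - right. rewrite (lsum_ext pairs _ (fun y => (fun b a => wt e b * wt e b * (wt e a * wt e a)) (fst y) (snd y))).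
      + rewrite (PSum (fun b a => wt e b * wt e b * (wt e a * wt e a))). apply lsum_ext; intros b _. unfold Nc, sqsum. symmetry. apply lsum_scal.
      + intros y Hy. apply Hpairs in Hy. destruct Hy as (Y1 & Y2 & _).
        rewrite wt_mult by (apply Hpos; first [apply (HBs _ Y1)|apply (HAf _ Y2)]). ring.
    - apply (lsum_le_inj (fun y : nat * nat => (fst y * snd y)%nat) K pairs (fun n => wt e n * wt e n)); [exact Npairs|exact Inj| |intros; apply Rle_0_sqr].
      intros y Hy. apply Hpairs, Hy. }
  assert (U3 : lsum Bs (fun b => wt e b * L b) <= lsum K (wt e)).
  { apply Rle_trans with (lsum pairs (fun y => wt e (fst y * snd y))).
    - right. rewrite (lsum_ext pairs _ (fun y => (fun b a => wt e b * wt e a) (fst y) (snd y))).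
      + rewrite (PSum (fun b a => wt e b * wt e a)). apply lsum_ext; intros b _. unfold L. symmetry. apply lsum_scal.
      + intros y Hy. apply Hpairs in Hy. destruct Hy as (Y1 & Y2 & _).
        rewrite wt_mult by (apply Hpos; first [apply (HBs _ Y1)|apply (HAf _ Y2)]). ring.
    - apply (lsum_le_inj (fun y : nat * nat => (fst y * snd y)%nat) K pairs (wt e)); [exact Npairs|exact Inj| |intros; left; apply wt_pos].
      intros y Hy. apply Hpairs, Hy. }
  assert (HL0 : forall b, 0 <= L b) by (intro; apply lsum_nonneg; intros; left; apply wt_pos).
  set (W := sqsum K (wt e)) in *. set (L1 := lsum K (wt e)) in *.
  assert (U4 : lsum Bs (fun b => wt e b * wt e b * (L b * L b)) <= L1 * L1).
  { assert (G : forall l : list nat, lsum l (fun b => wt e b * wt e b * (L b * L b)) <= lsum l (fun b => wt e b * L b) * lsum l (fun b => wt e b * L b)).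
    { induction l as [|b l IH]; [unfold lsum; simpl; lra|]. rewrite !lsum_cons.
      assert (0 <= lsum l (fun b => wt e b * L b)) by (apply lsum_nonneg; intros; apply Rmult_le_pos; [left; apply wt_pos|apply HL0]).
      assert (0 <= wt e b * L b) by (apply Rmult_le_pos; [left; apply wt_pos|apply HL0]). nra. }
    eapply Rle_trans; [apply G|].
    assert (0 <= lsum Bs (fun b => wt e b * L b)) by (apply lsum_nonneg; intros; apply Rmult_le_pos; [left; apply wt_pos|apply HL0]).
    apply Rmult_le_compat; assumption. }
  assert (HW : 0 < W).
  { unfold W, sqsum. eapply Rlt_le_trans; [|apply (lsum_single_le K (fun n => wt e n * wt e n) 1%nat H1); intros; apply Rle_0_sqr]. rewrite wt_1. lra. }
  assert (HL1 : 0 < L1).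
  { unfold L1. eapply Rlt_le_trans; [|apply (lsum_single_le K (wt e) 1%nat H1); intros; left; apply wt_pos]. rewrite wt_1. lra. }
  assert (HV : 0 < V).
  { unfold V, sqsum. eapply Rlt_le_trans; [|apply (lsum_single_le K (fun n => conv s e n * conv s e n) 1%nat H1); intros; apply Rle_0_sqr].
    pose proof (conv_ge_wt s e 1 (le_n 1)) as X. rewrite wt_1 in X. nra. }
  (* If every fibre violated one of the two inequalities, summation with the weights [wt e b ^ 2]
     would give [V <= V / 2]: the factor 4 leaves a quarter of [V] to each alternative. *)
  assert (Ex : exists b, In b Bs /\ V * Nc b <= 4 * S * W * Nb b /\ V * (L b * L b) <= 4 * S * (L1 * L1) * Nb b).
  { apply NNPP. intro Hno.
    assert (Hb : forall b, In b Bs -> Nb b <= V / (4 * S * W) * Nc b + V / (4 * S * (L1 * L1)) * (L b * L b)).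
    { intros b Hb. assert (Q1 : 0 < 4 * S * W) by nra. assert (Q2 : 0 < 4 * S * (L1 * L1)) by (assert (0 < L1 * L1) by nra; nra).
      assert (A1 : 0 <= V / (4 * S * W) * Nc b).
      { apply Rmult_le_pos; [left; now apply Rdiv_lt_0_compat|apply sqsum_nonneg]. }
      assert (A2 : 0 <= V / (4 * S * (L1 * L1)) * (L b * L b)).
      { apply Rmult_le_pos; [left; now apply Rdiv_lt_0_compat|apply Rle_0_sqr]. }
      destruct (Rle_or_lt (V * Nc b) (4 * S * W * Nb b)) as [G1|G1].
      - destruct (Rle_or_lt (V * (L b * L b)) (4 * S * (L1 * L1) * Nb b)) as [G2|G2].
        + exfalso. apply Hno. exists b. auto.
        + enough (Nb b <= V / (4 * S * (L1 * L1)) * (L b * L b)) by lra.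
          apply (Rmult_le_reg_l (4 * S * (L1 * L1))); [exact Q2|].
          replace (4 * S * (L1 * L1) * (V / (4 * S * (L1 * L1)) * (L b * L b))) with (V * (L b * L b)) by (field; lra). lra.
      - enough (Nb b <= V / (4 * S * W) * Nc b) by lra.
        apply (Rmult_le_reg_l (4 * S * W)); [exact Q1|].
        replace (4 * S * W * (V / (4 * S * W) * Nc b)) with (V * Nc b) by (field; lra). lra. }
    assert (Hsum : lsum Bs (fun b => wt e b * wt e b * Nb b) <= V / (4 * S * W) * W + V / (4 * S * (L1 * L1)) * (L1 * L1)).
    { apply Rle_trans with (V / (4 * S * W) * lsum Bs (fun b => wt e b * wt e b * Nc b) + V / (4 * S * (L1 * L1)) * lsum Bs (fun b => wt e b * wt e b * (L b * L b))).
      - rewrite <- !lsum_scal, <- lsum_plus. apply lsum_le; intros b Hbb.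
        replace (V / (4 * S * W) * (wt e b * wt e b * Nc b) + V / (4 * S * (L1 * L1)) * (wt e b * wt e b * (L b * L b)))
          with (wt e b * wt e b * (V / (4 * S * W) * Nc b + V / (4 * S * (L1 * L1)) * (L b * L b))) by ring.
        apply Rmult_le_compat_l; [apply Rle_0_sqr|]. auto.
      - apply Rplus_le_compat; (apply Rmult_le_compat_l; [left; apply Rdiv_lt_0_compat; [exact HV|assert (0 < L1 * L1) by nra; nra]|assumption]). }
    replace (V / (4 * S * W) * W + V / (4 * S * (L1 * L1)) * (L1 * L1)) with (V / S / 2) in Hsum by (field; repeat split; lra).
    assert (V <= S * (V / S / 2)) by (eapply Rle_trans; [exact U1|apply Rmult_le_compat_l; lra]).
    replace (S * (V / S / 2)) with (V / 2) in H by (field; lra). lra. }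
  destruct Ex as (b & Hb & E1 & E2). destruct (HBs b Hb) as [HbK HbP].
  exists (filter (ind b) Af). split; [now apply NoDup_filter|].
  assert (HA : forall a, In a (filter (ind b) Af) <-> In a K /\ pfree P a /\ In (b * a)%nat K).
  { intro a. rewrite filter_In. unfold ind, Af. rewrite pbool_true, in_filter_pbool. tauto. }
  split; [intros a Ha; apply HA, Ha|]. split; [|split; [|split; [intros a Ha; apply HA, Ha|split; assumption]]].
  - intros d a Hd Ha. apply HA in Ha. destruct Ha as (X1 & X2 & X3). apply HA. split; [exact (HF d a Hd X1)|]. split.
    + intros p Hp Hpd. apply (X2 p Hp). eapply Nat.divide_trans; eassumption.
    + apply (HF (b * d)%nat (b * a)%nat); [|exact X3]. now apply Nat.mul_divide_mono_l.
  - apply HA. split; [exact H1|]. split.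
    + intros p Hp Hd. apply Nat.divide_1_r in Hd. destruct (HP p Hp). lia.
    + rewrite Nat.mul_1_r. exact HbK.
Qed.

Definition mixed_coef (s e Nb Nc : R) (n : nat) : R := Nb * wt e n + Nc * conv s e n.

(** Substitute [a = n / d]. Closure under divisors puts all these [a] into [A], so the diagonal
    terms of the resonance recover the complete convolution. *)
Lemma conv_le_kernel s e A n : NoDup A -> factor_closed A -> In n A -> (1 <= n)%nat ->
  conv s e n <= lsum A (fun a => div_kernel s a n * wt e a).
Proof.
  intros HN HF Hn Hn1. unfold conv.
  rewrite (lsum_ext (divisors n) _ (fun d => (fun a => div_kernel s a n * wt e a) (n / d)%nat)).
  - apply (lsum_le_inj (fun d => n / d)%nat A (divisors n) (fun a => div_kernel s a n * wt e a)); [apply divisors_NoDup| | |].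
    + intros x y Hx Hy E. apply in_divisors in Hx, Hy; try assumption.
      destruct (divide_mul_div x n Hn1 Hx) as (E1 & E2 & _). destruct (divide_mul_div y n Hn1 Hy) as (E3 & E4 & _).
      rewrite E in E1. nia.
    + intros d Hd. apply in_divisors in Hd; [|assumption]. destruct (divide_mul_div d n Hn1 Hd) as (_ & _ & E). exact (HF _ n E Hn).
    + intros a _. apply Rmult_le_pos; [|left; apply wt_pos]. unfold div_kernel. destruct (_ =? _)%nat; [left; apply Rpower_pos|lra].
  - intros d Hd. apply in_divisors in Hd; [|assumption]. destruct (divide_mul_div d n Hn1 Hd) as (E1 & E2 & E3).
    f_equal. unfold div_kernel. replace (n mod (n / d) =? 0)%nat with true.
    2:{ symmetry. apply Nat.eqb_eq, Nat.Lcm0.mod_divide. exact E3. }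
    replace (n / (n / d))%nat with d; [reflexivity|]. symmetry. rewrite E1 at 1. apply Nat.div_mul. lia.
Qed.

Lemma div_kernel_nonneg s a b : 0 <= div_kernel s a b.
Proof. unfold div_kernel. destruct (_ =? _)%nat; [left; apply Rpower_pos|lra]. Qed.

(* With [c = wt e] and [b = conv s e], the resonator [|b| c + |c| b] makes the
   first moment of zeta produce [|b| / |c|], so that no second moment is needed. *)
Lemma mixed_resonator (s e : R) (A : list nat) :
  NoDup A -> factor_closed A -> (forall n, In n A -> (1 <= n)%nat) ->
  let Nb := sqrt (sqsum A (conv s e)) in let Nc := sqrt (sqsum A (wt e)) in
  let Y := map (fun n => (n, mixed_coef s e Nb Nc n)) A in
  Nc * Nb * (Nb * Nb) <= res_form s Y /\ res_norm Y <= 4 * ((Nb * Nb) * (Nc * Nc)) /\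
  res_sum Y = Nb * lsum A (wt e) + Nc * lsum A (conv s e).
Proof.
  intros HN HF Hpos Nb Nc Y.
  assert (HNb : Nb * Nb = sqsum A (conv s e)) by apply sqrt_sqrt, sqsum_nonneg.
  assert (HNc : Nc * Nc = sqsum A (wt e)) by apply sqrt_sqrt, sqsum_nonneg.
  assert (Nb0 : 0 <= Nb) by apply sqrt_pos. assert (Nc0 : 0 <= Nc) by apply sqrt_pos.
  split; [|split].
  - unfold res_form, Y. rewrite lsum_map, (lsum_ext A _ (fun a => lsum A (fun n => mixed_coef s e Nb Nc a * mixed_coef s e Nb Nc n * div_kernel s a n))).
    2:{ intros a _. rewrite lsum_map. reflexivity. }
    rewrite lsum_swap. rewrite HNb. unfold sqsum. rewrite <- lsum_scal. apply lsum_le. intros n Hn.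
    (* Of the four products in the expansion of the two mixed coefficients, the one kept is
       [(Nb c_a) (Nc b_n)]. *)
    apply Rle_trans with (Nc * conv s e n * Nb * lsum A (fun a => div_kernel s a n * wt e a)).
    + pose proof (conv_le_kernel s e A n HN HF Hn (Hpos n Hn)) as G. pose proof (conv_nonneg s e n).
      replace (Nc * Nb * (conv s e n * conv s e n)) with (Nc * conv s e n * Nb * conv s e n) by ring.
      apply Rmult_le_compat_l; [repeat apply Rmult_le_pos; assumption|exact G].
    + rewrite <- lsum_scal. apply lsum_le. intros a Ha. pose proof (div_kernel_nonneg s a n) as D.
      replace (Nc * conv s e n * Nb * (div_kernel s a n * wt e a)) with ((Nb * wt e a) * (Nc * conv s e n) * div_kernel s a n) by ring.
      apply Rmult_le_compat_r; [exact D|]. unfold mixed_coef.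
      pose proof (wt_pos e a). pose proof (wt_pos e n). pose proof (conv_nonneg s e n). pose proof (conv_nonneg s e a).
      apply Rmult_le_compat; try (apply Rmult_le_pos; lra).
      * assert (0 <= Nc * conv s e a) by (apply Rmult_le_pos; lra). lra.
      * assert (0 <= Nb * wt e n) by (apply Rmult_le_pos; lra). lra.
  - unfold res_norm, Y. rewrite lsum_map. cbn [snd].
    apply Rle_trans with (lsum A (fun n => 2 * (Nb * Nb) * (wt e n * wt e n) + 2 * (Nc * Nc) * (conv s e n * conv s e n))).
    + apply lsum_le; intros n _. unfold mixed_coef. pose proof (Rle_0_sqr (Nb * wt e n - Nc * conv s e n)) as X. unfold Rsqr in X. lra.
    + rewrite lsum_plus, !lsum_scal. fold (sqsum A (wt e)). fold (sqsum A (conv s e)). rewrite <- HNb, <- HNc. lra.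
  - unfold res_sum, Y. rewrite lsum_map. cbn [snd]. unfold mixed_coef. rewrite lsum_plus, !lsum_scal. reflexivity.
Qed.

(** The resonator multiplied by [1 + p^(it)]. *)
Definition double (p : nat) (Y : list (nat * R)) : list (nat * R) := Y ++ map (fun q => ((p * fst q)%nat, snd q)) Y.

Lemma double_norm p Y : res_norm (double p Y) = 2 * res_norm Y.
Proof. unfold res_norm, double. rewrite lsum_app, lsum_map. cbn [snd]. ring. Qed.

Lemma double_sum p Y : res_sum (double p Y) = 2 * res_sum Y.
Proof. unfold res_sum, double. rewrite lsum_app, lsum_map. cbn [snd]. change (lsum Y (fun x : nat * R => snd x)) with (lsum Y snd). ring. Qed.

Lemma div_kernel_mul_both s p a b : (1 <= p)%nat -> (1 <= a)%nat -> div_kernel s (p * a) (p * b) = div_kernel s a b.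
Proof.
  intros Hp Ha. unfold div_kernel. rewrite Nat.Div0.mul_mod_distr_l, Nat.Div0.div_mul_cancel_l by lia.
  replace (p * (b mod a) =? 0)%nat with (b mod a =? 0)%nat; [reflexivity|].
  destruct (b mod a =? 0)%nat eqn:E.
  - apply Nat.eqb_eq in E. rewrite E, Nat.mul_0_r. reflexivity.
  - apply Nat.eqb_neq in E. symmetry. apply Nat.eqb_neq. nia.
Qed.

Lemma div_kernel_mul_right s p a b : (1 <= p)%nat -> (1 <= a)%nat -> (1 <= b)%nat -> wt s p * div_kernel s a b <= div_kernel s a (p * b).
Proof.
  intros Hp Ha Hb. unfold div_kernel at 1. destruct (b mod a =? 0)%nat eqn:E.
  - apply Nat.eqb_eq, Nat.Lcm0.mod_divide in E. unfold div_kernel. destruct (divide_mul_div a b Hb E) as (E1 & E2 & _).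
    replace ((p * b) mod a =? 0)%nat with true.
    2:{ symmetry. apply Nat.eqb_eq, Nat.Lcm0.mod_divide. now apply Nat.divide_mul_r. }
    rewrite Nat.Lcm0.divide_div_mul_exact by assumption. rewrite Rpower_INR_mult by assumption. right. reflexivity.
  - rewrite Rmult_0_r. apply div_kernel_nonneg.
Qed.

(** Of the four blocks, the two diagonal ones reproduce the form of [Y], multiplying the second
    index by [p] adds at least [wt s p] times it, and the fourth is nonnegative. Relative to the
    norm, which doubles, the gain is [1 + wt s p / 2]. *)
Lemma double_form s p Y : (1 <= p)%nat -> (forall q, In q Y -> (1 <= fst q)%nat /\ 0 <= snd q) ->
  2 * (1 + wt s p / 2) * res_form s Y <= res_form s (double p Y).
Proof.
  intros Hp HY. set (Z := map (fun q => ((p * fst q)%nat, snd q)) Y).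
  set (F := fun q r : nat * R => snd q * snd r * div_kernel s (fst q) (fst r)).
  assert (E : res_form s (double p Y) = lsum Y (fun q => lsum Y (F q)) + lsum Y (fun q => lsum Z (F q)) + (lsum Z (fun q => lsum Y (F q)) + lsum Z (fun q => lsum Z (F q)))).
  { unfold res_form, double. fold Z. rewrite lsum_app, <- !lsum_plus. f_equal; apply lsum_ext; intros; apply lsum_app. }
  assert (E1 : wt s p * res_form s Y <= lsum Y (fun q => lsum Z (F q))).
  { unfold res_form. rewrite <- lsum_scal. apply lsum_le; intros q Hq. unfold Z. rewrite lsum_map, <- lsum_scal. apply lsum_le; intros r Hr.
    unfold F. cbn [fst snd]. destruct (HY q Hq), (HY r Hr).
    replace (wt s p * (snd q * snd r * div_kernel s (fst q) (fst r))) with (snd q * snd r * (wt s p * div_kernel s (fst q) (fst r))) by ring.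
    apply Rmult_le_compat_l; [apply Rmult_le_pos; assumption|]. apply div_kernel_mul_right; assumption. }
  assert (E2 : 0 <= lsum Z (fun q => lsum Y (F q))).
  { unfold Z. rewrite lsum_map. apply lsum_nonneg; intros q Hq. apply lsum_nonneg; intros r Hr. unfold F. cbn [fst snd].
    apply Rmult_le_pos; [apply Rmult_le_pos; [apply (HY q Hq)|apply (HY r Hr)]|apply div_kernel_nonneg]. }
  assert (E3 : lsum Z (fun q => lsum Z (F q)) = res_form s Y).
  { unfold Z. rewrite lsum_map. apply lsum_ext; intros q Hq. rewrite lsum_map. apply lsum_ext; intros r Hr. unfold F. cbn [fst snd].
    f_equal. apply div_kernel_mul_both; [exact Hp|apply (HY q Hq)]. }
  rewrite E, E3. change (lsum Y (fun q => lsum Y (F q))) with (res_form s Y). lra.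
Qed.

(** The last clause is the induction invariant: primes not yet used still divide no index, so the
    copy shifted by the next prime is disjoint from the list it is appended to. *)
Lemma double_many (s : R) (P : list nat) : NoDup P -> (forall p, In p P -> nprime p) ->
  forall (Y : list (nat * R)) (N M : R), 0 <= N -> 0 <= M -> (forall p, In p P -> INR p <= M) -> 1 <= M ->
  NoDup (map fst Y) -> (forall q, In q Y -> (1 <= fst q)%nat /\ INR (fst q) <= N /\ 0 <= snd q) ->
  (forall q, In q Y -> pfree P (fst q)) ->
  exists Y', NoDup (map fst Y') /\
    (forall q, In q Y' -> (1 <= fst q)%nat /\ INR (fst q) <= N * M ^ length P /\ 0 <= snd q) /\
    res_norm Y' = 2 ^ length P * res_norm Y /\ res_sum Y' = 2 ^ length P * res_sum Y /\
    2 ^ length P * lprod P (fun p => 1 + wt s p / 2) * res_form s Y <= res_form s Y' /\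
    (forall r, nprime r -> ~ In r P -> (forall q, In q Y -> ~ Nat.divide r (fst q)) -> forall q, In q Y' -> ~ Nat.divide r (fst q)).
Proof.
  intros HN HP. induction HN as [|p P Hp HN IH]; intros Y N M N0 M0 HM HM1 ND HY Hfree.
  - exists Y. simpl. unfold lprod. simpl. split; [exact ND|]. split; [intros q Hq; rewrite Rmult_1_r; auto|].
    repeat split; try ring; try lra. intros; auto.
  - assert (Pp : nprime p) by (apply HP; now left).
    destruct (IH ltac:(intros; apply HP; now right) Y N M N0 M0 ltac:(intros; apply HM; now right) HM1 ND HY
      ltac:(intros q Hq r Hr; apply (Hfree q Hq r); now right)) as (Y1 & ND1 & HY1 & E1 & E2 & E3 & E4).
    assert (Hpf : forall q, In q Y1 -> ~ Nat.divide p (fst q)).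
    { apply E4; [exact Pp|exact Hp|]. intros q Hq. apply (Hfree q Hq p). now left. }
    destruct Pp as [Pp2 Pp'].
    exists (double p Y1). split; [|split; [|split; [|split; [|split]]]].
    + unfold double. rewrite map_app, map_map. cbn [fst]. apply NoDup_app.
      * exact ND1.
      * rewrite <- (map_map fst (fun x => p * x)%nat). apply NoDup_map_inj; [exact ND1|]. intros x y _ _ E. nia.
      * intros x Hx Hx'. apply in_map_iff in Hx, Hx'. destruct Hx as (q & <- & Hq). destruct Hx' as (r & E & Hr).
        apply (Hpf q Hq). rewrite <- E. apply Nat.divide_mul_l, Nat.divide_refl.
    + intros q Hq. unfold double in Hq. apply in_app_or in Hq. simpl length. simpl pow. destruct Hq as [Hq|Hq].
      * destruct (HY1 q Hq) as (X1 & X2 & X3). split; [exact X1|]. split; [|exact X3]. eapply Rle_trans; [exact X2|].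
        apply Rmult_le_compat_l; [exact N0|]. pose proof (pow_le M (length P) M0). nra.
      * apply in_map_iff in Hq. destruct Hq as (r & <- & Hr). destruct (HY1 r Hr) as (X1 & X2 & X3). cbn [fst snd].
        split; [nia|]. split; [|exact X3]. rewrite mult_INR.
        replace (N * (M * M ^ length P)) with (M * (N * M ^ length P)) by ring.
        apply Rmult_le_compat; [apply pos_INR|apply pos_INR|apply HM; now left|exact X2].
    + rewrite double_norm, E1. simpl. ring.
    + rewrite double_sum, E2. simpl. ring.
    + eapply Rle_trans; [|apply double_form; [lia|intros q Hq; destruct (HY1 q Hq) as (X1 & _ & X3); auto]].
      rewrite lprod_cons. simpl length. simpl pow.
      replace (2 * 2 ^ length P * ((1 + wt s p / 2) * lprod P (fun p0 => 1 + wt s p0 / 2)) * res_form s Y)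
        with (2 * (1 + wt s p / 2) * (2 ^ length P * lprod P (fun p0 => 1 + wt s p0 / 2) * res_form s Y)) by ring.
      apply Rmult_le_compat_l; [pose proof (wt_pos s p); lra|exact E3].
    + intros r Pr Hr HrY q Hq. unfold double in Hq. apply in_app_or in Hq. destruct Hq as [Hq|Hq].
      * apply (E4 r Pr); auto. intro; apply Hr; now right.
      * apply in_map_iff in Hq. destruct Hq as (t & <- & Ht). cbn [fst]. intro Hd. apply nprime_divide_mul in Hd; [|exact Pr].
        destruct Hd as [Hd|Hd].
        -- destruct (Pp' r Hd) as [->| ->]; [destruct Pr; lia|]. apply Hr. now left.
        -- revert Hd. apply (E4 r Pr); auto. intro; apply Hr; now right.
Qed.

(** * Primes in short ranges and divisor sums on the line one *)

Module CentralBinomial.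
Import all_boot.
Local Open Scope nat_scope.

Lemma sum_leq_bound t N : \sum_(1 <= k < N.+1) (k <= t) <= minn N t.
Proof.
elim: N => [|N IH]; first by rewrite big_geq.
rewrite big_nat_recr //=; apply: leq_trans (leq_add IH (leqnn _)) _.
case: (leqP N.+1 t) => h /=.
  by rewrite (minn_idPl (ltnW h)) addn1.
by rewrite addn0 geq_minr.
Qed.
(** Legendre's formula: the power [p^k] contributes [floor(2n / p^k) - 2 floor(n / p^k) <= 1], and
    nothing once [p^k > 2n], so the exponent is at most the logarithm of [2n] to base [p]. *)
Lemma logn_central_bin p n : prime p -> 0 < n -> p ^ logn p 'C(n.*2, n) <= n.*2.
Proof.
move=> pp n0.
have p1 := prime_gt1 pp.
have le_n : n <= n.*2 by rewrite -addnn leq_addr.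
have E : logn p (n.*2)`! = logn p 'C(n.*2, n) + (logn p n`!).*2.
  rewrite -(bin_fact le_n) lognM ?bin_gt0 ?muln_gt0 ?fact_gt0 //.
  have -> : n.*2 - n = n by rewrite -addnn addnK.
  by rewrite lognM ?fact_gt0 // addnn.
have H : logn p 'C(n.*2, n) <= trunc_log p n.*2.
  have -> : logn p 'C(n.*2, n) = logn p (n.*2)`! - (logn p n`!).*2 by rewrite E addnK.
  rewrite !logn_fact //.
  have W : (\sum_(1 <= k < n.+1) n %/ p ^ k) = \sum_(1 <= k < n.*2.+1) n %/ p ^ k.
    rewrite [RHS](big_cat_nat (n := n.+1)) //=. rewrite [X in _ = _ + X]big_nat_cond [X in _ = _ + X]big1 ?addn0 //.
    move=> k /andP[/andP[k1 k2] _]. apply: divn_small.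
    by apply: (leq_trans k1); apply: ltnW; apply: ltn_expl.
  have D : (\sum_(1 <= k < n.*2.+1) n %/ p ^ k).*2 = \sum_(1 <= k < n.*2.+1) 2 * (n %/ p ^ k).
    by rewrite -big_distrr /= mul2n.
  rewrite W D leq_subLR.
  have T : \sum_(1 <= k < n.*2.+1) (k <= trunc_log p n.*2) <= trunc_log p n.*2.
    exact: leq_trans (sum_leq_bound _ _) (geq_minr _ _).
  apply: (@leq_trans (\sum_(1 <= k < n.*2.+1) 2 * (n %/ p ^ k) + \sum_(1 <= k < n.*2.+1) (k <= trunc_log p n.*2))); last by rewrite leq_add2l.
  rewrite -big_split /=.
  apply: leq_sum => k _.
  have d0 : 0 < p ^ k by rewrite expn_gt0 prime_gt0.
  case: (leqP k (trunc_log p n.*2)) => hk.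
    rewrite addn1 -ltnS ltn_divLR // -addn2 -mulnSr -mulnA -muln2 mulnC ltn_pmul2l //.
    exact: ltn_ceil.
  rewrite addn0 divn_small //.
  rewrite ltnNge; apply/negP => /(trunc_log_max p1). by rewrite leqNgt hk.
apply: (leq_trans (leq_pexp2l (prime_gt0 pp) H)).
by apply: trunc_logP => //; rewrite double_gt0.
Qed.
Lemma central_bin_lower n : 2 ^ n <= 'C(n.*2, n).
Proof.
elim: n => [|n IH]; first by rewrite bin0.
rewrite doubleS expnS.
have E : 'C(n.*2.+1, n) = 'C(n.*2.+1, n.+1).
  rewrite -bin_sub; last by rewrite -addnn leqW // leq_addr.
  by congr 'C(_, _); rewrite -addnn -addSn addnK.
rewrite binS -E addnn -mul2n leq_mul2l /=.
apply: leq_trans IH _. rewrite E binS. exact: leq_addl.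
Qed.
Lemma central_bin_upper n : 0 < n -> 'C(n.*2, n) <= n.*2 ^ size (primes 'C(n.*2, n)).
Proof.
move=> n0. set c := 'C(_, _).
have c0 : 0 < c by rewrite bin_gt0 -addnn leq_addr.
rewrite {1}(prod_prime_decomp c0) prime_decompE big_map /=.
have : all prime (primes c) by apply/allP => q; rewrite mem_primes => /andP[].
elim: (primes c) => [|q l IH] /=; first by rewrite big_nil.
move=> /andP[pq al]. rewrite big_cons expnS leq_mul ?IH //. exact: logn_central_bin.
Qed.

Lemma prime_nprime p : prime p -> nprime p.
Proof.
move=> pp; split; first by apply/leP; exact: prime_gt1.
move=> d [k E]; have /primeP[_ H] := pp.
have /H/orP[/eqP|/eqP] : d %| p by apply/dvdnP; exists k.
  by left.
by right.
Qed.

Lemma In_mem (l : seq nat) p : List.In p l -> p \in l.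
Proof.
elim: l => [//|q l IH] /= [->|h]; first by rewrite inE eqxx.
by rewrite inE IH ?orbT.
Qed.

Lemma uniq_NoDup (l : seq nat) : uniq l -> NoDup l.
Proof.
elim: l => [_|q l IH] /=; first by constructor.
move=> /andP[ql ul]; constructor; last exact: IH.
by move=> /In_mem; apply/negP.
Qed.

Lemma expn_pow a b : a ^ b = Nat.pow a b.
Proof. by elim: b => [//|b IH]; rewrite expnS IH. Qed.

Lemma size_length (l : seq nat) : size l = length l.
Proof. by elim: l => [//|q l IH] /=; rewrite IH. Qed.

(** Chebyshev's argument: [2^n] is at most the central binomial coefficient, a product of prime
    powers each at most [2n]. Stated with the operations of the standard library, for use outside
    this module. *)
Lemma many_primes (n : nat) : 0 < n -> exists P : list nat, NoDup P /\
  (forall p, List.In p P -> nprime p /\ Peano.le p (Nat.mul 2 n)) /\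
  Peano.le (Nat.pow 2 n) (Nat.pow (Nat.mul 2 n) (length P)).
Proof.
move=> n0; exists (primes 'C(n.*2, n)); split; first exact/uniq_NoDup/primes_uniq.
have E2 : Nat.mul 2 n = n.*2 by rewrite -mul2n.
have c0 : 0 < 'C(n.*2, n) by rewrite bin_gt0 -addnn leq_addr.
split.
  move=> p /In_mem; rewrite mem_primes => /and3P[pp _ pd]; split; first exact: prime_nprime.
  rewrite E2; apply/leP; apply: leq_trans (logn_central_bin _ _ pp n0).
  rewrite -{1}(expn1 p); apply: leq_pexp2l; first exact: prime_gt0.
  by rewrite logn_gt0 mem_primes pp c0.
rewrite E2 -!expn_pow -size_length; apply/leP.
exact: leq_trans (central_bin_lower n) (central_bin_upper _ n0).
Qed.
End CentralBinomial.

Lemma NoDup_firstn {A} (l : list A) k : NoDup l -> NoDup (firstn k l).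
Proof.
  intro H. revert k. induction H as [|x l Hx Hl IH]; intros [|k]; simpl; try constructor; auto.
  intro Hin. apply Hx. rewrite <- (firstn_skipn k l). apply in_or_app. now left.
Qed.

Lemma length_filter_cover {A} (f g h : A -> bool) l :
  (forall x, In x l -> f x = true -> g x = true \/ h x = true) ->
  (length (filter f l) <= length (filter g l) + length (filter h l))%nat.
Proof.
  induction l as [|x l IH]; intro H; [simpl; lia|]. specialize (IH ltac:(intros; apply H; [now right|assumption])).
  specialize (H x (or_introl eq_refl)). simpl. destruct (f x); [|destruct (g x), (h x); simpl; lia].
  destruct (H eq_refl) as [->| ->]; [destruct (h x)|destruct (g x)]; simpl; lia.
Qed.

Lemma pow4_between m : (1 <= m)%nat -> exists k, (4 ^ k <= m < 4 ^ S k)%nat.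
Proof.
  intro Hm. induction m as [|m IH]; [lia|]. destruct (Nat.eq_dec m 0) as [->|Hne]; [exists 0%nat; simpl; lia|].
  destruct (IH ltac:(lia)) as [k Hk]. destruct (Nat.lt_ge_cases (S m) (4 ^ S k)) as [L|L].
  - exists k. lia.
  - exists (S k). change (4 ^ S (S k))%nat with (4 * 4 ^ S k)%nat. lia.
Qed.

(** 9 is where the exponential overtakes for good, hence the condition [4 ^ 9 <= m] in
    [prime_block]. *)
Lemma pow2_beats_quadratic k : (9 <= k)%nat -> ((3 * k + 3) * (k + 2) < 2 ^ k)%nat.
Proof.
  intro H. induction H as [|k Hk IH]; [simpl; lia|]. change (2 ^ S k)%nat with (2 * 2 ^ k)%nat. nia.
Qed.

(** Pigeonhole over the ranges [(m 2^i, m 2^(i+1)]] with [i <= k] and [4^k <= m]: fewer than [m]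
    primes in each would leave at most [(k + 2) m] primes up to [m 2^(k+1)], too few for
    [many_primes]. The bound [Q <= m^(3/2)] keeps [m Q^(-s)] above a positive power of [m] for
    [s < 2/3]. *)
Lemma prime_block (m : nat) : (4 ^ 9 <= m)%nat -> exists Q P, (m <= Q)%nat /\ (Q * Q <= m * (m * m))%nat /\
  NoDup P /\ length P = m /\ forall p, In p P -> nprime p /\ (Q < p <= 2 * Q)%nat.
Proof.
  intro Hm. destruct (pow4_between m) as [k Hk]. { eapply Nat.le_trans; [|exact Hm]. apply Nat.neq_0_lt_0, Nat.pow_nonzero. discriminate. }
  assert (Hk9 : (9 <= k)%nat).
  { apply Nat.nlt_ge. intro L. assert (4 ^ S k <= 4 ^ 9)%nat by (apply Nat.pow_le_mono_r; lia). apply (Nat.lt_irrefl m). eapply Nat.lt_le_trans; [apply Hk|]. eapply Nat.le_trans; eassumption. }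
  clear Hm.
  assert (Hm1 : (1 <= m)%nat) by (assert (4 ^ k <> 0)%nat by (apply Nat.pow_nonzero; lia); lia).
  apply NNPP. intro Hno.
  set (n := (m * 2 ^ k)%nat).
  assert (H2k : (1 <= 2 ^ k)%nat) by (assert (2 ^ k <> 0)%nat by (apply Nat.pow_nonzero; lia); lia).
  destruct (CentralBinomial.many_primes n) as (P & HN & HP & HC).
  { destruct n eqn:E; [unfold n in E; nia|reflexivity]. }
  assert (Hblock : forall i, (i <= k)%nat ->
     (length (filter (fun p => andb (m * 2 ^ i <? p) (p <=? m * 2 ^ S i))%nat P) < m)%nat).
  { intros i Hi. apply Nat.nle_gt. intro L. apply Hno.
    exists (m * 2 ^ i)%nat, (firstn m (filter (fun p => andb (m * 2 ^ i <? p) (p <=? m * 2 ^ S i))%nat P)).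
    assert (1 <= 2 ^ i)%nat by (assert (2 ^ i <> 0)%nat by (apply Nat.pow_nonzero; lia); lia).
    split; [nia|]. split; [|split; [|split]].
    - assert (2 ^ i * 2 ^ i <= m)%nat.
      { rewrite <- Nat.pow_mul_l. change (2 * 2)%nat with 4%nat. assert (4 ^ i <= 4 ^ k)%nat by (apply Nat.pow_le_mono_r; lia). lia. }
      replace (m * 2 ^ i * (m * 2 ^ i))%nat with (m * m * (2 ^ i * 2 ^ i))%nat by ring. nia.
    - apply NoDup_firstn, NoDup_filter, HN.
    - rewrite length_firstn. lia.
    - intros p Hp. assert (Hp' : In p (filter (fun p => andb (m * 2 ^ i <? p) (p <=? m * 2 ^ S i))%nat P)).
      { rewrite <- (firstn_skipn m). apply in_or_app. now left. }
      apply filter_In in Hp'. destruct Hp' as [Hp1 Hp2]. apply andb_prop in Hp2. destruct Hp2 as [B1 B2].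
      apply Nat.ltb_lt in B1. apply Nat.leb_le in B2. simpl in B2. split; [apply HP, Hp1|]. lia. }
  assert (Hcount : forall j, (j <= S k)%nat -> (length (filter (fun p => p <=? m * 2 ^ j)%nat P) <= (j + 1) * m)%nat).
  { induction j as [|j IH]; intro Hj.
    - simpl (2 ^ 0)%nat. rewrite Nat.mul_1_r. rewrite Nat.add_0_l, Nat.mul_1_l.
      apply Nat.le_trans with (length (seq 1 m)); [|rewrite length_seq; lia].
      apply NoDup_incl_length; [now apply NoDup_filter|]. intros p Hp. apply filter_In in Hp. destruct Hp as [Hp1 Hp2].
      apply Nat.leb_le in Hp2. destruct (HP p Hp1) as [[Hp3 _] _]. apply in_seq. lia.
    - specialize (IH ltac:(lia)). specialize (Hblock j ltac:(lia)).
      pose proof (length_filter_cover (fun p => p <=? m * 2 ^ S j)%nat (fun p => p <=? m * 2 ^ j)%nat (fun p => andb (m * 2 ^ j <? p) (p <=? m * 2 ^ S j))%nat P) as C.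
      assert ((S j + 1) * m = (j + 1) * m + m)%nat by ring.
      enough (length (filter (fun p => p <=? m * 2 ^ S j)%nat P) <= length (filter (fun p => p <=? m * 2 ^ j)%nat P) + length (filter (fun p => andb (m * 2 ^ j <? p) (p <=? m * 2 ^ S j))%nat P))%nat by lia.
      apply C. intros x _ Hx. destruct (x <=? m * 2 ^ j)%nat eqn:E; [now left|right]. apply Nat.leb_gt in E. apply Nat.ltb_lt in E. rewrite E. exact Hx. }
  specialize (Hcount (S k) (le_n _)).
  assert (HL : (length P <= (k + 2) * m)%nat).
  { replace (filter (fun p => p <=? m * 2 ^ S k)%nat P) with P in Hcount; [lia|].
    symmetry. apply forallb_filter_id. apply forallb_forall. intros p Hp. apply Nat.leb_le. destruct (HP p Hp) as [_ B].
    unfold n in B. simpl in *. lia. }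
  assert (H2n : (2 * n <= 2 ^ (3 * k + 3))%nat).
  { unfold n. replace (2 ^ (3 * k + 3))%nat with (2 * (4 ^ S k * 2 ^ k))%nat; [nia|].
    change 4%nat with (2 * 2)%nat. rewrite Nat.pow_mul_l, <- !Nat.pow_add_r, <- Nat.pow_succ_r'. f_equal. lia. }
  assert (E : (2 ^ n <= 2 ^ ((3 * k + 3) * ((k + 2) * m)))%nat).
  { eapply Nat.le_trans; [exact HC|]. rewrite Nat.pow_mul_r. eapply Nat.le_trans; [apply (Nat.pow_le_mono_r _ _ ((k + 2) * m)); [unfold n; nia|exact HL]|].
    apply Nat.pow_le_mono_l. exact H2n. }
  apply Nat.pow_le_mono_r_iff in E; [|lia].
  pose proof (pow2_beats_quadratic k Hk9). unfold n in E. nia.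
Qed.

(** * Sums over primes and the divisor sum on the line one *)

Lemma lsum_ln_product (l : list nat) : (forall p, In p l -> (1 <= p)%nat) ->
  (1 <= fold_right Nat.mul 1%nat l)%nat /\ lsum l (fun p => ln (INR p)) = ln (INR (fold_right Nat.mul 1%nat l)).
Proof.
  induction l as [|p l IH]; intro H; [split; [simpl; lia|simpl; rewrite ln_1; reflexivity]|].
  destruct IH as [I1 I2]; [intros; apply H; now right|]. specialize (H p (or_introl eq_refl)).
  simpl fold_right. split; [nia|]. rewrite lsum_cons, I2, mult_INR, ln_mult; [reflexivity| |]; apply lt_0_INR; lia.
Qed.

Definition primes_upto (n : nat) : list nat := filter (fun p => pbool (nprime p)) (seq 1 n).

Lemma in_primes_upto p n : In p (primes_upto n) <-> (1 <= p <= n)%nat /\ nprime p.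
Proof. unfold primes_upto. rewrite in_filter_pbool, in_seq. split; intros [H1 H2]; (split; [lia|exact H2]). Qed.

(* [ln n!] dominates the sum of [floor (n / p) * ln p], and [floor (n / p) >= n / (2 p)]. *)
Lemma sum_log_over_prime n : (1 <= n)%nat -> lsum (primes_upto n) (fun p => ln (INR p) / INR p) <= 2 * ln (INR n).
Proof.
  intro Hn. pose proof (INR_pos_ge1 n Hn) as Hn1.
  set (dv := fun p k => Nat.eqb (k mod p) 0).
  assert (A : lsum (seq 1 n) (fun k => lsum (primes_upto n) (fun p => if dv p k then ln (INR p) else 0)) <= INR n * ln (INR n)).
  { eapply Rle_trans; [apply (lsum_le _ _ (fun _ => ln (INR n)))|rewrite lsum_const, length_seq; lra].
    intros k Hk. apply in_seq in Hk. rewrite <- lsum_filter.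
    assert (Hl : forall p, In p (filter (fun p => dv p k) (primes_upto n)) -> nprime p /\ Nat.divide p k).
    { intros p Hp. apply filter_In in Hp. destruct Hp as [Hp1 Hp2]. apply in_primes_upto in Hp1.
      split; [apply Hp1|]. apply Nat.Lcm0.mod_divide, Nat.eqb_eq. exact Hp2. }
    destruct (lsum_ln_product (filter (fun p => dv p k) (primes_upto n))) as [L1 L2].
    { intros p Hp. destruct (Hl p Hp) as [[Hp2 _] _]. lia. }
    rewrite L2. apply ln_le_ln; [apply lt_0_INR; lia|]. apply le_INR. apply Nat.le_trans with k; [|lia].
    apply Nat.divide_pos_le; [lia|]. apply prime_list_product_le; [apply NoDup_filter, NoDup_filter, seq_NoDup|exact Hl|lia]. }
  rewrite lsum_swap in A.
  assert (B : INR n / 2 * lsum (primes_upto n) (fun p => ln (INR p) / INR p) <= INR n * ln (INR n)).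
  { eapply Rle_trans; [|exact A]. rewrite <- lsum_scal. apply lsum_le. intros p Hp. apply in_primes_upto in Hp. destruct Hp as [Hp [Hp2 _]].
    assert (Hlp : 0 <= ln (INR p)) by (apply ln_nonneg, INR_pos_ge1; lia).
    apply Rle_trans with (INR (n / p) * ln (INR p)).
    - replace (INR n / 2 * (ln (INR p) / INR p)) with (INR n / (2 * INR p) * ln (INR p)) by (field; apply not_0_INR; lia).
      apply Rmult_le_compat_r; [exact Hlp|].
      assert (1 <= n / p)%nat by (apply Nat.div_le_lower_bound; lia).
      assert (n < p * (n / p) + p)%nat by (pose proof (Nat.div_mod_eq n p); pose proof (Nat.mod_upper_bound n p ltac:(lia)); lia).
      assert (Hle : (n <= 2 * p * (n / p))%nat) by nia. apply le_INR in Hle. rewrite !mult_INR in Hle. change (INR 2) with 2 in Hle.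
      assert (0 < INR p) by (apply lt_0_INR; lia).
      apply (Rmult_le_reg_r (2 * INR p)); [lra|]. unfold Rdiv. rewrite Rmult_assoc, Rinv_l by lra. lra.
    - rewrite <- lsum_filter, lsum_const. apply Rmult_le_compat_r; [exact Hlp|]. apply le_INR.
      rewrite <- (length_seq (n / p) 1), <- (length_map (fun j => p * j)%nat). apply NoDup_incl_length.
      + apply NoDup_map_inj; [apply seq_NoDup|]. intros x y _ _ E. nia.
      + intros k Hk. apply in_map_iff in Hk. destruct Hk as (j & <- & Hj). apply in_seq in Hj. apply filter_In.
        assert (p * (n / p) <= n)%nat by (apply Nat.Div0.mul_div_le). split; [apply in_seq; nia|].
        unfold dv. apply Nat.eqb_eq, Nat.Lcm0.mod_divide. apply Nat.divide_mul_l, Nat.divide_refl. }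
  apply (Rmult_le_reg_l (INR n / 2)); [lra|]. lra.
Qed.

Lemma lsum_wt_bound (kap : R) (D : list nat) : 0 < kap -> NoDup D -> (forall d, In d D -> (1 <= d)%nat) ->
  lsum D (wt (1 + kap)) <= 1 + / kap.
Proof.
  intros Hk HN HD.
  apply Rle_trans with (lsum (seq 1 (S (list_max D))) (wt (1 + kap))).
  - apply lsum_incl; [exact HN| |intros; left; apply wt_pos]. intros d Hd. apply in_seq.
    pose proof (proj1 (list_max_le D (list_max D)) (le_n _)) as LM. rewrite Forall_forall in LM. specialize (LM d Hd). specialize (HD d Hd). lia.
  - pose proof (sum_Rpower_tail kap 1 Hk (le_n 1) (list_max D)) as H.
    change (INR 1) with 1 in H. rewrite !Rpower_1_l in H. unfold Rdiv in H. rewrite Rmult_1_l in H.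
    rewrite <- sum_n_m_lsum by lia. rewrite <- (sum_n_m_S (wt (1 + kap)) 0 (list_max D)). exact H.
Qed.

(** The expansion of the product. Control of the prime divisors of [D] keeps the two halves of the
    next step disjoint. *)
Lemma squarefree_products (a : R) (P : list nat) : NoDup P -> (forall p, In p P -> nprime p) ->
  exists D, NoDup D /\ (forall d, In d D -> (1 <= d)%nat /\ forall r, nprime r -> Nat.divide r d -> In r P) /\
    lsum D (wt a) = lprod P (fun p => 1 + wt a p).
Proof.
  intros HN HP. induction HN as [|p P Hp HN IH].
  - exists [1%nat]. split; [constructor; [easy|constructor]|]. split.
    + intros d [<-|[]]. split; [lia|]. intros r [Hr _] Hd. apply Nat.divide_1_r in Hd. lia.
    + unfold lsum, lprod; simpl. rewrite wt_1. ring.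
  - destruct IH as (D & ND & HD & E); [intros; apply HP; now right|]. assert (Pp : nprime p) by (apply HP; now left).
    exists (D ++ map (fun d => p * d)%nat D). split; [|split].
    + apply NoDup_app; [exact ND| |].
      * apply NoDup_map_inj; [exact ND|]. intros x y _ _ E'. destruct Pp. nia.
      * intros x Hx Hx'. apply in_map_iff in Hx'. destruct Hx' as (d & <- & Hd). apply Hp.
        apply (proj2 (HD _ Hx) p Pp). apply Nat.divide_mul_l, Nat.divide_refl.
    + intros d Hd. apply in_app_or in Hd. destruct Hd as [Hd|Hd].
      * destruct (HD d Hd) as [D1 D2]. split; [exact D1|]. intros. right. auto.
      * apply in_map_iff in Hd. destruct Hd as (c & <- & Hc). destruct (HD c Hc) as [D1 D2]. split; [destruct Pp; nia|].
        intros r Hr Hrd. apply nprime_divide_mul in Hrd; [|exact Hr]. destruct Hrd as [Hrd|Hrd]; [|right; auto].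
        left. destruct Pp as [_ Pp]. destruct (Pp r Hrd) as [->|E']; [destruct Hr; lia|now symmetry].
    + rewrite lsum_app, lsum_map, lprod_cons, <- E.
      rewrite (lsum_ext D (fun x => wt a (p * x)) (fun x => wt a p * wt a x)).
      * rewrite lsum_scal. ring.
      * intros x Hx. apply wt_mult; [destruct Pp; lia|apply HD, Hx].
Qed.

Lemma inv_one_minus_exp x : 0 <= x <= 3 / 4 -> / (1 - x) <= exp (x + 4 * (x * x)).
Proof.
  intro Hx. pose proof (exp_ineq1_le (x + 4 * (x * x))) as H.
  apply Rle_trans with (1 + (x + 4 * (x * x))); [|exact H].
  apply (Rmult_le_reg_l (1 - x)); [lra|]. rewrite Rinv_r by lra.
  replace ((1 - x) * (1 + (x + 4 * (x * x)))) with (1 + x * x * (3 - 4 * x)) by ring. nra.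
Qed.

Lemma exp_le_one_plus x : 0 <= x -> exp (x - x * x) <= 1 + x.
Proof.
  intro Hx. pose proof (exp_ineq1_le (- (x - x * x))) as H. rewrite exp_Ropp in H.
  pose proof (exp_pos (x - x * x)) as Hp.
  assert (0 < 1 + - (x - x * x)) by nra.
  assert (K : exp (x - x * x) <= / (1 + - (x - x * x))).
  { rewrite <- (Rinv_inv (exp (x - x * x))). apply Rinv_le_contravar; assumption. }
  eapply Rle_trans; [exact K|]. apply (Rmult_le_reg_l (1 + - (x - x * x))); [assumption|]. rewrite Rinv_r by lra.
  replace ((1 + - (x - x * x)) * (1 + x)) with (1 + x * x * x) by ring. nra.
Qed.

(** [prod (1 + p^(-a))] expands into a sum over squarefree numbers, at most [1 + / kap], and
    [exp (x - x * x) <= 1 + x] compares it with the exponential; the squares cost [exp 2]. *)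
Lemma sum_prime_wt (a : R) (P : list nat) (kap : R) : 0 < kap <= 1 -> a = 1 + kap -> NoDup P -> (forall p, In p P -> nprime p) ->
  exp (lsum P (wt a)) <= exp 2 * (1 + / kap).
Proof.
  intros Hk -> HN HP. destruct (squarefree_products (1 + kap) P HN HP) as (D & ND & HD & E).
  pose proof (lsum_wt_bound kap D (proj1 Hk) ND (fun d Hd => proj1 (HD d Hd))) as B. rewrite E in B.
  assert (S2 : lsum P (fun p => wt (1 + kap) p * wt (1 + kap) p) <= 2).
  { apply Rle_trans with (lsum P (wt (1 + 1))).
    - apply lsum_le; intros p Hp. destruct (HP p Hp) as [Hp2 _]. unfold wt. rewrite <- Rpower_plus.
      apply Rle_Rpower; [apply INR_pos_ge1; lia|lra].
    - eapply Rle_trans; [apply lsum_wt_bound; [lra|exact HN|intros p Hp; destruct (HP p Hp); lia]|]. rewrite Rinv_1. lra. }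
  assert (L : lprod P (fun p => exp (wt (1 + kap) p - wt (1 + kap) p * wt (1 + kap) p)) <= lprod P (fun p => 1 + wt (1 + kap) p)).
  { apply lprod_le. intros p _. split; [left; apply exp_pos|]. apply exp_le_one_plus. left; apply wt_pos. }
  rewrite lprod_exp in L.
  assert (E2 : lsum P (wt (1 + kap)) = lsum P (fun p => wt (1 + kap) p * wt (1 + kap) p) + lsum P (fun p => wt (1 + kap) p - wt (1 + kap) p * wt (1 + kap) p)).
  { rewrite <- lsum_plus. apply lsum_ext; intros; ring. }
  rewrite E2, exp_plus. apply Rmult_le_compat; [left; apply exp_pos|left; apply exp_pos|now apply exp_le_exp|lra].
Qed.

Lemma exp_le_linear x B : 0 <= x <= B -> exp x <= 1 + x * exp B.
Proof.
  intro H. destruct (Req_dec x 0) as [->|Hx]; [rewrite exp_0; lra|].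
  destruct (MVT_cor2 exp exp 0 x) as [c [Hc1 Hc2]]; [lra|intros; apply derivable_pt_lim_exp|].
  rewrite exp_0 in Hc1. assert (exp c <= exp B) by (apply exp_le_exp; lra). nra.
Qed.

(* Divide by the Euler product of [zeta(1 + 1 / ln Y)]: primes above [Y >= ln n] contribute [O(1)],
   and below [Y] the exponents [1 - 1/ln Y] and [1 + 1/ln Y] differ by [O(ln p / (p ln Y))]. *)
Lemma divisor_sum_line_one : exists C, 0 < C /\ forall (Y : R) (n : nat), exp 4 <= Y -> (1 <= n)%nat -> ln (INR n) <= Y ->
  lsum (divisors n) (wt (1 - / ln Y)) <= C * (1 + ln Y).
Proof.
  (* 12 is [4 * 3] from the squares in [inv_one_minus_exp], [exp 1] comes from the primes above [Y],
     [4 * exp 2] from the change of exponent below [Y], and the last [exp 2] from [sum_prime_wt]. *)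
  exists (exp (12 + (exp 1 + 4 * exp 2)) * exp 2). split; [apply Rmult_lt_0_compat; apply exp_pos|].
  intros Y n HY Hn HnY.
  assert (HY1 : 1 < Y) by (pose proof (exp_ineq1_le 4); lra).
  assert (HlY : 4 <= ln Y) by (rewrite <- (ln_exp 4); apply ln_le_ln; [apply exp_pos|exact HY]).
  set (eta := / ln Y).
  assert (Heta : 0 < eta <= / 4) by (unfold eta; split; [apply Rinv_0_lt_compat; lra|apply Rinv_le_contravar; lra]).
  assert (HetaY : eta * ln Y = 1) by (unfold eta; apply Rinv_l; lra).
  set (P := filter (fun p => pbool (nprime p /\ Nat.divide p n)) (seq 1 n)).
  assert (HP : forall p, In p P <-> nprime p /\ Nat.divide p n).
  { intro p. unfold P. rewrite in_filter_pbool, in_seq. split; [tauto|]. intro H. split; [|exact H].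
    pose proof (divide_pos p n Hn (proj2 H)). lia. }
  assert (NP : NoDup P) by apply NoDup_filter, seq_NoDup.
  set (x := wt (1 - eta)).
  assert (Hx : forall p, nprime p -> 0 <= x p <= 3 / 4).
  { intros p [Hp _]. split; [left; apply wt_pos|]. unfold x, wt.
    apply Rle_trans with (Rpower 2 (- (1 - eta))).
    - apply Rpower_decr; [|lra]. apply le_INR in Hp. simpl in Hp. lra.
    - apply Rle_trans with (Rpower 2 (- (3 / 4))); [apply Rle_Rpower; lra|].
      rewrite Rpower_Ropp. replace (3 / 4) with (/ (4 / 3)) at 2 by field. apply Rinv_le_contravar; [lra|].
      replace (3 / 4) with (/ 2 + / 4) by field.
      apply Rle_trans with (Rpower 2 (/ 2)); [|apply Rle_Rpower; lra].
      rewrite Rpower_sqrt by lra. rewrite <- (sqrt_Rsqr (4 / 3)) by lra. apply sqrt_le_1_alt. unfold Rsqr. lra. }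
  assert (E1 : lsum (divisors n) x <= lprod P (fun p => exp (x p + 4 * (x p * x p)))).
  { eapply Rle_trans; [apply (euler_bound (1 - eta) P)|].
    - lra.
    - intros p Hp. apply HP in Hp. destruct Hp as [[Hp _] _]. exact Hp.
    - apply divisors_NoDup.
    - intros d Hd. apply in_divisors in Hd; [|exact Hn]. pose proof (divide_pos d n Hn Hd).
      apply psmooth_all_primes; [lia|]. intros p Pp Pd. apply HP. split; [exact Pp|]. eapply Nat.divide_trans; eassumption.
    - apply lprod_le. intros p Hp. apply HP in Hp. destruct (Hx p (proj1 Hp)) as [X1 X2]. split; [left; apply Rinv_0_lt_compat; fold (wt (1 - eta) p); fold x; lra|].
      apply inv_one_minus_exp. split; assumption. }
  rewrite lprod_exp, lsum_plus, lsum_scal in E1.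
  assert (S2 : lsum P (fun p => x p * x p) <= 3).
  { apply Rle_trans with (lsum P (wt (1 + 1 / 2))).
    - apply lsum_le; intros p Hp. apply HP in Hp. destruct Hp as [[Hp _] _]. unfold x, wt. rewrite <- Rpower_plus.
      apply Rle_Rpower; [apply INR_pos_ge1; lia|lra].
    - eapply Rle_trans; [apply lsum_wt_bound; [lra|exact NP|intros p Hp; apply HP in Hp; destruct Hp as [[Hp _] _]; lia]|]. lra. }
  set (small := fun p => if Rle_dec (INR p) Y then true else false).
  assert (S1 : lsum P x = lsum (filter small P) x + lsum (filter (fun p => negb (small p)) P) x).
  { rewrite !lsum_filter, <- lsum_plus. apply lsum_ext; intros p _. destruct (small p); simpl; ring. }
  (* At most [Y / ln Y] of these primes divide [n], since their product is at most [n] and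
     [ln n <= Y]; each contributes at most [exp 1 / Y]. *)
  assert (SL : lsum (filter (fun p => negb (small p)) P) x <= exp 1).
  { set (Pl := filter (fun p => negb (small p)) P).
    assert (HPl : forall p, In p Pl -> (nprime p /\ Nat.divide p n) /\ Y < INR p).
    { intros p Hp. apply filter_In in Hp. destruct Hp as [Hp1 Hp2]. split; [now apply HP|]. unfold small in Hp2.
      destruct (Rle_dec (INR p) Y); [discriminate|lra]. }
    assert (HL : INR (length Pl) * ln Y <= Y).
    { eapply Rle_trans; [|exact HnY]. rewrite <- ln_pow by lra. apply ln_le_ln; [apply pow_lt; lra|].
      apply (pow_length_le Pl n Y); [apply NoDup_filter, NP|intros p Hp; apply HPl, Hp|exact Hn|lra|intros p Hp; left; apply HPl, Hp]. }
    apply Rle_trans with (lsum Pl (fun _ => exp 1 / Y)).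
    - apply lsum_le; intros p Hp. destruct (HPl p Hp) as [_ HpY]. unfold x, wt.
      apply Rle_trans with (Rpower Y (- (1 - eta))); [apply Rpower_decr; lra|].
      replace (- (1 - eta)) with (eta + - (1)) by ring. rewrite Rpower_plus, (Rpower_Ropp _ 1), Rpower_1 by lra.
      unfold Rpower. rewrite HetaY. right. reflexivity.
    - rewrite lsum_const. pose proof (exp_pos 1).
      replace (INR (length Pl) * (exp 1 / Y)) with (exp 1 * (INR (length Pl) / Y)) by (field; lra).
      rewrite <- (Rmult_1_r (exp 1)) at 2. apply Rmult_le_compat_l; [lra|].
      apply (Rmult_le_reg_r Y); [lra|]. unfold Rdiv. rewrite Rmult_assoc, Rinv_l by lra. pose proof (pos_INR (length Pl)). nra. }
  assert (SS : lsum (filter small P) x <= lsum (filter small P) (wt (1 + eta)) + 4 * exp 2).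
  { set (Ps := filter small P).
    assert (HPs : forall p, In p Ps -> (nprime p /\ Nat.divide p n) /\ INR p <= Y).
    { intros p Hp. apply filter_In in Hp. destruct Hp as [Hp1 Hp2]. split; [now apply HP|]. unfold small in Hp2.
      destruct (Rle_dec (INR p) Y); [assumption|discriminate]. }
    destruct (nfloor_ex Y) as [N [HN1 HN2]]; [lra|].
    assert (HN : (1 <= N)%nat). { destruct N; [simpl in HN2; lra|lia]. }
    assert (ML : lsum Ps (fun p => ln (INR p) / INR p) <= 2 * ln Y).
    { apply Rle_trans with (lsum (primes_upto N) (fun p => ln (INR p) / INR p)).
      - apply lsum_incl; [apply NoDup_filter, NP| |].
        + intros p Hp. destruct (HPs p Hp) as [[Pp _] HpY]. apply in_primes_upto. split; [|exact Pp].
          destruct Pp as [Pp _]. split; [lia|]. assert (INR p < INR (S N)) by (rewrite S_INR; lra). apply INR_lt in H. lia.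
        + intros p Hp. apply in_primes_upto in Hp. apply Rmult_le_pos; [apply ln_nonneg, INR_pos_ge1; lia|left; apply Rinv_0_lt_compat, lt_0_INR; lia].
      - eapply Rle_trans; [apply sum_log_over_prime, HN|]. apply Rmult_le_compat_l; [lra|]. apply ln_le_ln; [apply lt_0_INR; lia|exact HN1]. }
    apply Rle_trans with (lsum Ps (fun p => wt (1 + eta) p + 2 * eta * exp 2 * (ln (INR p) / INR p))).
    - apply lsum_le; intros p Hp. destruct (HPs p Hp) as [[[Pp _] _] HpY].
      assert (Hp1 : 1 <= INR p) by (apply INR_pos_ge1; lia).
      pose proof (ln_nonneg _ Hp1) as Hl0. assert (HlY' : ln (INR p) <= ln Y) by (apply ln_le_ln; lra).
      assert (Ex : exp (2 * eta * ln (INR p)) <= 1 + 2 * eta * ln (INR p) * exp 2).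
      { apply exp_le_linear. split; [repeat apply Rmult_le_pos; lra|]. nra. }
      assert (Ewt : x p = wt (1 + eta) p * exp (2 * eta * ln (INR p))).
      { unfold x, wt. change (exp (2 * eta * ln (INR p))) with (Rpower (INR p) (2 * eta)). rewrite <- Rpower_plus. f_equal. ring. }
      assert (Wp : wt (1 + eta) p <= / INR p).
      { unfold wt. rewrite <- (Rpower_1 (INR p)) at 2 by lra. rewrite <- Rpower_Ropp. apply Rle_Rpower; lra. }
      rewrite Ewt. apply Rle_trans with (wt (1 + eta) p * (1 + 2 * eta * ln (INR p) * exp 2)); [apply Rmult_le_compat_l; [left; apply wt_pos|exact Ex]|].
      rewrite Rmult_plus_distr_l, Rmult_1_r. apply Rplus_le_compat_l.
      replace (2 * eta * exp 2 * (ln (INR p) / INR p)) with (/ INR p * (2 * eta * ln (INR p) * exp 2)) by (field; lra).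
      apply Rmult_le_compat_r; [|exact Wp]. pose proof (exp_pos 2). repeat apply Rmult_le_pos; lra.
    - rewrite lsum_plus, lsum_scal. apply Rplus_le_compat_l. pose proof (exp_pos 2).
      apply Rle_trans with (2 * eta * exp 2 * (2 * ln Y)); [apply Rmult_le_compat_l; [repeat apply Rmult_le_pos; lra|exact ML]|].
      replace (2 * eta * exp 2 * (2 * ln Y)) with (4 * exp 2 * (eta * ln Y)) by ring. rewrite HetaY. lra. }
  eapply Rle_trans; [exact E1|].
  assert (Efin : lsum P x + 4 * lsum P (fun p => x p * x p) <= (12 + (exp 1 + 4 * exp 2)) + lsum (filter small P) (wt (1 + eta))) by lra.
  eapply Rle_trans; [apply exp_le_exp, Efin|]. rewrite exp_plus, (Rmult_assoc _ (exp 2)).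
  apply Rmult_le_compat_l; [left; apply exp_pos|].
  replace (ln Y) with (/ eta) by (unfold eta; apply Rinv_inv).
  apply (sum_prime_wt (1 + eta)); [lra|reflexivity|apply NoDup_filter, NP|]. intros p Hp. apply filter_In in Hp. apply HP, Hp.
Qed.

(** * The half-plane sigma >= 1 *)

(** Cosine sums with nonnegative coefficients, as lists of pairs (coefficient, frequency). They are
    closed under sums and products and have nonnegative grid averages, so an inequality between
    averages follows once the difference has this form. *)
Definition cos_positive (f : R -> R) : Prop :=
  exists l : list (R * R), (forall q, In q l -> 0 <= fst q) /\ forall t, f t = lsum l (fun q => fst q * cos (snd q * t)).

Lemma cos_positive_ext f g : (forall t, f t = g t) -> cos_positive f -> cos_positive g.
Proof. intros E (l & H1 & H2). exists l. split; [exact H1|]. intro t. rewrite <- E. apply H2. Qed.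

Lemma cos_positive_cos xi : cos_positive (fun t => cos (xi * t)).
Proof.
  exists [(1, xi)]. split; [intros q [<-|[]]; simpl; lra|]. intro t. unfold lsum; simpl. ring.
Qed.

Lemma cos_positive_const c : 0 <= c -> cos_positive (fun _ => c).
Proof.
  intro Hc. exists [(c, 0)]. split; [intros q [<-|[]]; exact Hc|]. intro t. unfold lsum; simpl. rewrite Rmult_0_l, cos_0. ring.
Qed.

Lemma cos_positive_plus f g : cos_positive f -> cos_positive g -> cos_positive (fun t => f t + g t).
Proof.
  intros (l & H1 & H2) (k & H3 & H4). exists (l ++ k). split.
  - intros q Hq. apply in_app_or in Hq. destruct Hq; auto.
  - intro t. rewrite lsum_app, H2, H4. reflexivity.
Qed.

Lemma cos_positive_mult f g : cos_positive f -> cos_positive g -> cos_positive (fun t => f t * g t).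
Proof.
  intros (l & H1 & H2) (k & H3 & H4).
  exists (map (fun y => (fst (fst y) * fst (snd y) / 2, snd (fst y) + snd (snd y))) (list_prod l k)
       ++ map (fun y => (fst (fst y) * fst (snd y) / 2, snd (fst y) - snd (snd y))) (list_prod l k)).
  split.
  - intros q Hq. apply in_app_or in Hq. destruct Hq as [Hq|Hq]; apply in_map_iff in Hq; destruct Hq as ([a b] & <- & Hab);
      apply in_prod_iff in Hab; simpl; pose proof (H1 a (proj1 Hab)); pose proof (H3 b (proj2 Hab));
      assert (0 <= fst a * fst b) by (apply Rmult_le_pos; assumption); lra.
  - intro t. rewrite lsum_app, !lsum_map, <- lsum_plus, lsum_list_prod, H2, H4, <- lsum_scal_r. apply lsum_ext; intros a _.
    rewrite <- lsum_scal. apply lsum_ext; intros b _. cbn [fst snd].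
    rewrite Rmult_plus_distr_r, Rmult_minus_distr_r, cos_plus, cos_minus. field.
Qed.

Lemma cos_positive_avg f n h : (1 <= n)%nat -> cos_positive f -> 0 <= grid_avg n h f.
Proof.
  intros Hn (l & H1 & H2). rewrite (grid_avg_ext _ _ _ _ H2), grid_avg_lsum. apply lsum_nonneg. intros q Hq.
  rewrite grid_avg_scal. apply Rmult_le_pos; [auto|now apply grid_avg_cos_nonneg].
Qed.

(** [|prod_(m in l) (1 + m^(it))|^2]. Multiplicative relations between the [m] only add to
    nonnegative coefficients. *)
Definition log_kernel (l : list nat) (t : R) : R := lprod l (fun m => 2 + 2 * cos (ln (INR m) * t)).

Lemma log_kernel_cons m l t : log_kernel (m :: l) t = (2 + 2 * cos (ln (INR m) * t)) * log_kernel l t.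
Proof. reflexivity. Qed.

Lemma cos_positive_factor m : cos_positive (fun t => 2 + 2 * cos (ln (INR m) * t)).
Proof.
  apply cos_positive_plus; [apply cos_positive_const; lra|].
  apply (cos_positive_mult (fun _ => 2)); [apply cos_positive_const; lra|apply cos_positive_cos].
Qed.

Lemma cos_positive_log_kernel l : cos_positive (log_kernel l).
Proof.
  induction l as [|m l IH].
  - apply (cos_positive_ext (fun _ => 1)); [reflexivity|]. apply cos_positive_const. lra.
  - apply (cos_positive_mult _ _ (cos_positive_factor m) IH).
Qed.

(** Each factor has constant term 2 and the remaining contributions have nonnegative coefficients;
    the average of the kernel is therefore at least [2 ^ length l]. *)
Lemma log_kernel_constant_term l : cos_positive (fun t => log_kernel l t - 2 ^ length l).
Proof.
  induction l as [|m l IH].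
  - apply (cos_positive_ext (fun _ => 0)); [intro; unfold log_kernel, lprod; simpl; ring|]. apply cos_positive_const. lra.
  - apply (cos_positive_ext (fun t => 2 * (log_kernel l t - 2 ^ length l) + 2 * (cos (ln (INR m) * t) * log_kernel l t))).
    + intro t. rewrite log_kernel_cons. simpl. ring.
    + apply cos_positive_plus.
      * apply (cos_positive_mult (fun _ => 2)); [apply cos_positive_const; lra|exact IH].
      * apply (cos_positive_mult (fun _ => 2)); [apply cos_positive_const; lra|].
        apply cos_positive_mult; [apply cos_positive_cos|apply cos_positive_log_kernel].
Qed.

(* [cos x (2 + 2 cos x) - (1 + cos x) = cos x + cos 2x] *)
Lemma log_kernel_half l m : In m l -> cos_positive (fun t => cos (ln (INR m) * t) * log_kernel l t - / 2 * log_kernel l t).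
Proof.
  induction l as [|k l IH]; [easy|]. intros [->|Hm].
  - apply (cos_positive_ext (fun t => (cos (ln (INR m) * t) + cos (2 * ln (INR m) * t)) * log_kernel l t)).
    + intro t. rewrite log_kernel_cons. replace (2 * ln (INR m) * t) with (2 * (ln (INR m) * t)) by ring. rewrite cos_2a_cos. field.
    + apply cos_positive_mult; [|apply cos_positive_log_kernel]. apply cos_positive_plus; apply cos_positive_cos.
  - apply (cos_positive_ext (fun t => (2 + 2 * cos (ln (INR k) * t)) * (cos (ln (INR m) * t) * log_kernel l t - / 2 * log_kernel l t))).
    + intro t. rewrite log_kernel_cons. ring.
    + apply cos_positive_mult; [apply cos_positive_factor|exact (IH Hm)].
Qed.

Lemma log_kernel_bounds l t : 0 <= log_kernel l t <= 4 ^ length l.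
Proof.
  induction l as [|m l IH]; [unfold log_kernel, lprod; simpl; lra|]. rewrite log_kernel_cons. simpl.
  pose proof (COS_bound (ln (INR m) * t)). nra.
Qed.

Lemma log_kernel_even l t : log_kernel l (- t) = log_kernel l t.
Proof.
  induction l as [|m l IH]; [reflexivity|]. rewrite !log_kernel_cons, IH. do 3 f_equal. rewrite <- cos_neg. f_equal. ring.
Qed.

(** For a factor [m] of the kernel, [cos (t ln m)] keeps at least half of the average, for [m = 1]
    all of it, and the terms beyond [y] are nonnegative. *)
Lemma log_kernel_resonance s X n h y : (1 <= n)%nat -> (1 <= y <= X)%nat ->
  / 2 * lsum (seq 1 y) (wt s) * grid_avg n h (log_kernel (seq 2 (y - 1)))
  <= grid_avg n h (fun t => dirichlet_cos s X t * log_kernel (seq 2 (y - 1)) t).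
Proof.
  intros Hn Hy. set (k := log_kernel (seq 2 (y - 1))).
  rewrite (grid_avg_ext _ _ (fun t => dirichlet_cos s X t * k t) (fun t => lsum (seq 1 X) (fun m => wt s m * (cos (ln (INR m) * t) * k t)))).
  2:{ intro t. unfold dirichlet_cos. rewrite sum_n_m_lsum by lia. rewrite <- lsum_scal_r. apply lsum_ext; intros m _.
      unfold wt. rewrite (Rmult_comm t). ring. }
  rewrite grid_avg_lsum. 
  assert (Hpos : forall m, 0 <= grid_avg n h (fun t => cos (ln (INR m) * t) * k t)).
  { intro m. apply cos_positive_avg; [exact Hn|]. apply cos_positive_mult; [apply cos_positive_cos|apply cos_positive_log_kernel]. }
  assert (Hhalf : forall m, In m (seq 1 y) -> / 2 * grid_avg n h k <= grid_avg n h (fun t => cos (ln (INR m) * t) * k t)).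
  { intros m Hm. apply in_seq in Hm.
    assert (H : 0 <= grid_avg n h (fun t => cos (ln (INR m) * t) * k t - / 2 * k t)).
    { apply cos_positive_avg; [exact Hn|]. destruct (Nat.eq_dec m 1) as [->|Hne].
      - apply (cos_positive_ext (fun t => / 2 * k t)).
        + intro t. change (INR 1) with 1. rewrite ln_1, Rmult_0_l, cos_0. lra.
        + apply (cos_positive_mult (fun _ => / 2)); [apply cos_positive_const; lra|apply cos_positive_log_kernel].
      - apply log_kernel_half. apply in_seq. lia. }
    rewrite (grid_avg_ext _ _ _ (fun t => cos (ln (INR m) * t) * k t + (- / 2) * k t)) in H by (intro; ring).
    rewrite grid_avg_plus, grid_avg_scal in H. lra. }
  apply Rle_trans with (lsum (seq 1 y) (fun m => wt s m * grid_avg n h (fun t => cos (ln (INR m) * t) * k t))).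
  - replace (/ 2 * lsum (seq 1 y) (wt s) * grid_avg n h k) with (lsum (seq 1 y) (wt s) * (/ 2 * grid_avg n h k)) by ring.
    rewrite <- lsum_scal_r. apply lsum_le. intros m Hm. apply Rmult_le_compat_l; [left; apply wt_pos|auto].
  - rewrite (lsum_ext (seq 1 X) _ (fun m => wt s m * grid_avg n h (fun t => cos (ln (INR m) * t) * k t))) by (intros; apply grid_avg_scal).
    apply lsum_incl; [apply seq_NoDup| |].
    + intros m Hm. apply in_seq in Hm. apply in_seq. lia.
    + intros m _. apply Rmult_le_pos; [left; apply wt_pos|apply Hpos].
Qed.

Lemma Rpower_ge_1 (x a : R) : 1 <= x -> 0 <= a -> 1 <= Rpower x a.
Proof.
  intros Hx Ha. apply Rle_trans with (Rpower 1 a); [right; symmetry; apply Rpower_1_l|]. apply Rle_Rpower_l; lra.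
Qed.

Lemma log_square_small (kap C : R) : 0 < kap -> 0 <= C -> exists T0, 3 <= T0 /\ forall T, T0 <= T -> C * (1 + ln T) ^ 2 <= Rpower T kap.
Proof.
  intros Hk HC. set (D := 1 + C * (1 + 4 / kap) ^ 2).
  assert (H4 : 0 < 4 / kap) by (apply Rdiv_lt_0_compat; lra).
  assert (HD : 1 <= D) by (unfold D; pose proof (pow2_ge_0 (1 + 4 / kap)); nra).
  exists (3 + Rpower D (2 / kap)). split; [pose proof (Rpower_pos D (2 / kap)); lra|]. intros T HT.
  pose proof (Rpower_pos D (2 / kap)) as HDp.
  assert (Hl : ln T <= 4 / kap * Rpower T (kap / 4)).
  { assert (E : ln (Rpower T (kap / 4)) = kap / 4 * ln T) by (unfold Rpower; apply ln_exp).
    pose proof (exp_ineq1_le (ln (Rpower T (kap / 4)))) as H. rewrite exp_ln in H by apply Rpower_pos. rewrite E in H.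
    replace (ln T) with (4 / kap * (kap / 4 * ln T)) by (field; lra). apply Rmult_le_compat_l; lra. }
  assert (H1 : 1 <= Rpower T (kap / 4)) by (apply Rpower_ge_1; lra).
  assert (Hl0 : 0 <= ln T) by (apply ln_nonneg; lra).
  assert (H2 : (1 + ln T) ^ 2 <= (1 + 4 / kap) ^ 2 * Rpower T (kap / 2)).
  { replace (Rpower T (kap / 2)) with (Rpower T (kap / 4) ^ 2).
    - rewrite <- Rpow_mult_distr. apply pow_incr. nra.
    - simpl. rewrite Rmult_1_r, <- Rpower_plus. f_equal. field. }
  assert (H3 : D <= Rpower T (kap / 2)).
  { replace D with (Rpower (Rpower D (2 / kap)) (kap / 2)).
    - apply Rle_Rpower_l; lra.
    - rewrite Rpower_mult. replace (2 / kap * (kap / 2)) with 1 by (field; lra). apply Rpower_1. lra. }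
  replace (Rpower T kap) with (Rpower T (kap / 2) * Rpower T (kap / 2)) by (rewrite <- Rpower_plus; f_equal; field).
  apply Rle_trans with (C * (1 + 4 / kap) ^ 2 * Rpower T (kap / 2)).
  - rewrite Rmult_assoc. apply Rmult_le_compat_l; assumption.
  - apply Rmult_le_compat_r; [left; apply Rpower_pos|]. unfold D in H3. lra.
Qed.

Lemma nat_between (x : R) : 1 <= x -> exists X : nat, x <= INR X <= 2 * x.
Proof.
  intro Hx. destruct (nfloor_ex x) as [N [H1 H2]]; [lra|]. exists (S N). rewrite S_INR. lra.
Qed.

(** One-sided and for the real part, the form in which resonance uses zeta; in the end [S] is the
    square root of the maximum. *)
Definition zeta_bound (zeta : C -> C) (s T S : R) : Prop :=
  0 <= S /\ forall t, 1 <= t <= T -> fst (zeta (s, t)) <= S.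

(** With [X] about [T^2], the error relative to the average of the kernel carries the factor
    [4^(y-1) / 2^(y-1)] against [O(ln^2 T / T)], and [y <= ln T / 2] gives [2^y <= T^(1/2)]. The
    total error is at most 1/8, which half of the main term absorbs because the sum is at least
    1. *)
Lemma zeta_lower_line_one (zeta : C -> C) (s : R) : is_riemann_zeta zeta -> 1 <= s ->
  exists T0, 3 <= T0 /\ forall T S y, T0 <= T -> zeta_bound zeta s T S -> (1 <= y)%nat -> INR y <= / 2 * ln T ->
    / 4 * lsum (seq 1 y) (wt s) <= S.
Proof.
  intros Hz Hs. set (Ks := 2 * (2 + s) ^ 2 * (1 + 1 / s)).
  assert (HKs : 0 <= Ks).
  { unfold Ks. assert (0 < 1 / s) by (apply Rdiv_lt_0_compat; lra). apply Rmult_le_pos; [nra|lra]. }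
  destruct (log_square_small (1 / 2) (8 * (Ks + 32)) ltac:(lra) ltac:(lra)) as (T0 & HT0 & HTl).
  exists T0. split; [exact HT0|]. intros T S y HT [HS HzS] Hy1 Hy.
  specialize (HTl T HT). assert (HT3 : 3 <= T) by lra.
  assert (Hl0 : 0 <= ln T) by (apply ln_nonneg; lra).
  destruct (nat_between (T * T)) as [X [HX1 HX2]]; [nra|].
  assert (HX0 : 1 <= INR X) by nra.
  assert (HXn : (1 <= X)%nat) by (apply INR_le; simpl; lra).
  assert (HyT : INR y <= T).
  { pose proof (exp_ineq1_le (ln T)) as H. rewrite exp_ln in H by lra. lra. }
  assert (HyX : (y <= X)%nat) by (apply INR_le; nra).
  destruct (grid_exists T HT3) as (n & h & Hn & Hh & HnT & HhT).
  set (l := seq 2 (y - 1)). set (Av := grid_avg n h (log_kernel l)).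
  assert (Hlen : length l = (y - 1)%nat) by apply length_seq.
  assert (HAv : 2 ^ (y - 1) <= Av).
  { pose proof (cos_positive_avg _ n h Hn (log_kernel_constant_term l)) as H.
    rewrite (grid_avg_ext _ _ _ (fun t => log_kernel l t + - 2 ^ length l)) in H by (intro; ring).
    rewrite grid_avg_plus, grid_avg_const, Hlen in H by exact Hn. fold Av in H. lra. }
  assert (HXs : Rpower (INR X) (1 - s) <= 1).
  { replace (1 - s) with (- (s - 1)) by ring. apply Rle_trans with (Rpower 1 (- (s - 1))); [apply Rpower_decr; lra|right; apply Rpower_1_l]. }
  pose proof (log_kernel_resonance s X n h y Hn (conj Hy1 HyX)) as Low. fold l in Low. fold Av in Low.
  pose proof (resonance_upper zeta s T h S 1 (4 ^ (y - 1)) n X (log_kernel l) Hz ltac:(lra) ltac:(lra) Hn Hh HnT HXn HS HzS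
    (log_kernel_even l) (fun t => eq_ind (length l) (fun k => 0 <= log_kernel l t <= 4 ^ k) (log_kernel_bounds l t) _ Hlen) (Rle_refl 1) HXs) as Up.
  fold Ks in Up. fold Av in Up.
  set (E := Ks * T * Rpower (INR X) (- s)) in *. set (err := 1 * (2 + ln (INR X)) * (4 * (1 + ln (1 + T)) / T)) in *.
  assert (H2y : 0 < 2 ^ (y - 1)) by (apply pow_lt; lra).
  assert (H4 : 4 ^ (y - 1) = 2 ^ (y - 1) * 2 ^ (y - 1)) by (rewrite <- Rpow_mult_distr; f_equal; lra).
  assert (Herr0 : 0 <= err).
  { unfold err. assert (0 <= ln (INR X)) by now apply ln_nonneg. assert (0 <= ln (1 + T)) by (apply ln_nonneg; lra).
    apply Rmult_le_pos; [lra|]. apply Rmult_le_pos; [lra|left; apply Rinv_0_lt_compat; lra]. }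
  assert (Main : / 2 * lsum (seq 1 y) (wt s) <= S + E + 2 ^ (y - 1) * err).
  { apply (Rmult_le_reg_r Av); [lra|]. eapply Rle_trans; [exact Low|]. eapply Rle_trans; [exact Up|].
    rewrite (Rmult_plus_distr_r (S + E)). apply Rplus_le_compat_l. rewrite H4.
    replace (2 ^ (y - 1) * 2 ^ (y - 1) * err) with (2 ^ (y - 1) * err * 2 ^ (y - 1)) by ring.
    apply Rmult_le_compat_l; [apply Rmult_le_pos; lra|exact HAv]. }
  set (sq := Rpower T (1 / 2)) in *.
  assert (Hsq : sq * sq = T) by (unfold sq; rewrite <- Rpower_plus; replace (1 / 2 + 1 / 2) with 1 by field; apply Rpower_1; lra).
  assert (Hsq0 : 0 < sq) by apply Rpower_pos.
  assert (HE : E <= Ks / T).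
  { unfold E. apply Rle_trans with (Ks * T * Rpower (T * T) (- (1))).
    - apply Rmult_le_compat_l; [apply Rmult_le_pos; lra|].
      apply Rle_trans with (Rpower (INR X) (- (1))); [apply Rle_Rpower; lra|]. apply Rpower_decr; nra.
    - rewrite Rpower_Ropp, Rpower_1 by nra. right. field. lra. }
  assert (H2p : 2 ^ (y - 1) <= sq).
  { apply Rle_trans with (2 ^ y); [apply Rle_pow; [lra|lia]|].
    apply Rle_trans with (exp 1 ^ y); [apply pow_incr; pose proof (exp_ineq1_le 1); lra|].
    rewrite <- Rpower_pow by apply exp_pos. unfold sq, Rpower. rewrite ln_exp. apply exp_le_exp. lra. }
  assert (Hlsq : 0 <= (1 + ln T) ^ 2) by apply pow2_ge_0.
  assert (HlX : 2 + ln (INR X) <= 4 * (1 + ln T)).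
  { assert (ln (INR X) <= ln (2 * (T * T))) by (apply ln_le_ln; lra).
    rewrite !ln_mult in H by nra. assert (ln 2 <= 1) by (rewrite <- (ln_exp 1); apply ln_le_ln; [lra|]; pose proof (exp_ineq1_le 1); lra). lra. }
  assert (HlT : 1 + ln (1 + T) <= 2 * (1 + ln T)).
  { assert (ln (1 + T) <= ln (2 * T)) by (apply ln_le_ln; lra).
    rewrite ln_mult in H by lra. assert (ln 2 <= 1) by (rewrite <- (ln_exp 1); apply ln_le_ln; [lra|]; pose proof (exp_ineq1_le 1); lra). lra. }
  assert (HX0' : 0 <= 2 + ln (INR X)) by (pose proof (ln_nonneg _ HX0); lra).
  assert (HT0' : 0 <= 1 + ln (1 + T)) by (pose proof (ln_nonneg (1 + T) ltac:(lra)); lra).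
  assert (Herr : err <= 32 * (1 + ln T) ^ 2 / T).
  { unfold err. replace (1 * (2 + ln (INR X)) * (4 * (1 + ln (1 + T)) / T)) with (4 * ((2 + ln (INR X)) * (1 + ln (1 + T))) / T) by (unfold Rdiv; ring).
    apply Rmult_le_compat_r; [left; apply Rinv_0_lt_compat; lra|].
    assert ((2 + ln (INR X)) * (1 + ln (1 + T)) <= 4 * (1 + ln T) * (2 * (1 + ln T))) by (apply Rmult_le_compat; assumption). nra. }
  assert (Tot : E + 2 ^ (y - 1) * err <= / 8).
  { assert (A1 : 2 ^ (y - 1) * err <= sq * (32 * (1 + ln T) ^ 2 / T)) by (apply Rmult_le_compat; lra).
    assert (A2 : Ks / T <= sq * (Ks * (1 + ln T) ^ 2 / T)).
    { assert (1 <= sq) by (apply Rpower_ge_1; lra).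
      assert (1 <= (1 + ln T) ^ 2) by (simpl; nra).
      replace (sq * (Ks * (1 + ln T) ^ 2 / T)) with (Ks / T * (sq * (1 + ln T) ^ 2)) by (unfold Rdiv; ring).
      assert (0 <= Ks / T) by (apply Rmult_le_pos; [exact HKs|left; apply Rinv_0_lt_compat; lra]).
      assert (1 * 1 <= sq * (1 + ln T) ^ 2) by (apply Rmult_le_compat; lra).
      rewrite <- (Rmult_1_r (Ks / T)) at 1. apply Rmult_le_compat_l; lra. }
    assert (A3 : sq * (Ks * (1 + ln T) ^ 2 / T) + sq * (32 * (1 + ln T) ^ 2 / T) <= / 8).
    { replace (sq * (Ks * (1 + ln T) ^ 2 / T) + sq * (32 * (1 + ln T) ^ 2 / T)) with (8 * (Ks + 32) * (1 + ln T) ^ 2 * (sq / T / 8)) by (field; lra).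
      replace (/ 8) with (sq * (sq / T / 8)) by (rewrite <- Hsq; field; lra).
      apply Rmult_le_compat_r; [|exact HTl]. left. apply Rdiv_lt_0_compat; [apply Rdiv_lt_0_compat; lra|lra]. }
    lra. }
  assert (H1 : 1 <= lsum (seq 1 y) (wt s)).
  { rewrite <- (wt_1 s). apply (lsum_single_le (seq 1 y) (wt s)); [apply in_seq; lia|intros; left; apply wt_pos]. }
  lra.
Qed.

Definition pos_set (K : list nat) : Prop := NoDup K /\ (forall n, In n K -> (1 <= n)%nat) /\ factor_closed K /\ In 1%nat K.

Lemma harmonic_lower y : ln (INR y + 1) <= lsum (seq 1 y) (wt 1).
Proof.
  induction y as [|y IH]; [simpl; rewrite Rplus_0_l, ln_1; unfold lsum; simpl; lra|].
  rewrite lsum_seq_S. change (1 + y)%nat with (S y). pose proof (INR_S_ge1 y) as H1.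
  assert (E : wt 1 (S y) = / INR (S y)) by (unfold wt; rewrite Rpower_Ropp, Rpower_1 by lra; reflexivity).
  rewrite E. rewrite <- S_INR in IH.
  assert (H : ln (INR (S y) + 1) <= ln (INR (S y)) + / INR (S y)).
  { replace (INR (S y) + 1) with (INR (S y) * (1 + / INR (S y))) by (field; lra).
    assert (0 < / INR (S y)) by (apply Rinv_0_lt_compat; lra).
    rewrite ln_mult by lra. apply Rplus_le_compat_l. rewrite <- (ln_exp (/ INR (S y))) at 2.
    apply ln_le_ln; [lra|]. apply exp_ineq1_le. }
  lra.
Qed.

Lemma lsum_wt_split (kap : R) (D : list nat) (y : nat) : 0 < kap -> NoDup D -> (forall d, In d D -> (1 <= d)%nat) ->
  lsum D (wt (1 + kap)) <= lsum (seq 1 y) (wt (1 + kap)) + (1 + / kap) * wt kap (S y).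
Proof.
  intros Hk HN HD. set (N := list_max D).
  apply Rle_trans with (lsum (seq 1 (y + S N)) (wt (1 + kap))).
  - apply lsum_incl; [exact HN| |intros; left; apply wt_pos]. intros d Hd. apply in_seq.
    pose proof (proj1 (list_max_le D (list_max D)) (le_n _)) as LM. rewrite Forall_forall in LM. specialize (LM d Hd). specialize (HD d Hd). unfold N. lia.
  - rewrite seq_app, lsum_app. apply Rplus_le_compat_l.
    pose proof (sum_Rpower_tail kap (S y) Hk ltac:(lia) N) as H.
    assert (E : lsum (seq (1 + y) (S N)) (wt (1 + kap)) = sum_n (fun k => Rpower (INR (S y + k)) (- (1 + kap))) N).
    { clear. induction N as [|N IH]; [rewrite sum_O; unfold lsum; simpl; rewrite Nat.add_0_r; apply Rplus_0_r|].
      rewrite lsum_seq_S, IH, sum_Sn. reflexivity. }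
    rewrite E. eapply Rle_trans; [exact H|]. fold (wt (1 + kap) (S y)). fold (wt kap (S y)).
    assert (wt (1 + kap) (S y) <= wt kap (S y)) by (apply Rle_Rpower; [apply INR_S_ge1|lra]).
    unfold Rdiv. pose proof (wt_pos kap (S y)). lra.
Qed.

(** One constant [C1] serves all [s >= 1]. At [s = 1] the shift [tau = / ln (ln T)] in
    [conv_l2_bound] makes both sums [O(ln ln T)], the size of the harmonic sum up to [ln T / 2]. For
    [s > 1] the shift is 0: once [T] is large, every sum of [wt s] is at most twice its part up to
    [y]. *)
Lemma case_line_one : exists C1, 0 < C1 /\ forall zeta, is_riemann_zeta zeta -> forall s, 1 <= s ->
  exists T0, 3 <= T0 /\ forall T S K e, T0 <= T -> zeta_bound zeta s T S -> pos_set K ->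
    (forall n, In n K -> INR n <= T) -> sqsum K (conv s e) <= C1 * (S * S) * sqsum K (wt e).
Proof.
  destruct divisor_sum_line_one as (C & HC & HD). exists (64 * (C + 1)). split; [lra|].
  intros zeta Hz s Hs. destruct (zeta_lower_line_one zeta s Hz Hs) as (T1 & HT1 & HL).
  (* [L] will be [1 + ln (ln T)] at [s = 1] and twice the partial sum for [s > 1];
     [zeta_lower_line_one] gives [L <= 8 S] in both cases. *)
  assert (Hred : forall K e S L, pos_set K -> 0 <= L -> L <= 8 * S -> sqsum K (conv s e) <= (C + 1) * L * L * sqsum K (wt e) ->
     sqsum K (conv s e) <= 64 * (C + 1) * (S * S) * sqsum K (wt e)).
  { intros K e S L _ HL0 HLS H. eapply Rle_trans; [exact H|]. apply Rmult_le_compat_r; [apply sqsum_nonneg|].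
    rewrite !Rmult_assoc, (Rmult_comm 64), !Rmult_assoc. apply Rmult_le_compat_l; [lra|]. nra. }
  destruct (Req_dec s 1) as [->|Hs1].
  - exists (Rmax T1 (exp (exp 4))). split; [eapply Rle_trans; [exact HT1|apply Rmax_l]|].
    intros T S K e HT HzS HK HKT.
    assert (HTa : T1 <= T) by (eapply Rle_trans; [apply Rmax_l|exact HT]).
    assert (HTb : exp (exp 4) <= T) by (eapply Rle_trans; [apply Rmax_r|exact HT]).
    set (Y := ln T). assert (HY : exp 4 <= Y) by (unfold Y; rewrite <- (ln_exp (exp 4)); apply ln_le_ln; [apply exp_pos|exact HTb]).
    assert (HY5 : 5 <= Y) by (pose proof (exp_ineq1_le 4); lra).
    assert (HlY : 4 <= ln Y) by (rewrite <- (ln_exp 4); apply ln_le_ln; [apply exp_pos|exact HY]).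
    destruct (nfloor_ex (/ 2 * Y)) as [y [Hy1 Hy2]]; [lra|].
    assert (Hy : (1 <= y)%nat) by (destruct y; [simpl in Hy2; lra|lia]).
    pose proof (HL T S y HTa HzS Hy Hy1) as HLS.
    pose proof (harmonic_lower y) as Hh.
    assert (Hln : ln Y - 1 <= ln (INR y + 1)).
    { apply Rle_trans with (ln (/ 2 * Y)); [|apply ln_le_ln; lra]. rewrite ln_mult, ln_Rinv by lra.
      assert (ln 2 <= 1) by (rewrite <- (ln_exp 1); apply ln_le_ln; [lra|]; pose proof (exp_ineq1_le 1); lra). lra. }
    destruct HK as (HN & Hpos & HF & H1).
    apply (Hred K e S (1 + ln Y)); [repeat split; assumption|lra|lra|].
    assert (Htau : 0 < / ln Y) by (apply Rinv_0_lt_compat; lra).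
    eapply Rle_trans; [apply (conv_l2_bound 1 e (/ ln Y) (C * (1 + ln Y)) (1 + ln Y) K HN Hpos HF)|].
    + intros n Hn. apply HD; [exact HY|auto|]. apply ln_le_ln; [apply lt_0_INR; specialize (Hpos n Hn); lia|auto].
    + eapply Rle_trans; [apply lsum_wt_bound; assumption|]. rewrite Rinv_inv. lra.
    + apply Rmult_le_compat_r; [apply sqsum_nonneg|].
      assert (0 <= (1 + ln Y) * (1 + ln Y)) by nra. nra.
  - set (kap := s - 1). assert (Hk : 0 < kap) by (unfold kap; lra).
    (* [y + 1 >= x0] yields [(1 + / kap) (y + 1)^(-kap) <= 1], a bound for the tail beyond [y]. *)
    set (x0 := 1 + Rpower (1 + / kap) (/ kap)).
    assert (Hik : 0 < / kap) by now apply Rinv_0_lt_compat.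
    pose proof (Rpower_pos (1 + / kap) (/ kap)) as Hx0.
    exists (Rmax T1 (exp (2 * x0))). split; [eapply Rle_trans; [exact HT1|apply Rmax_l]|].
    intros T S K e HT HzS HK HKT.
    assert (HTa : T1 <= T) by (eapply Rle_trans; [apply Rmax_l|exact HT]).
    assert (HTb : exp (2 * x0) <= T) by (eapply Rle_trans; [apply Rmax_r|exact HT]).
    assert (HY : 2 * x0 <= ln T) by (rewrite <- (ln_exp (2 * x0)); apply ln_le_ln; [apply exp_pos|exact HTb]).
    destruct (nfloor_ex (/ 2 * ln T)) as [y [Hy1 Hy2]]; [unfold x0 in HY; lra|].
    assert (Hy : (1 <= y)%nat) by (destruct y; [unfold x0 in HY; simpl in Hy2; lra|lia]).
    pose proof (HL T S y HTa HzS Hy Hy1) as HLS.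
    set (H0 := lsum (seq 1 y) (wt s)) in *.
    assert (HH1 : 1 <= H0).
    { rewrite <- (wt_1 s). apply (lsum_single_le (seq 1 y) (wt s)); [apply in_seq; lia|intros; left; apply wt_pos]. }
    assert (Htail : (1 + / kap) * wt kap (Datatypes.S y) <= 1).
    { unfold wt. rewrite S_INR, Rpower_Ropp.
      assert (K1 : 1 + / kap <= Rpower (INR y + 1) kap).
      { replace (1 + / kap) with (Rpower (Rpower (1 + / kap) (/ kap)) kap).
        - apply Rle_Rpower_l; [lra|]. unfold x0 in HY. lra.
        - rewrite Rpower_mult, Rinv_l, Rpower_1 by lra. reflexivity. }
      pose proof (Rpower_pos (INR y + 1) kap). apply (Rmult_le_reg_r (Rpower (INR y + 1) kap)); [assumption|].
      rewrite Rmult_assoc, Rinv_l by lra. lra. }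
    assert (HDD : forall D, NoDup D -> (forall d, In d D -> (1 <= d)%nat) -> lsum D (wt s) <= 2 * H0).
    { intros D ND PD. pose proof (lsum_wt_split kap D y Hk ND PD) as X. replace (1 + kap) with s in X by (unfold kap; ring).
      fold H0 in X. lra. }
    destruct HK as (HN & Hpos & HF & H1).
    apply (Hred K e S (2 * H0)); [repeat split; assumption|lra|lra|].
    eapply Rle_trans; [apply (conv_l2_bound s e 0 (2 * H0) (2 * H0) K HN Hpos HF)|].
    + intros n Hn. replace (s - 0) with s by ring. apply HDD; [apply divisors_NoDup|].
      intros d Hd. apply in_divisors in Hd; [|auto]. apply (divide_pos d n); auto.
    + replace (s + 0) with s by ring. apply HDD; assumption.
    + apply Rmult_le_compat_r; [apply sqsum_nonneg|]. nra.
Qed.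

(** * The strip 1/2 < sigma < 1 *)

(* The power of [T] saved by the resonance error when [X] is about [T^(1 + 1/(2 s))]. *)
Definition slack (s : R) : R := (1 - s) * (1 - 1 / (2 * s)).

Lemma slack_pos s : 1 / 2 < s < 1 -> 0 < slack s.
Proof.
  intro Hs. unfold slack. assert (1 / (2 * s) < 1).
  { apply (Rmult_lt_reg_r (2 * s)); [lra|]. unfold Rdiv. rewrite Rmult_assoc, Rinv_l by lra. lra. }
  apply Rmult_lt_0_compat; lra.
Qed.

Lemma divisor_count_uniform (theta : R) : 0 < theta -> exists T0, 3 <= T0 /\ forall T n, T0 <= T -> (1 <= n)%nat -> INR n <= T ->
  INR (length (divisors n)) <= Rpower T theta.
Proof.
  intro Ht. destruct (divisor_bound (theta / 2) ltac:(lra)) as (C & HC & H).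
  destruct (log_square_small (theta / 2) C ltac:(lra) ltac:(lra)) as (T0 & HT0 & HL).
  exists T0. split; [exact HT0|]. intros T n HT Hn HnT. eapply Rle_trans; [apply H, Hn|].
  assert (HlT : 0 <= ln T) by (apply ln_nonneg; lra). specialize (HL T HT).
  assert (C <= Rpower T (theta / 2)). { eapply Rle_trans; [|exact HL]. simpl. nra. }
  replace (Rpower T theta) with (Rpower T (theta / 2) * Rpower T (theta / 2)) by (rewrite <- Rpower_plus; f_equal; field).
  apply Rmult_le_compat; [lra|left; apply Rpower_pos|assumption|].
  apply Rle_Rpower_l; [lra|]. split; [apply lt_0_INR; lia|exact HnT].
Qed.

Lemma lsum_conv_le s e A D : 0 <= e <= s -> (forall n, In n A -> (1 <= n)%nat /\ INR (length (divisors n)) <= D) ->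
  lsum A (conv s e) <= D * lsum A (wt e) /\ sqsum A (conv s e) <= D * D * sqsum A (wt e).
Proof.
  intros He HA.
  assert (P : forall n, In n A -> 0 <= conv s e n <= D * wt e n).
  { intros n Hn. destruct (HA n Hn) as [H1 H2]. split; [apply conv_nonneg|].
    eapply Rle_trans; [apply conv_le_divisors; assumption|]. rewrite Rmult_comm. apply Rmult_le_compat_r; [left; apply wt_pos|exact H2]. }
  split.
  - rewrite <- lsum_scal. apply lsum_le. intros n Hn. apply P, Hn.
  - unfold sqsum. rewrite <- lsum_scal. apply lsum_le. intros n Hn. destruct (P n Hn).
    replace (D * D * (wt e n * wt e n)) with ((D * wt e n) * (D * wt e n)) by ring. apply Rmult_le_compat; assumption.
Qed.

Lemma lprod_ge_1 {A} (l : list A) f : (forall x, In x l -> 1 <= f x) -> 1 <= lprod l f.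
Proof.
  intro H. apply Rle_trans with (lprod l (fun _ => 1)); [rewrite lprod_const, pow1; lra|].
  apply lprod_le. intros x Hx. specialize (H x Hx). lra.
Qed.

(** The mixed resonator on [A], multiplied by the block [P], has indices up to [T]; the l1
    hypothesis controls the error term of the resonance. [P = []] gives the plain resonance bound.
    The amplification appears squared since it multiplies [|b| / |c|]. *)
Lemma amplified_resonance (zeta : C -> C) (s : R) : is_riemann_zeta zeta -> 1 / 2 < s < 1 ->
  exists T0, 3 <= T0 /\ forall T S A P e Nn Mp, T0 <= T -> zeta_bound zeta s T S -> pos_set A -> 0 <= e <= s ->
    NoDup P -> (forall p, In p P -> nprime p /\ INR p <= Mp) -> (forall a, In a A -> pfree P a /\ INR a <= Nn) ->
    0 <= Nn -> 1 <= Mp -> Nn * Mp ^ length P <= T -> 2 ^ length P <= Rpower T (slack s / 8) ->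
    lsum A (wt e) * lsum A (wt e) <= Rpower T (2 * s - 1 + slack s / 8) * sqsum A (conv s e) ->
    lprod P (fun p => 1 + wt s p / 2) * lprod P (fun p => 1 + wt s p / 2) * sqsum A (conv s e) <= 1536 * 1536 * (S * S) * sqsum A (wt e).
Proof.
  intros Hz Hs. pose proof (slack_pos s Hs) as Hsl. set (kap := slack s) in *. set (th := kap / 8).
  (* [X] will be about [T^a0]. Then [T X^(-s)] is about [T^(-(s - 1/2))], and
     [T^(2s - 1) X^(1-s) / T] is about [T^(- slack s)]. *)
  set (a0 := 1 + 1 / (2 * s)). set (Ks := 2 * (2 + s) ^ 2 * (1 + 1 / s)).
  assert (Ha0 : 1 < a0 < 2).
  { unfold a0. assert (0 < 1 / (2 * s)) by (apply Rdiv_lt_0_compat; lra). assert (1 / (2 * s) < 1); [|lra].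
    apply (Rmult_lt_reg_r (2 * s)); [lra|]. unfold Rdiv. rewrite Rmult_assoc, Rinv_l by lra. lra. }
  assert (HKs : 0 <= Ks).
  { unfold Ks. assert (0 < 1 / s) by (apply Rdiv_lt_0_compat; lra). apply Rmult_le_pos; [nra|lra]. }
  destruct (divisor_count_uniform th ltac:(unfold th; lra)) as (T1 & HT1 & HD).
  destruct (log_square_small (kap / 2) 1280 ltac:(lra) ltac:(lra)) as (T2 & HT2 & HL2).
  destruct (log_square_small (s - 1 / 2) (3072 * Ks) ltac:(lra) ltac:(lra)) as (T3 & HT3 & HL3).
  exists (Rmax T1 (Rmax T2 T3)). split; [eapply Rle_trans; [exact HT1|apply Rmax_l]|].
  intros T S A P e Nn Mp HT [HS HzS] (NA & PA & FA & A1) He NP HP HA HNn HMp HNM H2m HL1.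
  assert (HTa : T1 <= T) by (eapply Rle_trans; [apply Rmax_l|exact HT]).
  assert (HTb : T2 <= T) by (eapply Rle_trans; [|exact HT]; eapply Rle_trans; [apply Rmax_l|apply Rmax_r]).
  assert (HTc : T3 <= T) by (eapply Rle_trans; [|exact HT]; eapply Rle_trans; [apply Rmax_r|apply Rmax_r]).
  specialize (HL2 T HTb). specialize (HL3 T HTc).
  assert (HT3' : 3 <= T) by lra. assert (Hl0 : 0 <= ln T) by (apply ln_nonneg; lra).
  assert (HMm : 1 <= Mp ^ length P) by (apply pow_R1_Rle; exact HMp).
  assert (HAT : forall n, In n A -> INR n <= T).
  { intros n Hn. destruct (HA n Hn) as [_ H]. eapply Rle_trans; [exact H|]. eapply Rle_trans; [|exact HNM]. nra. }
  set (D := Rpower T th).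
  assert (HD1 : 1 <= D) by (apply Rpower_ge_1; unfold th; lra).
  destruct (lsum_conv_le s e A D He) as [C1 C2]; [intros n Hn; split; [auto|apply HD; auto]|].
  set (L := lsum A (wt e)) in *. set (Lb := lsum A (conv s e)) in *.
  set (B2 := sqsum A (conv s e)) in *. set (W2 := sqsum A (wt e)) in *.
  assert (HL0 : 0 <= L) by (apply lsum_nonneg; intros; left; apply wt_pos).
  assert (HLb0 : 0 <= Lb) by (apply lsum_nonneg; intros; apply conv_nonneg).
  assert (HWB : W2 <= B2).
  { apply lsum_le. intros n Hn. pose proof (conv_ge_wt s e n (PA n Hn)). pose proof (wt_pos e n). nra. }
  assert (HW1 : 1 <= W2).
  { unfold W2, sqsum. pose proof (lsum_single_le A (fun n => wt e n * wt e n) 1%nat A1) as X. cbv beta in X. rewrite wt_1 in X.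
    rewrite Rmult_1_r in X. apply X. intros; apply Rle_0_sqr. }
  destruct (mixed_resonator s e A NA FA PA) as (F1 & F2 & F3). fold B2 W2 in F1, F2, F3. fold L Lb in F3.
  set (Nb := sqrt B2) in *. set (Nc := sqrt W2) in *.
  assert (HNb : Nb * Nb = B2) by (apply sqrt_sqrt; lra). assert (HNc : Nc * Nc = W2) by (apply sqrt_sqrt; lra).
  assert (Nc1 : 1 <= Nc) by (unfold Nc; rewrite <- sqrt_1; now apply sqrt_le_1_alt).
  assert (Ncb : Nc <= Nb) by (now apply sqrt_le_1_alt).
  set (Y := map (fun n => (n, mixed_coef s e Nb Nc n)) A) in *.
  assert (HYfst : map fst Y = A) by (unfold Y; rewrite map_map; apply map_id).
  destruct (double_many s P NP (fun p Hp => proj1 (HP p Hp)) Y Nn Mp HNn ltac:(lra) (fun p Hp => proj2 (HP p Hp)) HMp) as (Y' & ND' & HY' & E1 & E2 & E3 & _).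
  { rewrite HYfst. exact NA. }
  { intros q Hq. unfold Y in Hq. apply in_map_iff in Hq. destruct Hq as (n & <- & Hn). cbn [fst snd].
    split; [auto|]. split; [apply HA, Hn|]. unfold mixed_coef. pose proof (wt_pos e n). pose proof (conv_nonneg s e n).
    apply Rplus_le_le_0_compat; apply Rmult_le_pos; lra. }
  { intros q Hq. unfold Y in Hq. apply in_map_iff in Hq. destruct Hq as (n & <- & Hn). apply HA, Hn. }
  set (m := length P) in *. set (Gam := lprod P (fun p => 1 + wt s p / 2)) in *.
  assert (HGam : 1 <= Gam) by (apply lprod_ge_1; intros; pose proof (wt_pos s x); lra).
  destruct (nat_between (Rpower T a0)) as [X [HX1 HX2]]; [apply Rpower_ge_1; lra|].
  assert (HTX : T <= INR X).
  { eapply Rle_trans; [|exact HX1]. rewrite <- (Rpower_1 T) at 1 by lra. apply Rle_Rpower; lra. }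
  assert (Ts : 0 < Rpower T (a0 * (1 - s))) by apply Rpower_pos.
  set (G := 2 * Rpower T (a0 * (1 - s))).
  assert (HG1 : 1 <= G) by (unfold G; assert (1 <= Rpower T (a0 * (1 - s))) by (apply Rpower_ge_1; [lra|nra]); lra).
  assert (HXG : Rpower (INR X) (1 - s) <= G).
  { apply Rle_trans with (Rpower (2 * Rpower T a0) (1 - s)); [apply Rle_Rpower_l; lra|].
    rewrite <- Rpower_mult_distr by (try apply Rpower_pos; lra). rewrite Rpower_mult. unfold G. apply Rmult_le_compat_r; [lra|].
    rewrite <- (Rpower_1 2) at 2 by lra. apply Rle_Rpower; lra. }
  pose proof (resonance zeta s T S G X Y' Hz ltac:(lra) HT3' HTX HS HzS HG1 HXG ND') as Res.
  fold Ks in Res. set (E := Ks * T * Rpower (INR X) (- s)) in *. set (err := G * (2 + ln (INR X)) * (4 * (1 + ln (1 + T)) / T)) in *.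
  assert (Res' : res_form s Y' <= 192 * (S + E) * res_norm Y' + res_sum Y' * res_sum Y' * err).
  { apply Res. intros q Hq. destruct (HY' q Hq) as (Z1 & Z2 & Z3). split; [exact Z1|]. split; [lra|exact Z3]. }
  clear Res.
  assert (HE : 768 * E <= / 4).
  { unfold E. apply Rle_trans with (768 * (Ks * Rpower T (- (s - 1 / 2)))).
    - apply Rmult_le_compat_l; [lra|]. rewrite Rmult_assoc. apply Rmult_le_compat_l; [exact HKs|].
      apply Rle_trans with (T * Rpower (Rpower T a0) (- s)).
      + apply Rmult_le_compat_l; [lra|]. apply Rpower_decr; [|lra]. split; [apply Rpower_pos|exact HX1].
      + rewrite Rpower_mult. rewrite <- (Rpower_1 T) at 1 by lra. rewrite <- Rpower_plus. right. f_equal. unfold a0. field. lra.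
    - rewrite Rpower_Ropp. pose proof (Rpower_pos T (s - 1 / 2)) as Tp.
      assert (3072 * Ks <= Rpower T (s - 1 / 2)) by (eapply Rle_trans; [|exact HL3]; simpl; nra).
      apply (Rmult_le_reg_r (Rpower T (s - 1 / 2))); [exact Tp|]. replace (768 * (Ks * / Rpower T (s - 1 / 2)) * Rpower T (s - 1 / 2)) with (768 * Ks) by (field; lra). lra. }
  assert (HE0 : 0 <= E).
  { unfold E. apply Rmult_le_pos; [apply Rmult_le_pos; lra|left; apply Rpower_pos]. }
  assert (Hln2 : ln 2 <= 1) by (rewrite <- (ln_exp 1); apply ln_le_ln; [lra|]; pose proof (exp_ineq1_le 1); lra).
  assert (HlX : 0 <= 2 + ln (INR X) <= 5 * (1 + ln T)).
  { assert (0 <= ln (INR X)) by (apply ln_nonneg; lra). split; [lra|].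
    assert (ln (INR X) <= ln (2 * Rpower T a0)) by (apply ln_le_ln; lra).
    rewrite ln_mult in H0 by (try apply Rpower_pos; lra). unfold Rpower in H0. rewrite ln_exp in H0. nra. }
  assert (HlT : 0 <= 1 + ln (1 + T) <= 2 * (1 + ln T)).
  { assert (0 <= ln (1 + T)) by (apply ln_nonneg; lra). split; [lra|].
    assert (ln (1 + T) <= ln (2 * T)) by (apply ln_le_ln; lra). rewrite ln_mult in H0 by lra. lra. }
  assert (Herr : 0 <= err <= 80 * (1 + ln T) ^ 2 * Rpower T (a0 * (1 - s) - 1)).
  { split.
    - unfold err. apply Rmult_le_pos; [apply Rmult_le_pos; lra|]. apply Rmult_le_pos; [lra|left; apply Rinv_0_lt_compat; lra].
    - unfold Rminus at 1. rewrite Rpower_plus, Rpower_Ropp, Rpower_1 by lra. unfold err, G.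
      replace (2 * Rpower T (a0 * (1 - s)) * (2 + ln (INR X)) * (4 * (1 + ln (1 + T)) / T)) with (8 * ((2 + ln (INR X)) * (1 + ln (1 + T))) * (Rpower T (a0 * (1 - s)) * / T)) by (unfold Rdiv; ring).
      apply Rmult_le_compat_r; [apply Rmult_le_pos; [lra|left; apply Rinv_0_lt_compat; lra]|].
      assert ((2 + ln (INR X)) * (1 + ln (1 + T)) <= 5 * (1 + ln T) * (2 * (1 + ln T))) by (apply Rmult_le_compat; lra). simpl. nra. }
  set (tau := Rpower T (2 * s - 1 + th)).
  assert (Htau : 0 < tau) by apply Rpower_pos.
  assert (H2m0 : 0 < 2 ^ m) by (apply pow_lt; lra).
  assert (Hsmall : 2 ^ m * (4 * tau * (D * D)) * err <= / 4).
  { apply Rle_trans with (Rpower T th * (4 * tau * (D * D)) * (80 * (1 + ln T) ^ 2 * Rpower T (a0 * (1 - s) - 1))).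
    - assert (0 <= 4 * tau * (D * D)) by nra. apply Rmult_le_compat; [apply Rmult_le_pos; lra|lra| |lra]. apply Rmult_le_compat_r; assumption.
    - replace (Rpower T th * (4 * tau * (D * D)) * (80 * (1 + ln T) ^ 2 * Rpower T (a0 * (1 - s) - 1)))
        with (320 * (1 + ln T) ^ 2 * (Rpower T th * tau * D * D * Rpower T (a0 * (1 - s) - 1))) by ring.
      unfold tau, D. rewrite <- !Rpower_plus.
      (* The four factors [T^th], from [2^m], the l1 bound and twice the divisor bound, spend half
         of [slack s]. *)
      replace (th + (2 * s - 1 + th) + th + th + (a0 * (1 - s) - 1)) with (- (kap / 2)) by (unfold a0, th, kap, slack; field; lra).
      rewrite Rpower_Ropp. pose proof (Rpower_pos T (kap / 2)) as Tp.
      apply (Rmult_le_reg_r (Rpower T (kap / 2))); [exact Tp|]. rewrite Rmult_assoc, Rinv_l by lra. lra. }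
  assert (Hsum : (Nb * L + Nc * Lb) * (Nb * L + Nc * Lb) <= 4 * tau * (D * D) * (B2 * W2)).
  { assert (HLL : L * L <= tau * B2) by exact HL1.
    assert (HLbb : Lb * Lb <= D * D * (tau * B2)).
    { apply Rle_trans with ((D * L) * (D * L)); [apply Rmult_le_compat; assumption|]. replace (D * L * (D * L)) with (D * D * (L * L)) by ring.
      apply Rmult_le_compat_l; [nra|exact HLL]. }
    assert (H1 : B2 * (L * L) <= B2 * (tau * (D * D * W2))).
    { apply Rmult_le_compat_l; [lra|]. eapply Rle_trans; [exact HLL|]. apply Rmult_le_compat_l; [lra|exact C2]. }
    assert (H2 : W2 * (Lb * Lb) <= W2 * (D * D * (tau * B2))) by (apply Rmult_le_compat_l; lra).
    pose proof (Rle_0_sqr (Nb * L - Nc * Lb)) as Q. unfold Rsqr in Q.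
    replace ((Nb * L + Nc * Lb) * (Nb * L + Nc * Lb)) with (2 * (Nb * Nb * (L * L)) + 2 * (Nc * Nc * (Lb * Lb)) - (Nb * L - Nc * Lb) * (Nb * L - Nc * Lb)) by ring.
    rewrite HNb, HNc. lra. }
  assert (Key : Gam * (Nc * Nb * B2) <= (768 * (S + E) + 2 ^ m * (4 * tau * (D * D)) * err) * (B2 * W2)).
  { apply (Rmult_le_reg_l (2 ^ m)); [exact H2m0|].
    apply Rle_trans with (res_form s Y').
    - eapply Rle_trans; [|exact E3]. rewrite (Rmult_assoc (2 ^ m) Gam). apply Rmult_le_compat_l; [lra|]. apply Rmult_le_compat_l; [lra|]. rewrite <- HNb. exact F1.
    - eapply Rle_trans; [exact Res'|]. rewrite E1, E2, F3.
      assert (Q1 : 192 * (S + E) * (2 ^ m * res_norm Y) <= 192 * (S + E) * (2 ^ m * (4 * (B2 * W2)))).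
      { apply Rmult_le_compat_l; [lra|]. apply Rmult_le_compat_l; [lra|]. rewrite <- HNb, <- HNc. exact F2. }
      assert (Q2 : 2 ^ m * (Nb * L + Nc * Lb) * (2 ^ m * (Nb * L + Nc * Lb)) * err <= 2 ^ m * 2 ^ m * (4 * tau * (D * D) * (B2 * W2)) * err).
      { apply Rmult_le_compat_r; [lra|]. replace (2 ^ m * (Nb * L + Nc * Lb) * (2 ^ m * (Nb * L + Nc * Lb))) with (2 ^ m * 2 ^ m * ((Nb * L + Nc * Lb) * (Nb * L + Nc * Lb))) by ring.
        apply Rmult_le_compat_l; [nra|exact Hsum]. }
      lra. }
  assert (Key2 : Gam * Nb <= (768 * S + / 2) * Nc).
  { apply (Rmult_le_reg_r (Nc * B2)); [nra|].
    replace (Gam * Nb * (Nc * B2)) with (Gam * (Nc * Nb * B2)) by ring. eapply Rle_trans; [exact Key|].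
    replace ((768 * S + / 2) * Nc * (Nc * B2)) with ((768 * S + / 2) * (B2 * W2)) by (rewrite <- HNc; ring).
    apply Rmult_le_compat_r; [nra|]. lra. }
  (* [768 = 4 * 192] came from the norm of the mixed resonator and Schur's test. The additive
     [/ 2 * Nc] is at most half of the left side, because [Nc <= Nb] and [1 <= Gam]. *)
  assert (Key3 : Gam * Nb <= 1536 * S * Nc) by nra.
  rewrite <- HNb, <- HNc.
  replace (Gam * Gam * (Nb * Nb)) with ((Gam * Nb) * (Gam * Nb)) by ring.
  replace (1536 * 1536 * (S * S) * (Nc * Nc)) with ((1536 * S * Nc) * (1536 * S * Nc)) by ring.
  apply Rmult_le_compat; try assumption; nra.
Qed.

(** * Amplification by a block of primes near sigma = 1/2 *)

Lemma inv_one_minus_half x : 0 <= x <= 1 / 2 -> / (1 - x) <= exp (2 * x).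
Proof.
  intro Hx. apply Rle_trans with (1 + 2 * x); [|apply exp_ineq1_le].
  apply (Rmult_le_reg_l (1 - x)); [lra|]. rewrite Rinv_r by lra. nra.
Qed.

Lemma lprod_block_bound (P : list nat) (Q a y : R) : 1 <= Q -> 0 <= a -> Rpower Q (- a) <= y -> y <= 1 / 2 ->
  (forall p, In p P -> Q <= INR p) ->
  lprod P (fun p => / (1 - Rpower (INR p) (- a))) <= exp (2 * y * INR (length P)).
Proof.
  intros HQ Ha Hy Hy2 HP. apply Rle_trans with (lprod P (fun _ => exp (2 * y))).
  - apply lprod_le. intros p Hp. pose proof (Rpower_decr Q (INR p) a ltac:(specialize (HP p Hp); lra) Ha) as H.
    pose proof (Rpower_pos (INR p) (- a)) as H0. split; [left; apply Rinv_0_lt_compat; lra|].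
    eapply Rle_trans; [apply inv_one_minus_half; lra|]. apply exp_le_exp. lra.
  - rewrite lprod_exp, lsum_const. apply exp_le_exp. lra.
Qed.

(** [tau] is chosen so that [Q^tau = 32]. With [q = Q^(-s)], the weight of a prime in the divisors
    of [n] grows to [32 q], but at most 1/1024 of the block divides [n]; over all smooth numbers it
    drops to [q / 32]. Both Euler products are at most [exp (mq / 16)], so a fibre costs
    [exp (mq / 8)], while the square of the amplification is at least [exp (mq / 4)]. *)
Lemma block_sums (s Q : R) (P : list nat) (N : R) : 1 / 2 < s -> 1 < Q -> NoDup P ->
  (forall p, In p P -> nprime p /\ Q < INR p <= 2 * Q) -> Rpower Q (- s) <= / 64 -> 1 <= N ->
  1024 * ln N <= INR (length P) * ln Q ->
  let tau := ln 32 / ln Q in let mq := INR (length P) * Rpower Q (- s) in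
  (forall n, (1 <= n)%nat -> INR n <= N -> psmooth P n -> lsum (divisors n) (wt (s - tau)) <= exp (mq / 16)) /\
  (forall D, NoDup D -> (forall d, In d D -> psmooth P d) -> lsum D (wt (s + tau)) <= exp (mq / 16)) /\
  (s <= 1 -> exp (mq / 8) <= lprod P (fun p => 1 + wt s p / 2)).
Proof.
  intros Hs HQ NP HP Hq HN HNQ tau mq.
  assert (HlQ : 0 < ln Q) by (rewrite <- ln_1; apply ln_increasing; lra).
  assert (Hl32 : 0 < ln 32) by (rewrite <- ln_1; apply ln_increasing; lra).
  assert (Htau : 0 < tau) by (now apply Rdiv_lt_0_compat).
  assert (HQt : Rpower Q tau = 32).
  { unfold Rpower, tau. replace (ln 32 / ln Q * ln Q) with (ln 32) by (field; lra). apply exp_ln. lra. }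
  set (q := Rpower Q (- s)) in *. assert (Hq0 : 0 < q) by apply Rpower_pos.
  assert (Em : Rpower Q (- (s - tau)) = 32 * q).
  { replace (- (s - tau)) with (tau + - s) by ring. rewrite Rpower_plus, HQt. reflexivity. }
  assert (Ep : Rpower Q (- (s + tau)) = q / 32).
  { replace (- (s + tau)) with (- s + - tau) by ring. rewrite Rpower_plus, (Rpower_Ropp _ tau), HQt. reflexivity. }
  assert (Hst : 0 < s - tau).
  { apply Rnot_le_lt. intro L. assert (1 <= Rpower Q (- (s - tau))); [|lra]. apply Rpower_ge_1; lra. }
  assert (Hge2 : forall l, incl l P -> forall p, In p l -> (2 <= p)%nat) by (intros l Hl p Hp; apply (HP p (Hl p Hp))).
  split; [|split].
  - intros n Hn HnN Hsm. set (Pn := filter (fun p => pbool (Nat.divide p n)) P).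
    assert (HPn : forall p, In p Pn <-> In p P /\ Nat.divide p n) by (intro p; apply (in_filter_pbool (fun p => Nat.divide p n))).
    eapply Rle_trans; [apply (euler_bound (s - tau) Pn)|].
    + exact Hst.
    + apply Hge2. intros p Hp. exact (proj1 (proj1 (HPn p) Hp)).
    + apply divisors_NoDup.
    + intros d Hd. apply in_divisors in Hd; [|exact Hn]. apply (psmooth_restrict P).
      * eapply psmooth_divide; [|exact Hsm|exact Hd]. intros; apply HP; assumption.
      * intros p Hp Hpd. apply HPn. split; [exact Hp|]. eapply Nat.divide_trans; eassumption.
    + eapply Rle_trans; [apply (lprod_block_bound Pn Q (s - tau) (32 * q))|].
      * lra.
      * lra.
      * rewrite Em. lra.
      * lra.
      * intros p Hp. apply HPn in Hp. left. apply HP, Hp.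
      * apply exp_le_exp.
        assert (HL : INR (length Pn) * ln Q <= ln N).
        { rewrite <- ln_pow by lra. apply ln_le_ln; [apply pow_lt; lra|]. eapply Rle_trans; [|exact HnN].
          apply (pow_length_le Pn n Q); [apply NoDup_filter, NP| |exact Hn|lra|].
          - intros p Hp. apply HPn in Hp. split; [apply HP, Hp|apply Hp].
          - intros p Hp. apply HPn in Hp. left. apply HP, Hp. }
        assert (HL2 : 1024 * INR (length Pn) <= INR (length P)).
        { apply (Rmult_le_reg_r (ln Q)); [exact HlQ|]. lra. }
        unfold mq. nra.
  - intros D ND HD. eapply Rle_trans; [apply (euler_bound (s + tau) P)|].
    + lra.
    + apply Hge2, incl_refl.
    + exact ND.
    + exact HD.
    + eapply Rle_trans; [apply (lprod_block_bound P Q (s + tau) (q / 32))|].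
      * lra.
      * lra.
      * rewrite Ep. lra.
      * lra.
      * intros p Hp. left. apply HP, Hp.
      * apply exp_le_exp. unfold mq. right. field.
  - intro Hs1. apply Rle_trans with (lprod P (fun _ => exp (q / 8))).
    + rewrite lprod_exp, lsum_const. apply exp_le_exp. unfold mq. right. field.
    + apply lprod_le. intros p Hp. split; [left; apply exp_pos|].
      assert (Hw : q / 2 <= wt s p).
      { apply Rle_trans with (Rpower (2 * Q) (- s)).
        - rewrite <- Rpower_mult_distr by lra. fold q. unfold Rdiv. rewrite (Rmult_comm q). apply Rmult_le_compat_r; [lra|].
          rewrite <- (Rpower_1 2) at 1 by lra. rewrite <- Rpower_Ropp. apply Rle_Rpower; lra.
        - destruct (HP p Hp) as [_ H]. apply Rpower_decr; lra. }
      apply Rle_trans with (1 + q / 4); [|lra].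
      eapply Rle_trans; [|apply exp_le_one_plus; lra]. apply exp_le_exp. nra.
Qed.

(** Passing from [m] to [m + 1] multiplies [m ln m] by at most 4, so the last [m] before [4 m ln m]
    exceeds [L] is within this factor. *)
Lemma choose_block_size (m1 : nat) (L : R) : (3 <= m1)%nat -> 4 * INR m1 * ln (INR m1) <= L ->
  exists m, (m1 <= m)%nat /\ 4 * INR m * ln (INR m) <= L /\ L <= 16 * INR m * ln (INR m).
Proof.
  intros Hm1 H1. apply NNPP. intro Hno.
  assert (G : forall m, (m1 <= m)%nat -> 4 * INR m * ln (INR m) <= L).
  { induction 1 as [|m Hm IH]; [exact H1|]. apply Rnot_lt_le. intro HL. apply Hno. exists m. split; [exact Hm|]. split; [exact IH|].
    left. eapply Rlt_le_trans; [exact HL|].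
    assert (Hm3 : 3 <= INR m) by (replace 3 with (INR 3) by (simpl; ring); apply le_INR; lia).
    assert (0 <= ln (INR m)) by (apply ln_nonneg; lra).
    rewrite S_INR. assert (0 <= ln (INR m + 1)) by (apply ln_nonneg; lra).
    assert (ln (INR m + 1) <= 2 * ln (INR m)).
    { replace (2 * ln (INR m)) with (ln (INR m) + ln (INR m)) by ring. rewrite <- ln_mult by lra. apply ln_le_ln; nra. }
    apply Rle_trans with (4 * (2 * INR m) * (2 * ln (INR m))); [|lra]. apply Rmult_le_compat; lra. }
  destruct (nfloor_ex (Rmax L 0)) as [N [_ HN]]; [apply Rmax_r|].
  set (m := (m1 + S N)%nat). specialize (G m ltac:(unfold m; lia)).
  assert (HmN : L < INR m).
  { unfold m. rewrite plus_INR, S_INR. pose proof (pos_INR m1). pose proof (Rmax_l L 0). lra. }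
  assert (Hm3 : 3 <= INR m) by (replace 3 with (INR 3) by (simpl; ring); apply le_INR; unfold m; lia).
  assert (1 <= ln (INR m)). { rewrite <- (ln_exp 1). apply ln_le_ln; [apply exp_pos|]. pose proof exp_le_3. lra. }
  nra.
Qed.

(** [16384 = 1024 * 16]: with [ln T <= 16 m ln m] the hypothesis [1024 ln N <= m ln Q] of
    [block_sums] holds for [N = T^width]. *)
Definition width : R := / 16384.

(* A negligible error term forces the mass of [K] onto [n <= T^width]. One fibre
   over a block of primes is then amplified by that block, and the gain
   [exp (m Q^(-s) / 8)] tends to infinity with [T], so it absorbs [zeta(2 s)],
   which is unbounded as [s] decreases to 1/2. *)
Lemma strip_near_half (zeta : C -> C) (s Z : R) : is_riemann_zeta zeta -> 1 / 2 < s < 1 / 2 + width / 16 -> 0 <= Z ->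
  exists T0, 3 <= T0 /\ forall T S K e, T0 <= T -> zeta_bound zeta s T S -> pos_set K -> (forall n, In n K -> INR n <= T) -> 0 <= e <= s ->
    lsum K (wt e) * lsum K (fun k => Rpower (INR k) (1 - s) * wt e k) <= Z * Rpower T (2 * s - 1) * sqsum K (conv s e) ->
    Z * sqsum K (conv s e) <= 8 * (1536 * 1536) * (S * S) * sqsum K (wt e).
Proof.
  intros Hz Hs HZ. assert (Hwd : width = / 16384) by reflexivity.
  assert (Hs1 : 1 / 2 < s < 1) by lra. pose proof (slack_pos s Hs1) as Hsl. set (th := slack s / 8).
  assert (Hth : 0 < th) by (unfold th; lra).
  destruct (amplified_resonance zeta s Hz Hs1) as (T1 & HT1 & HR).
  destruct (divisor_count_uniform (width / 64) ltac:(lra)) as (T2 & HT2 & HD).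
  destruct (log_square_small (width / 16) (2 * Z) ltac:(lra) ltac:(lra)) as (T3 & HT3 & HL3).
  destruct (log_square_small (th / 2) (16 * Z) ltac:(lra) ltac:(lra)) as (T4 & HT4 & HL4).
  (* Lower bounds for [m]: [(1 + 8 Z)^10] forces [m Q^(-s) >= m^(1/10) >= 8 Z], and [exp (1 / th)]
     forces [m <= th / 4 * ln T], so that [exp (2 m)] is at most [T^(th / 2)]. *)
  destruct (nfloor_ex (Rpower (1 + 8 * Z) 10 + exp (1 / th))) as [mz [_ Hmz]].
  { pose proof (Rpower_pos (1 + 8 * Z) 10). pose proof (exp_pos (1 / th)). lra. }
  set (m1 := (4 ^ 9 + S mz)%nat).
  exists (Rmax (Rmax T1 T2) (Rmax (Rmax T3 T4) (exp (4 * INR m1 * ln (INR m1))))).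
  split; [eapply Rle_trans; [exact HT1|]; eapply Rle_trans; [apply Rmax_l|apply Rmax_l]|].
  intros T S K e HT HzS HK HKT He HRHS.
  assert (HTa : T1 <= T) by (eapply Rle_trans; [|exact HT]; eapply Rle_trans; [apply Rmax_l|apply Rmax_l]).
  assert (HTb : T2 <= T) by (eapply Rle_trans; [|exact HT]; eapply Rle_trans; [apply Rmax_r|apply Rmax_l]).
  assert (HTc : T3 <= T) by (eapply Rle_trans; [|exact HT]; eapply Rle_trans; [|apply Rmax_r]; eapply Rle_trans; [apply Rmax_l|apply Rmax_l]).
  assert (HTd : T4 <= T) by (eapply Rle_trans; [|exact HT]; eapply Rle_trans; [|apply Rmax_r]; eapply Rle_trans; [apply Rmax_r|apply Rmax_l]).
  assert (HTe : exp (4 * INR m1 * ln (INR m1)) <= T) by (eapply Rle_trans; [|exact HT]; eapply Rle_trans; [apply Rmax_r|apply Rmax_r]).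
  specialize (HL3 T HTc). specialize (HL4 T HTd). clear HT.
  assert (HT3' : 3 <= T) by lra. assert (Hl0 : 0 <= ln T) by (apply ln_nonneg; lra).
  destruct HK as (NK & PK & FK & K1).
  assert (Hm1 : (4 ^ 9 <= m1)%nat) by (unfold m1; apply Nat.le_add_r).
  assert (Hm13 : (3 <= m1)%nat) by (eapply Nat.le_trans; [|exact Hm1]; apply Nat.leb_le; reflexivity).
  destruct (choose_block_size m1 (ln T) Hm13) as (m & Hm & HmT1 & HmT2).
  { rewrite <- (ln_exp (4 * INR m1 * ln (INR m1))). apply ln_le_ln; [apply exp_pos|exact HTe]. }
  destruct (prime_block m (Nat.le_trans _ _ _ Hm1 Hm)) as (Qn & P & HQ1 & HQ2 & NP & HPm & HP).
  set (Q := INR Qn).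
  assert (HmR : 4096 <= INR m).
  { replace 4096 with (INR (4 ^ 6)) by (rewrite pow_INR; simpl; ring). apply le_INR.
    eapply Nat.le_trans; [|exact Hm]. eapply Nat.le_trans; [|exact Hm1]. apply Nat.pow_le_mono_r; [discriminate|lia]. }
  assert (HmQ : INR m <= Q) by (apply le_INR, HQ1).
  assert (HQm : Q * Q <= INR m * (INR m * INR m)) by (unfold Q; rewrite <- !mult_INR; apply le_INR, HQ2).
  assert (HPQ : forall p, In p P -> nprime p /\ Q < INR p <= 2 * Q).
  { intros p Hp. destruct (HP p Hp) as [Pp [Hp1 Hp2]]. split; [exact Pp|]. split; [apply lt_INR, Hp1|].
    apply le_INR in Hp2. rewrite mult_INR in Hp2. exact Hp2. }
  assert (HmZ : Rpower (1 + 8 * Z) 10 + exp (1 / th) <= INR m).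
  { apply Rle_trans with (INR m1); [|apply le_INR, Hm]. unfold m1. rewrite plus_INR, S_INR. pose proof (pos_INR (4 ^ 9)). lra. }
  clearbody m1. clear Hm1 HTe Hmz mz Hm13 Hm HP.
  assert (Hlnm : 0 < ln (INR m)) by (rewrite <- ln_1; apply ln_increasing; lra).
  set (q := Rpower Q (- s)).
  assert (Hq0 : 0 < q) by apply Rpower_pos.
  assert (Hqle : q <= / 64).
  { apply Rle_trans with (Rpower 4096 (- (1 / 2))).
    - apply Rle_trans with (Rpower Q (- (1 / 2))); [apply Rle_Rpower; lra|apply Rpower_decr; lra].
    - rewrite Rpower_Ropp. apply Rinv_le_contravar; [lra|]. replace (1 / 2) with (/ 2) by field. rewrite Rpower_sqrt by lra.
      rewrite <- (sqrt_square 64) at 1 by lra. apply sqrt_le_1_alt. lra. }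
  assert (Hmq : 8 * Z <= INR m * q).
  { apply Rle_trans with (Rpower (INR m) (1 / 10)).
    - apply Rle_trans with (Rpower (Rpower (1 + 8 * Z) 10) (1 / 10)).
      + rewrite Rpower_mult. replace (10 * (1 / 10)) with 1 by field. rewrite Rpower_1 by lra. lra.
      + apply Rle_Rpower_l; [lra|]. split; [apply Rpower_pos|]. pose proof (exp_pos (1 / th)). lra.
    - assert (HQ32 : Q <= Rpower (INR m) (3 / 2)).
      { apply Rsqr_incr_0_var; [|left; apply Rpower_pos]. unfold Rsqr. rewrite <- Rpower_plus.
        replace (3 / 2 + 3 / 2) with (INR 3) by (simpl; field). rewrite Rpower_pow by lra. simpl. lra. }
      assert (Rpower (Rpower (INR m) (3 / 2)) (- s) <= q) by (apply Rpower_decr; lra).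
      apply Rle_trans with (INR m * Rpower (Rpower (INR m) (3 / 2)) (- s)); [|apply Rmult_le_compat_l; lra].
      rewrite Rpower_mult. rewrite <- (Rpower_1 (INR m)) at 2 by lra. rewrite <- Rpower_plus. apply Rle_Rpower; lra. }
  assert (HmT : INR m <= th / 4 * ln T).
  { assert (1 / th <= ln (INR m)).
    { rewrite <- (ln_exp (1 / th)). apply ln_le_ln; [apply exp_pos|]. pose proof (Rpower_pos (1 + 8 * Z) 10). lra. }
    assert (1 <= th * ln (INR m)) by (apply (Rmult_le_compat_l th) in H; [|lra]; replace (th * (1 / th)) with 1 in H by (field; lra); exact H).
    nra. }
  assert (HmTexp : forall c, 0 <= c <= 2 -> exp (c * INR m) <= Rpower T (th / 2)) by (intros c Hc; unfold Rpower; apply exp_le_exp; pose proof (pos_INR m); nra).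
  set (N := Rpower T width). assert (HN1 : 1 <= N) by (apply Rpower_ge_1; lra).
  assert (HlnN : ln N = width * ln T) by (unfold N, Rpower; apply ln_exp).
  destruct (block_sums s Q P N ltac:(lra) ltac:(lra) NP HPQ Hqle HN1) as (B1 & B2 & B3).
  { rewrite HlnN, HPm, Hwd. assert (ln (INR m) <= ln Q) by (apply ln_le_ln; lra).
    apply Rle_trans with (INR m * ln (INR m)); [lra|]. apply Rmult_le_compat_l; lra. }
  rewrite HPm in B1, B2, B3. fold q in B1, B2, B3. set (tau := ln 32 / ln Q) in *. set (mq := INR m * q) in *.
  set (K' := filter (fun n => pbool (INR n <= N)) K).
  assert (HK' : forall n, In n K' <-> In n K /\ INR n <= N) by (intro n; apply (in_filter_pbool (fun n => INR n <= N))).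
  assert (NK' : NoDup K') by now apply NoDup_filter.
  assert (PK' : forall n, In n K' -> (1 <= n)%nat) by (intros n Hn; apply PK, HK', Hn).
  assert (FK' : factor_closed K').
  { intros d n Hd Hn. apply HK' in Hn. destruct Hn as [Hn1 Hn2]. apply HK'. split; [exact (FK d n Hd Hn1)|].
    eapply Rle_trans; [|exact Hn2]. apply le_INR. apply (divide_pos d n (PK n Hn1) Hd). }
  assert (K1' : In 1%nat K') by (apply HK'; split; [exact K1|exact HN1]).
  set (V := sqsum K (conv s e)) in *. set (W := sqsum K (wt e)) in *. set (L := lsum K (wt e)) in *.
  set (V' := sqsum K' (conv s e)).
  assert (HL1 : 1 <= L).
  { unfold L. rewrite <- (wt_1 e). apply (lsum_single_le K (wt e) 1%nat K1). intros; left; apply wt_pos. }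
  assert (HV1 : 1 <= V).
  { apply Rle_trans with (conv s e 1 * conv s e 1).
    - pose proof (conv_ge_wt s e 1 (le_n 1)) as X. rewrite wt_1 in X. nra.
    - apply (lsum_single_le K (fun n => conv s e n * conv s e n) 1%nat K1). intros; apply Rle_0_sqr. }
  set (D := Rpower T (width / 64)) in *. assert (HD1 : 1 <= D) by (apply Rpower_ge_1; lra).
  assert (HDK : forall n, In n K -> (1 <= n)%nat /\ INR (length (divisors n)) <= D) by (intros n Hn; split; [auto|apply HD; auto]).
  destruct (lsum_conv_le s e K D He HDK) as [_ CV]. fold V in CV. fold W in CV.
  assert (HWL : W <= L).
  { apply lsum_le. intros n Hn. pose proof (wt_pos e n). pose proof (wt_le_1 e n (proj1 He) (PK n Hn)). nra. }
  assert (HT21 : 0 < Rpower T (2 * s - 1)) by apply Rpower_pos.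
  (* [HRHS] bounds the l1 mass beyond [N]: there [k^(1-s)] is at least [N^(1-s)], about
     [T^(width / 2)], which outweighs [T^(2s - 1)] and the divisor bounds because
     [2s - 1 < width / 8]. The l2 mass of [conv] beyond [N] is then at most 1/2, hence at most half
     of [V]. *)
  assert (HVV : V <= 2 * V').
  { set (K'' := filter (fun n => negb (pbool (INR n <= N))) K).
    assert (HK'' : forall n, In n K'' -> In n K /\ N <= INR n).
    { intros n Hn. apply filter_In in Hn. destruct Hn as [Hn1 Hn2]. split; [exact Hn1|]. apply Bool.negb_true_iff in Hn2.
      left. apply Rnot_le_lt. intro X. apply (proj2 (pbool_true _)) in X. congruence. }
    assert (ES : V = V' + sqsum K'' (conv s e)).
    { unfold V, V', K', K'', sqsum. rewrite !lsum_filter, <- lsum_plus. apply lsum_ext; intros n _. destruct (pbool (INR n <= N)); simpl; ring. }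
    destruct (lsum_conv_le s e K'' D He ltac:(intros n Hn; apply HDK, HK'', Hn)) as [_ CV'].
    set (l'' := lsum K'' (wt e)).
    assert (Hl'' : 0 <= l'') by (apply lsum_nonneg; intros; left; apply wt_pos).
    assert (HW'' : sqsum K'' (wt e) <= l'').
    { apply lsum_le. intros n Hn. pose proof (wt_pos e n). pose proof (wt_le_1 e n (proj1 He) (PK n (proj1 (HK'' n Hn)))). nra. }
    assert (G1 : Rpower N (1 - s) * l'' <= lsum K (fun k => Rpower (INR k) (1 - s) * wt e k)).
    { apply Rle_trans with (lsum K'' (fun k => Rpower (INR k) (1 - s) * wt e k)).
      - unfold l''. rewrite <- lsum_scal. apply lsum_le. intros n Hn. apply Rmult_le_compat_r; [left; apply wt_pos|].
        apply Rle_Rpower_l; [lra|]. destruct (HK'' n Hn). lra.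
      - apply lsum_incl; [now apply NoDup_filter| |intros; apply Rmult_le_pos; left; [apply Rpower_pos|apply wt_pos]].
        intros n Hn. apply HK'', Hn. }
    assert (G2 : Rpower N (1 - s) * l'' <= Z * Rpower T (2 * s - 1) * (D * D)).
    { apply (Rmult_le_reg_l L); [lra|]. apply Rle_trans with (Z * Rpower T (2 * s - 1) * V).
      - eapply Rle_trans; [|exact HRHS]. apply Rmult_le_compat_l; lra.
      - replace (L * (Z * Rpower T (2 * s - 1) * (D * D))) with (Z * Rpower T (2 * s - 1) * (D * D * L)) by ring.
        apply Rmult_le_compat_l; [apply Rmult_le_pos; lra|]. eapply Rle_trans; [exact CV|]. apply Rmult_le_compat_l; [nra|exact HWL]. }
    assert (G3 : D * D * l'' <= / 2).
    { pose proof (Rpower_pos N (1 - s)) as HNp. apply (Rmult_le_reg_l (Rpower N (1 - s))); [exact HNp|].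
      apply Rle_trans with (Z * (Rpower T (2 * s - 1) * D * D * D * D)).
      - replace (Rpower N (1 - s) * (D * D * l'')) with (D * D * (Rpower N (1 - s) * l'')) by ring.
        replace (Z * (Rpower T (2 * s - 1) * D * D * D * D)) with (D * D * (Z * Rpower T (2 * s - 1) * (D * D))) by ring.
        apply Rmult_le_compat_l; [nra|exact G2].
      - unfold D, N. rewrite Rpower_mult, <- !Rpower_plus.
        assert (HZT : 2 * Z <= Rpower T (width / 16)) by (eapply Rle_trans; [|exact HL3]; simpl; nra).
        set (ex := 2 * s - 1 + width / 64 + width / 64 + width / 64 + width / 64).
        apply Rle_trans with (/ 2 * (Rpower T (width / 16) * Rpower T ex)).
        + pose proof (Rpower_pos T ex). nra.
        + rewrite <- Rpower_plus, (Rmult_comm _ (/ 2)). apply Rmult_le_compat_l; [lra|]. apply Rle_Rpower; [lra|]. unfold ex. rewrite Hwd in *. lra. }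
    assert (sqsum K'' (conv s e) <= / 2).
    { eapply Rle_trans; [exact CV'|]. eapply Rle_trans; [|exact G3]. apply Rmult_le_compat_l; [nra|exact HW'']. }
    lra. }
  assert (HV'0 : 0 < V') by lra.
  set (Sp := exp (mq / 16)) in *. assert (HSp : 0 < Sp) by apply exp_pos.
  destruct (fibre_selection s e tau Sp Sp P K' (fun p Hp => proj1 (HPQ p Hp)) NK' PK' FK' K1' HSp HSp) as (A & NA & IA & FA & A1 & PA & Eq1 & Eq2).
  { intros n Hn Hsm. apply B1; [auto|apply HK', Hn|exact Hsm]. }
  { apply B2; [now apply NoDup_filter|]. intros d Hd. apply in_filter_pbool in Hd. apply Hd. }
  fold V' in Eq1, Eq2.
  assert (ESp : Sp * Sp = exp (mq / 8)) by (unfold Sp; rewrite <- exp_plus; f_equal; field).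
  rewrite ESp in Eq1, Eq2. set (S8 := exp (mq / 8)) in *.
  assert (Hmq0 : 0 <= mq) by (apply Rmult_le_pos; [apply pos_INR|lra]).
  assert (HS8 : 1 <= S8) by (unfold S8; rewrite <- exp_0; apply exp_le_exp; lra).
  assert (HS8Z : Z <= S8) by (unfold S8; pose proof (exp_ineq1_le (mq / 8)); lra).
  set (WA := sqsum A (wt e)) in *. set (VA := sqsum A (conv s e)) in *. set (LA := lsum A (wt e)) in *.
  set (W' := sqsum K' (wt e)) in *. set (L' := lsum K' (wt e)) in *.
  assert (HL'L : 0 <= L' <= L).
  { split; [apply lsum_nonneg; intros; left; apply wt_pos|]. apply lsum_incl; [exact NK'|intros n Hn; apply HK', Hn|intros; left; apply wt_pos]. }
  assert (HW'W : W' <= W).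
  { apply lsum_incl; [exact NK'|intros n Hn; apply HK', Hn|intros; apply Rle_0_sqr]. }
  assert (HVA : 0 <= VA) by apply sqsum_nonneg.
  assert (HWA : 1 <= WA).
  { unfold WA, sqsum. pose proof (lsum_single_le A (fun n => wt e n * wt e n) 1%nat A1) as X. cbv beta in X. rewrite wt_1, Rmult_1_r in X.
    apply X. intros; apply Rle_0_sqr. }
  assert (HLL : L * L <= Z * Rpower T (2 * s - 1) * V).
  { eapply Rle_trans; [|exact HRHS]. apply Rmult_le_compat_l; [lra|]. apply lsum_le. intros n Hn.
    rewrite <- (Rmult_1_l (wt e n)) at 1. apply Rmult_le_compat_r; [left; apply wt_pos|]. apply Rpower_ge_1; [apply INR_pos_ge1; auto|lra]. }
  (* The amplified resonator has indices up to [N (2Q)^m], at most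
     [T^width m^(2m) <= T^(width + 1/2)] by [4 m ln m <= ln T]. *)
  assert (Hamp : lprod P (fun p => 1 + wt s p / 2) * lprod P (fun p => 1 + wt s p / 2) * VA <= 1536 * 1536 * (S * S) * WA).
  { apply (HR T S A P e N (2 * Q)); try assumption.
    - split; [exact NA|]. split; [intros n Hn; apply PK', IA, Hn|]. split; assumption.
    - intros p Hp. split; [apply HPQ, Hp|apply HPQ, Hp].
    - intros a Ha. split; [auto|]. apply HK', IA, Ha.
    - lra.
    - lra.
    - rewrite HPm.
      assert (H2Q : 2 * Q <= INR m * INR m).
      { apply Rsqr_incr_0_var; [|nra]. unfold Rsqr. assert (4 * (INR m * (INR m * INR m)) <= INR m * INR m * (INR m * INR m)); [|lra].
        assert (0 <= INR m * (INR m * INR m)) by nra. nra. }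
      apply Rle_trans with (N * (INR m * INR m) ^ m).
      + apply Rmult_le_compat_l; [lra|]. apply pow_incr. lra.
      + rewrite <- (exp_ln ((INR m * INR m) ^ m)) by (apply pow_lt; nra). rewrite ln_pow by nra. rewrite ln_mult by lra.
        unfold N, Rpower. rewrite <- exp_plus. rewrite <- (exp_ln T) at 2 by lra. apply exp_le_exp. rewrite Hwd. lra.
    - rewrite HPm. fold th. apply Rle_trans with (exp (1 * INR m)).
      + apply Rle_trans with (exp 1 ^ m); [apply pow_incr; pose proof (exp_ineq1_le 1); lra|].
        rewrite <- Rpower_pow by apply exp_pos. unfold Rpower. rewrite ln_exp. apply exp_le_exp. lra.
      + eapply Rle_trans; [apply HmTexp; lra|]. apply Rle_Rpower; lra.
    (* The l1 bound passes to the fibre with the loss [8 Z S8], which is at most [T^th]. *)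
    - fold th. fold LA VA.
      assert (HS8T : S8 <= Rpower T (th / 2)).
      { eapply Rle_trans; [|apply (HmTexp 1); lra]. apply exp_le_exp. unfold mq. pose proof (pos_INR m). nra. }
      assert (HZT : 16 * Z <= Rpower T (th / 2)) by (eapply Rle_trans; [|exact HL4]; simpl; nra).
      apply (Rmult_le_reg_l V'); [exact HV'0|]. eapply Rle_trans; [exact Eq2|].
      apply Rle_trans with (4 * S8 * (L * L) * VA).
      { apply Rmult_le_compat_r; [exact HVA|]. apply Rmult_le_compat_l; [lra|]. apply Rmult_le_compat; lra. }
      apply Rle_trans with (4 * S8 * (Z * Rpower T (2 * s - 1) * (2 * V')) * VA).
      { apply Rmult_le_compat_r; [exact HVA|]. apply Rmult_le_compat_l; [lra|]. eapply Rle_trans; [exact HLL|].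
        apply Rmult_le_compat_l; [apply Rmult_le_pos; lra|exact HVV]. }
      replace (2 * s - 1 + th) with (2 * s - 1 + (th / 2 + th / 2)) by field. rewrite (Rpower_plus _ _ T), (Rpower_plus (th / 2)).
      assert (X : 8 * Z * S8 <= Rpower T (th / 2) * Rpower T (th / 2)) by (apply Rmult_le_compat; lra).
      replace (4 * S8 * (Z * Rpower T (2 * s - 1) * (2 * V')) * VA) with ((8 * Z * S8) * (Rpower T (2 * s - 1) * V' * VA)) by ring.
      replace (V' * (Rpower T (2 * s - 1) * (Rpower T (th / 2) * Rpower T (th / 2)) * VA)) with ((Rpower T (th / 2) * Rpower T (th / 2)) * (Rpower T (2 * s - 1) * V' * VA)) by ring.
      apply Rmult_le_compat_r; [|exact X]. repeat apply Rmult_le_pos; lra. }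
  specialize (B3 ltac:(lra)).
  set (Gam := lprod P (fun p => 1 + wt s p / 2)) in *.
  assert (HGG : S8 * S8 <= Gam * Gam) by (apply Rmult_le_compat; lra).
  (* The gain [Gam^2 >= S8^2] stands against the loss [4 S8] of the fibre; a factor [S8 >= Z]
     survives. *)
  assert (Hfin : S8 * S8 * V' * WA <= 4 * S8 * W' * (1536 * 1536 * (S * S)) * WA).
  { replace (S8 * S8 * V' * WA) with (S8 * S8 * (V' * WA)) by ring.
    apply Rle_trans with (S8 * S8 * (4 * S8 * W' * VA)); [apply Rmult_le_compat_l; [nra|exact Eq1]|].
    replace (S8 * S8 * (4 * S8 * W' * VA)) with (4 * S8 * W' * (S8 * S8 * VA)) by ring.
    replace (4 * S8 * W' * (1536 * 1536 * (S * S)) * WA) with (4 * S8 * W' * (1536 * 1536 * (S * S) * WA)) by ring.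
    assert (0 <= W') by apply sqsum_nonneg.
    apply Rmult_le_compat_l; [apply Rmult_le_pos; lra|]. eapply Rle_trans; [|exact Hamp]. apply Rmult_le_compat_r; assumption. }
  assert (Hfin2 : S8 * V' <= 4 * W' * (1536 * 1536 * (S * S))).
  { apply (Rmult_le_reg_r (S8 * WA)); [nra|]. 
    replace (S8 * V' * (S8 * WA)) with (S8 * S8 * V' * WA) by ring. eapply Rle_trans; [exact Hfin|]. right. ring. }
  assert (HSS : 0 <= S * S) by (destruct HzS; nra).
  apply Rle_trans with (2 * (S8 * V')).
  - apply Rle_trans with (S8 * V); [apply Rmult_le_compat_r; lra|]. replace (2 * (S8 * V')) with (S8 * (2 * V')) by ring. apply Rmult_le_compat_l; lra.
  - apply Rle_trans with (2 * (4 * W' * (1536 * 1536 * (S * S)))); [lra|].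
    replace (8 * (1536 * 1536) * (S * S) * W) with (2 * (4 * W * (1536 * 1536 * (S * S)))) by ring.
    apply Rmult_le_compat_l; [lra|]. apply Rmult_le_compat_r; lra.
Qed.

(** Resonance with an empty block. [Z] remains on both sides; it is applied where sigma is far
    enough from 1/2 for [Z] to have an absolute bound. *)
Lemma strip_away (zeta : C -> C) (s Z : R) : is_riemann_zeta zeta -> 1 / 2 < s < 1 -> 0 <= Z ->
  exists T0, 3 <= T0 /\ forall T S K e, T0 <= T -> zeta_bound zeta s T S -> pos_set K -> (forall n, In n K -> INR n <= T) -> 0 <= e <= s ->
    lsum K (wt e) * lsum K (fun k => Rpower (INR k) (1 - s) * wt e k) <= Z * Rpower T (2 * s - 1) * sqsum K (conv s e) ->
    Z * sqsum K (conv s e) <= Z * (1536 * 1536) * (S * S) * sqsum K (wt e).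
Proof.
  intros Hz Hs HZ. pose proof (slack_pos s Hs) as Hsl.
  destruct (amplified_resonance zeta s Hz Hs) as (T1 & HT1 & HR).
  destruct (log_square_small (slack s / 8) Z ltac:(lra) HZ) as (T2 & HT2 & HL).
  exists (Rmax T1 T2). split; [eapply Rle_trans; [exact HT1|apply Rmax_l]|].
  intros T S K e HT HzS HK HKT He HRHS.
  assert (HTa : T1 <= T) by (eapply Rle_trans; [apply Rmax_l|exact HT]).
  assert (HTb : T2 <= T) by (eapply Rle_trans; [apply Rmax_r|exact HT]).
  specialize (HL T HTb). assert (Hl0 : 0 <= ln T) by (apply ln_nonneg; lra).
  assert (HZT : Z <= Rpower T (slack s / 8)) by (eapply Rle_trans; [|exact HL]; simpl; nra).
  replace (Z * (1536 * 1536) * (S * S) * sqsum K (wt e)) with (Z * (1536 * 1536 * (S * S) * sqsum K (wt e))) by ring.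
  apply Rmult_le_compat_l; [exact HZ|].
  destruct HK as (NK & PK & FK & K1).
  pose proof (HR T S K [] e T 1 HTa HzS (conj NK (conj PK (conj FK K1))) He) as H.
  change (lprod [] (fun p : nat => 1 + wt s p / 2)) with 1 in H. rewrite !Rmult_1_l in H. apply H.
  - constructor.
  - easy.
  - intros a Ha. split; [easy|auto].
  - lra.
  - lra.
  - simpl. lra.
  - simpl. apply Rpower_ge_1; lra.
  - rewrite Rpower_plus.
    assert (HT21 : 0 < Rpower T (2 * s - 1)) by apply Rpower_pos.
    apply Rle_trans with (Z * Rpower T (2 * s - 1) * sqsum K (conv s e)).
    + eapply Rle_trans; [|exact HRHS]. apply Rmult_le_compat_l; [apply lsum_nonneg; intros; left; apply wt_pos|].
      apply lsum_le. intros n Hn. rewrite <- (Rmult_1_l (wt e n)) at 1. apply Rmult_le_compat_r; [left; apply wt_pos|].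
      apply Rpower_ge_1; [apply INR_pos_ge1; auto|lra].
    + apply Rmult_le_compat_r; [apply sqsum_nonneg|]. rewrite (Rmult_comm Z). apply Rmult_le_compat_l; lra.
Qed.

(** * The three ranges of sigma put together *)

Lemma zeta_real_bounds (zeta : C -> C) (u : R) : is_riemann_zeta zeta -> 1 < u ->
  0 <= fst (zeta (RtoC u)) <= 1 + / (u - 1).
Proof.
  intros Hz Hu. destruct (zeta_series_parts zeta u 0 Hz Hu) as [H _]. change (u, 0) with (RtoC u) in H.
  assert (H' : is_series (fun n => Rpower (INR (S n)) (- (1 + (u - 1)))) (fst (zeta (RtoC u)))).
  { eapply is_series_ext; [|exact H]. intro n. cbv beta. rewrite Rmult_0_l, cos_0, Rmult_1_r. f_equal. ring. }
  rewrite <- (is_series_unique _ _ H'). split.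
  - rewrite (is_series_unique _ _ H'). apply Rle_trans with (sum_n (fun n => Rpower (INR (S n)) (- (1 + (u - 1)))) 0).
    + rewrite sum_O. left; apply Rpower_pos.
    + apply sum_n_le_series; [intro; left; apply Rpower_pos|exact H'].
  - apply Series_le_bound; [intro; left; apply Rpower_pos|]. intro N.
    pose proof (sum_Rpower_tail (u - 1) 1 ltac:(lra) (le_n 1) N) as X. change (INR 1) with 1 in X.
    rewrite !Rpower_1_l in X. unfold Rdiv in X. rewrite Rmult_1_l in X. exact X.
Qed.

(** The gcd is at least 1, so a large ratio forces a large [T]. For empty [K] the maximum has the
    default value 0, excluded by [0 < c]. *)
Lemma max_ratio_bound (K : list nat) (c T : R) : (forall k, In k K -> (0 < k)%nat) -> 0 < c -> c <= max_ratio K ->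
  INR (list_max K) <= T -> c <= T /\ exists k, In k K.
Proof.
  intros Hpos Hc Hr HT.
  set (l := map (fun p : nat * nat => INR (Nat.max (fst p) (snd p)) / INR (Nat.gcd (fst p) (snd p))) (list_prod K K)) in *.
  change (c <= RList.MaxRlist l) in Hr.
  destruct K as [|k0 K0]; [simpl in Hr; unfold l in Hr; simpl in Hr; lra|]. set (K := k0 :: K0) in *.
  split; [|exists k0; now left].
  assert (Hin : In (RList.MaxRlist l) l).
  { apply RList.MaxRlist_P2. eexists. apply in_map. apply (in_prod K K k0 k0); now left. }
  apply in_map_iff in Hin. destruct Hin as ([a b] & E & Hab). apply in_prod_iff in Hab. destruct Hab as [Ha Hb].
  cbn [fst snd] in E. rewrite <- E in Hr.
  pose proof (proj1 (list_max_le K (list_max K)) (le_n _)) as LM. rewrite Forall_forall in LM.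
  pose proof (LM a Ha). pose proof (LM b Hb). pose proof (Hpos a Ha).
  assert (Hg : (1 <= Nat.gcd a b)%nat).
  { destruct (Nat.gcd a b) eqn:G; [apply Nat.gcd_eq_0 in G; lia|lia]. }
  apply INR_pos_ge1 in Hg.
  assert (Hm : INR (Nat.max a b) <= T) by (eapply Rle_trans; [apply le_INR; apply Nat.max_lub; eassumption|exact HT]).
  eapply Rle_trans; [exact Hr|]. eapply Rle_trans; [|exact Hm].
  rewrite <- (Rmult_1_r (INR (Nat.max a b))) at 2. apply Rmult_le_compat_l; [apply pos_INR|].
  rewrite <- Rinv_1. apply Rinv_le_contravar; lra.
Qed.

Theorem theorem2p9 :
  forall zeta : C -> C, is_riemann_zeta zeta ->
  exists C0 : R, 0 < C0 /\
  forall sigma : R, 1 / 2 < sigma ->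
  exists c_sigma : R, 0 < c_sigma /\
  forall (T : R) (K : list nat) (eps : R),
    finite_set_pos K ->
    factor_closed K ->
    INR (list_max K) <= T ->
    c_sigma <= max_ratio K ->
    0 <= eps < sigma ->
    exists M : R,
      is_maximum
        (fun y : R => exists t : R, 1 <= t <= T /\ y = Cmod (zeta (sigma, t)) ^ 2) M /\
      (1 + C0) * sum_over K (fun n => 1 / Rpower (INR n) (2 * eps)) * M
      >= Re (zeta (RtoC (2 * sigma))) / 2
           * sum_over K (fun n =>
               sigma_div (- sigma + eps) n ^ 2 / Rpower (INR n) (2 * eps))
         - 1 / Rpower T (2 * sigma - 1)
           * sum_over K (fun l => 1 / Rpower (INR l) eps)
           * sum_over K (fun k =>
               Rpower (INR k) (1 - sigma - eps) * ln (INR k * T)).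
Proof.
  intros zeta Hz. destruct case_line_one as (C1 & HC1 & HI).
  (* One summand for each range of sigma. [131073 = 1 + 2^17] bounds [zeta (2 sigma)] for [sigma >=
     1/2 + width / 16 = 1/2 + 2^(-18)]. *)
  set (C0 := C1 + 131073 * (1536 * 1536) + 8 * (1536 * 1536)).
  exists C0. split; [unfold C0; lra|]. intros sigma Hsig.
  destruct (zeta_real_bounds zeta (2 * sigma) Hz ltac:(lra)) as [HZ0 HZ1].
  change (fst (zeta (RtoC (2 * sigma)))) with (Re (zeta (RtoC (2 * sigma)))) in *.
  set (Z := Re (zeta (RtoC (2 * sigma)))) in *.
  assert (Hmain : exists T0, 3 <= T0 /\ forall T S K e, T0 <= T -> zeta_bound zeta sigma T S -> pos_set K -> (forall n, In n K -> INR n <= T) -> 0 <= e <= sigma ->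
    lsum K (wt e) * lsum K (fun k => Rpower (INR k) (1 - sigma) * wt e k) <= Z / 2 * Rpower T (2 * sigma - 1) * sqsum K (conv sigma e) ->
    Z / 2 * sqsum K (conv sigma e) <= C0 * (S * S) * sqsum K (wt e)).
  { assert (Wid : width = / 16384) by reflexivity.
    assert (Up : forall c S K e, 0 <= c <= C0 -> c * (S * S) * sqsum K (wt e) <= C0 * (S * S) * sqsum K (wt e)).
    { intros c S K e Hc. apply Rmult_le_compat_r; [apply sqsum_nonneg|]. apply Rmult_le_compat_r; [apply Rle_0_sqr|lra]. }
    destruct (Rle_or_lt 1 sigma) as [L1|L1]; [|destruct (Rlt_or_le sigma (1 / 2 + width / 16)) as [L2|L2]].
    - destruct (HI zeta Hz sigma L1) as (T0 & HT0 & H). exists T0. split; [exact HT0|].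
      intros T S K e HT HS HK HKT He _. specialize (H T S K e HT HS HK HKT).
      apply Rle_trans with (C1 * (S * S) * sqsum K (wt e)); [|apply Up; unfold C0; lra].
      assert (/ (2 * sigma - 1) <= 1) by (rewrite <- Rinv_1; apply Rinv_le_contravar; lra).
      eapply Rle_trans; [|exact H]. rewrite <- (Rmult_1_l (sqsum K (conv sigma e))) at 2.
      apply Rmult_le_compat_r; [apply sqsum_nonneg|lra].
    - destruct (strip_near_half zeta sigma (Z / 2) Hz ltac:(lra) ltac:(lra)) as (T0 & HT0 & H). exists T0. split; [exact HT0|].
      intros T S K e HT HS HK HKT He HR. eapply Rle_trans; [apply (H T S K e); assumption|]. apply Up. unfold C0. lra.
    - destruct (strip_away zeta sigma (Z / 2) Hz ltac:(lra) ltac:(lra)) as (T0 & HT0 & H). exists T0. split; [exact HT0|].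
      intros T S K e HT HS HK HKT He HR. eapply Rle_trans; [apply (H T S K e); assumption|]. apply Up.
      assert (/ (2 * sigma - 1) <= 131072).
      { replace 131072 with (/ / 131072) by field. apply Rinv_le_contravar; [lra|]. rewrite Wid in L2. lra. }
      unfold C0. lra. }
  (* The threshold for [T] is the witness for [c_sigma]. *)
  destruct Hmain as (T0 & HT0 & Hmain). exists T0. split; [lra|].
  intros T K e [NK PK] FK HKmax Hratio He.
  destruct (max_ratio_bound K T0 T PK ltac:(lra) Hratio HKmax) as [HT [k0 Hk0]].
  destruct (zeta_vertical_maximum zeta sigma T Hz ltac:(lra)) as [M HM]. exists M. split; [exact HM|].
  destruct HM as [(t0 & Ht0 & EM) HMub].
  assert (HM0 : 0 <= M) by (rewrite EM; apply pow2_ge_0).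
  assert (HS : zeta_bound zeta sigma T (sqrt M)).
  { split; [apply sqrt_pos|]. intros t Ht. eapply Rle_trans; [apply Rle_abs|]. eapply Rle_trans; [apply (re_le_Cmod (zeta (sigma, t)))|].
    rewrite <- (sqrt_pow2 (Cmod (zeta (sigma, t)))) by apply Cmod_ge_0. apply sqrt_le_1_alt. apply HMub. exists t. split; [exact Ht|reflexivity]. }
  assert (HK : pos_set K).
  { split; [exact NK|]. split; [intros n Hn; apply PK, Hn|]. split; [exact FK|]. apply (FK 1%nat k0); [apply Nat.divide_1_l|exact Hk0]. }
  assert (HKT : forall n, In n K -> INR n <= T).
  { intros n Hn. eapply Rle_trans; [|exact HKmax]. apply le_INR.
    pose proof (proj1 (list_max_le K (list_max K)) (le_n _)) as LM. rewrite Forall_forall in LM. auto. }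
  assert (EW : sum_over K (fun n => 1 / Rpower (INR n) (2 * e)) = sqsum K (wt e)).
  { apply lsum_ext. intros n _. unfold wt, Rdiv. rewrite <- Rpower_plus, Rmult_1_l, <- Rpower_Ropp. f_equal. ring. }
  assert (EV : sum_over K (fun n => sigma_div (- sigma + e) n ^ 2 / Rpower (INR n) (2 * e)) = sqsum K (conv sigma e)).
  { apply lsum_ext. intros n Hn. rewrite conv_sigma by (apply PK, Hn). unfold wt, Rdiv. rewrite <- Rpower_Ropp.
    replace (- (2 * e)) with (- e + - e) by ring. rewrite Rpower_plus. ring. }
  assert (EL : sum_over K (fun l => 1 / Rpower (INR l) e) = lsum K (wt e)).
  { apply lsum_ext. intros n _. unfold wt, Rdiv. rewrite Rmult_1_l, <- Rpower_Ropp. reflexivity. }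
  rewrite EW, EV, EL. set (R0 := sum_over K _).
  assert (HlnT : 1 <= ln T).
  { rewrite <- (ln_exp 1). apply ln_le_ln; [apply exp_pos|]. pose proof exp_le_3. lra. }
  (* [ln (k T) >= ln T >= 1], so the sum without the logarithm is smaller and inherits the bound. *)
  assert (HR0 : lsum K (fun k => Rpower (INR k) (1 - sigma) * wt e k) <= R0).
  { apply lsum_le. intros k Hk. unfold wt. rewrite <- Rpower_plus. replace (1 - sigma + - e) with (1 - sigma - e) by ring.
    rewrite <- (Rmult_1_r (Rpower _ _)) at 1. apply Rmult_le_compat_l; [left; apply Rpower_pos|].
    assert (Hk1 : 1 <= INR k) by (apply INR_pos_ge1, PK, Hk). eapply Rle_trans; [exact HlnT|]. apply ln_le_ln; nra. }
  assert (HL : 0 <= lsum K (wt e)) by (apply lsum_nonneg; intros; left; apply wt_pos).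
  assert (HRpos : 0 <= R0).
  { eapply Rle_trans; [|exact HR0]. apply lsum_nonneg; intros. apply Rmult_le_pos; left; apply Rpower_pos. }
  pose proof (sqsum_nonneg K (wt e)) as HW. set (W := sqsum K (wt e)) in *. set (V := sqsum K (conv sigma e)) in *. set (L := lsum K (wt e)) in *.
  assert (HTp : 0 < Rpower T (2 * sigma - 1)) by apply Rpower_pos. set (Tp := Rpower T (2 * sigma - 1)) in *.
  assert (Herr : 0 <= 1 / Tp * L * R0).
  { apply Rmult_le_pos; [apply Rmult_le_pos; [left; apply Rdiv_lt_0_compat; lra|exact HL]|exact HRpos]. }
  apply Rle_ge.
  (* Either the right-hand side of the theorem is at most 0, or multiplication by [T^(2 sigma - 1)]
     turns its positivity into the l1 condition of [Hmain]. *)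
  destruct (Rle_or_lt (Z / 2 * V) (1 / Tp * L * R0)) as [Hneg|Hposi].
  - apply Rle_trans with 0; [lra|]. assert (0 < C0) by (unfold C0; lra). repeat apply Rmult_le_pos; lra.
  - apply Rle_trans with (Z / 2 * V); [lra|].
    assert (HC : L * R0 <= Z / 2 * Tp * V).
    { apply (Rmult_le_reg_l (1 / Tp)); [apply Rdiv_lt_0_compat; lra|]. replace (1 / Tp * (Z / 2 * Tp * V)) with (Z / 2 * V) by (field; lra). lra. }
    eapply Rle_trans; [apply (Hmain T (sqrt M) K e HT HS HK HKT ltac:(lra))|].
    + eapply Rle_trans; [|exact HC]. apply Rmult_le_compat_l; assumption.
    + rewrite sqrt_sqrt by exact HM0. fold W. assert (0 <= W * M) by (apply Rmult_le_pos; assumption). lra.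
Qed.
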